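(* Let $n\ge 1$, let $z_1,\dots,z_m$ be distinct points of $\mathbb{B}^n$ and let $w_1,\dots,w_m\in\mathbb{D}$. Then there exists $\varphi\in\mathcal{S}(\mathbb{B}^n)$ with $\varphi(z_j)=w_j$ for all $j=1,\dots,m$ if and only if there exists a sequence of inner functions $\{\varphi_k\}_k\subseteq\mathcal{I}(\mathbb{B}^n)$ such that $\lim_{k\to\infty}\varphi_k(z_j)=w_j$ for each $j=1,\dots,m$.
   Context: $\mathbb{B}^n$ is the open unit ball of $\mathbb{C}^n$, $\mathbb{D}=\mathbb{B}^1$, $\mathbb{S}^n=\partial\mathbb{B}^n$. $H^\infty(\mathbb{B}^n)$ is the algebra of bounded analytic functions on $\mathbb{B}^n$ with the supremum norm, and $\mathcal{S}(\mathbb{B}^n)=\{\varphi\in H^\infty(\mathbb{B}^n):\|\varphi\|_\infty\le 1\}$. A function $\varphi\in H^\infty(\mathbb{B}^n)$ is inner if its boundary function (given by $K$-limits, equivalently a.e. by radial limits) satisfies $|\varphi(\zeta)|=1$ for almost every $\zeta\in\mathbb{S}^n$ with respect to surface measure; $\mathcal{I}(\mathbb{B}^n)$ is the set of inner functions (unimodular constants included). *)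

(* Defs.v *)
From HB Require Import structures.
From mathcomp Require Import all_boot all_order all_algebra.
From mathcomp Require Import all_classical all_reals all_analysis.
From mathcomp Require Import measurable_realfun complex.

Set Implicit Arguments.
Unset Strict Implicit.
Unset Printing Implicit Defensive.

Import Order.TTheory GRing.Theory Num.Theory.
Import numFieldNormedType.Exports.

Local Open Scope classical_set_scope.
Local Open Scope ring_scope.

(* R[i] gets the topology that MathComp-Analysis puts on every numFieldType
   (the one of its norm); as the instances of the library are keyed on the
   structures, they have to be transported to the concrete type R[i]. *)
HB.instance Definition _ (R : rcfType) := GRing.ComAlgebra.copy R[i] R[i]^o.
HB.instance Definition _ (R : rcfType) := Vector.copy R[i] R[i]^o.
HB.instance Definition _ (R : rcfType) := NormedModule.copy R[i] R[i]^o.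

Notation Rspace R d := (d.-tuple (measurableTypeR R)).

Section lebesgue_measure_Rspace.
Variable R : realType.

Section step.
Variables (d : nat) (mu : {sigma_finite_measure set (Rspace R d) -> \bar R}).

Definition cons_pair (x : measurableTypeR R * Rspace R d) : Rspace R d.+1 :=
  [the d.+1.-tuple _ of x.1 :: x.2].

Lemma measurable_cons_pair : measurable_fun [set: _] cons_pair.
Proof. exact: measurable_cons. Qed.

Definition lebesgue_step : set (Rspace R d.+1) -> \bar R :=
  pushforward (@lebesgue_measure R \x mu)%E cons_pair.

HB.instance Definition _ := Measure.copy lebesgue_step
  (measure_function_pushforward__canonical__measure_function_Measure
    (@lebesgue_measure R \x mu)%E measurable_cons_pair).

Lemma lebesgue_step_sigma_finite : sigma_finite setT lebesgue_step.
Proof.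
have /sigma_finiteP[F [TF ndF Foo]] := sigma_finiteT (@lebesgue_measure R).
have /sigma_finiteP[G [TG ndG Goo]] := sigma_finiteT mu.
pose H n : set (Rspace R d.+1) :=
  [set t | F n (thead t) /\ G n [tuple of behead t]].
have consH n : cons_pair @^-1` H n = F n `*` G n.
  by apply/seteqP; split=> -[x t] /=;
    rewrite /H/= theadE (_ : [tuple of _] = t)//; exact: val_inj.
exists H.
  apply/seteqP; split=> // t _.
  have [i _ Fi] : (\bigcup_i F i) (thead t) by rewrite -TF.
  have [j _ Gj] : (\bigcup_j G j) [tuple of behead t] by rewrite -TG.
  exists (maxn i j) => //; split.
    by move: Fi; exact/subsetPset/ndF/leq_maxl.
  by move: Gj; exact/subsetPset/ndG/leq_maxr.
move=> n; have [mF Fn] := Foo n; have [mG Gn] := Goo n; split.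
  rewrite (_ : H n = (fun t : Rspace R d.+1 => tnth t ord0) @^-1` F n `&`
    (fun t : Rspace R d.+1 => [tuple of behead t]) @^-1` G n)//.
  apply: measurableI; rewrite -[X in measurable X]setTI.
    exact: measurable_tnth.
  exact: measurable_behead.
rewrite /lebesgue_step /pushforward consH product_measure1E//.
by rewrite lte_mul_pinfty// ge0_fin_numE.
Qed.

HB.instance Definition _ :=
  Measure_isSigmaFinite.Build _ _ _ lebesgue_step lebesgue_step_sigma_finite.

End step.

Fixpoint lebesgue_measure_Rspace (d : nat) :
    {sigma_finite_measure set (Rspace R d) -> \bar R} :=
  match d with
  | 0 => \d_([tuple] : Rspace R 0)
  | d.+1 => lebesgue_step (lebesgue_measure_Rspace d)
  end.

Lemma lebesgue_measure_Rspace_box (d : nat) (A : 'I_d -> set (measurableTypeR R)) :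
  (forall i, measurable (A i)) ->
  lebesgue_measure_Rspace d [set t | forall i, A i (tnth t i)] =
  (\prod_(i < d) lebesgue_measure (A i))%E.
Proof.
elim: d A => [|d IHd] A mA.
  rewrite big_ord0 /= diracE mem_set//; by case.
rewrite big_ord_recl /= /lebesgue_step /pushforward.
rewrite -IHd; last by move=> i; exact: mA.
rewrite -product_measure1E//; last first.
  rewrite (_ : [set t | _] = \bigcap_(i in [set: 'I_d])
      ((fun t : Rspace R d => tnth t i) @^-1` A (lift ord0 i))); last first.
    by apply/seteqP; split => [t At i _|t At i] /=; [exact: At|exact: At].
  apply: fin_bigcap_measurable => // i _; rewrite -[X in measurable X]setTI.
  exact: measurable_tnth.
congr (_ _); apply/seteqP; split => -[x t] /=.
  move=> h; split; first by have := h ord0; rewrite tnth0.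
  by move=> i; have := h (lift ord0 i); rewrite tnthS.
by move=> [Ax At] i; case: (unliftP ord0 i) => [j|] ->; rewrite ?tnthS ?tnth0.
Qed.

End lebesgue_measure_Rspace.

Section surface_measure.
Variables (R : realType) (d : nat).

Definition enorm (t : Rspace R d) : R :=
  Num.sqrt (\sum_(i < d) (tnth t i : R) ^+ 2).

Definition direction (t : Rspace R d) : Rspace R d :=
  [tuple (tnth t i : R) / enorm t | i < d].

Definition punctured_ball : set (Rspace R d) := [set t | 0 < enorm t <= 1].

Lemma measurable_enorm : measurable_fun [set: Rspace R d] enorm.
Proof.
apply: (@measurableT_comp _ _ _ _ _ _ (@Num.sqrt R)).
  by apply: continuous_measurable_fun; exact: sqrt_continuous.
by apply: measurable_sum => i; apply: measurable_funX; exact: measurable_tnth.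
Qed.

Lemma measurable_direction : measurable_fun [set: Rspace R d] direction.
Proof.
apply/measurable_fun_tnthP => i.
rewrite (_ : _ \o _ =
    (fun t => (tnth t i : R)) \* ((@powR R ^~ (- 1)) \o enorm)).
  apply: measurable_funM; first exact: measurable_tnth.
  by apply: measurableT_comp; [exact: measurable_powR|exact: measurable_enorm].
by apply/funext => t /=; rewrite tnth_mktuple powR_inv1// sqrtr_ge0.
Qed.

Lemma measurable_punctured_ball : measurable punctured_ball.
Proof.
rewrite (_ : punctured_ball = enorm @^-1` `]0, 1]%classic).
  by rewrite -[X in measurable X]setTI; exact: measurable_enorm.
by apply/seteqP; split=> t /=; rewrite in_itv.
Qed.

Definition cone_measure : set (Rspace R d) -> \bar R := pushforward
  (mrestr (lebesgue_measure_Rspace R d) measurable_punctured_ball) direction.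

HB.instance Definition _ := Measure.copy cone_measure
  (measure_function_pushforward__canonical__measure_function_Measure
    (mrestr (lebesgue_measure_Rspace R d) measurable_punctured_ball)
    measurable_direction).

(* The surface measure sigma of the unit sphere of R^d, as a measure on R^d that
   is carried by the sphere. It is given by integration in polar coordinates:
     sigma A = d * lambda {t | 0 < |t| <= 1 and t / |t| \in A} *)
Definition surface_measure : {measure set (Rspace R d) -> \bar R} :=
  mscale (d%:R%:nng : {nonneg R}) cone_measure.

Lemma surface_measureE A : surface_measure A =
  (d%:R%:E * lebesgue_measure_Rspace R d (direction @^-1` A `&` punctured_ball))%E.
Proof. by []. Qed.

Lemma surface_measure_sphere : {ae surface_measure, forall t, enorm t = 1}.
Proof.
exists (~` [set t | enorm t = 1]); split => //.
  apply: measurableC; rewrite -[X in measurable X]setTI.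
  by apply: (@measurable_enorm measurableT [set 1]); exact: measurable_set1.
rewrite surface_measureE (_ : _ `&` _ = set0) ?measure0 ?mule0//.
apply/seteqP; split => // t [/= h /andP[t0 t1]]; apply: h.
rewrite /enorm; under eq_bigr do rewrite tnth_mktuple exprMn.
rewrite -mulr_suml -{1}[X in X * _]sqr_sqrtr ?sumr_ge0// => [|i _]; last exact: sqr_ge0.
by rewrite -/(enorm t) -exprMn divff ?gt_eqF// expr1n sqrtr1.
Qed.

End surface_measure.

Arguments surface_measure R d : clear implicits.

Section several_complex_variables.
Variables (R : realType) (n : nat).
Implicit Types (z : 'rV[R[i]]_n) (phi : 'rV[R[i]]_n -> R[i]).

Definition unit_ball : set 'rV[R[i]]_n :=
  [set z | \sum_(k < n) `|z 0 k| ^+ 2 < 1].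

(* differentiable is Fréchet differentiability over the scalar field R[i],
   i.e., the differential is C-linear *)
Definition analytic_on_ball phi : Prop :=
  forall z, unit_ball z -> differentiable phi z.

Definition Hinfty phi : Prop :=
  analytic_on_ball phi /\
  exists M : R, forall z, unit_ball z -> Normc.normc (phi z) <= M.

Definition Hinfty_norm phi : R :=
  sup [set Normc.normc (phi z) | z in unit_ball].

Definition schur_class phi : Prop := Hinfty phi /\ Hinfty_norm phi <= 1.

(* (x, y) |-> x + i y, from R^n x R^n = R^2n to C^n *)
Definition complexify (t : Rspace R (n + n)) : 'rV[R[i]]_n :=
  \row_(k < n) (Complex (tnth t (lshift n k) : R) (tnth t (rshift n k) : R)).

Definition has_boundary_value phi z (l : R[i]) : Prop :=
  phi ((r%:C)%C *: z) @[r --> (1 : R)^'-] --> l.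

Definition inner_function phi : Prop :=
  Hinfty phi /\
  {ae surface_measure R (n + n), forall t : Rspace R (n + n),
    exists2 l, has_boundary_value phi (complexify t) l & `|l| = 1}.

End several_complex_variables.

(* Main.v *)
(* If the inner functions phi_k interpolate approximately, their pointwise limit
   along an ultrafilter is holomorphic, by the uniformity of the second order
   expansions of bounded holomorphic functions, and interpolates exactly. It is
   bounded by 1 because an inner function is: Cauchy's formula on the circles
   z e^(i th), averaged over the sphere with the invariance of the surface measure
   under z |-> e^(i th) z, gives
     int |phi(r t)|^N dt <= C sup_s int |phi(s t)|^N dt = C |S|   for all N,
   with C independent of N.

   Conversely, let phi be in the Schur class; it suffices to approximate
   f = rho phi(rho z), which is holomorphic beyond the ball and of modulus less
   than 1 on the closed ball, by inner functions on a ball of radius less than 1.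
   Put H = 1 - |f|^2 and add to f a sum of peaks u_y d H(y) e_y, where y runs over
   a lattice of small step, e_y(z) = exp(N <z, y> - N (1 + |y|^2) / 2) is a Gaussian
   bump around y on the sphere and is small inside the ball, and u_y is in
   {1, i, -1, -i}. By Gaussian sums the perturbation is at most H / 64 on the closed
   ball, whereas at every point of the sphere one of the peaks is at least c H, with
   c depending only on n. Averaging over the phases u_y, concavity shows that some
   choice of them multiplies the mean of sqrt H over the sphere by at most q < 1.
   Iterating, the functions converge locally uniformly in the ball to some F, while
   sum_k sqrt H_k is finite almost everywhere on the sphere; at such points the f_k
   converge to a unimodular number, which is the radial limit of F provided the
   k-th perturbation is small on a ball outside of which f_k almost equals its
   boundary values along the radii. *)

(* The square root in the mean of sqrt H decides the proof. Averaging over the phases of a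
   perturbation g turns H = 1 - |f|^2 into H - |g|^2; since |g| is at most a small multiple of H,
   the relative loss |g|^2 / H tends to 0 with H, and the mean of H would not decay at a fixed rate.
   The relative loss of sqrt H is of order (|g| / H)^2, which the peaks keep above a constant, so
   the means decay geometrically. As H <= sqrt H, the sum of the H_k is then finite almost
   everywhere too, and it controls the increments, which are at most H_k / 64.

   Each peak carries the value of H at its own node, whereas the bounds on the sum are wanted in
   terms of H at the point z. On the closed ball H is Lipschitz and bounded below, so its ratio
   between two points grows at most like a Gaussian exp(K |z - y|^2), which sufficiently narrow
   peaks absorb. The mesh 1/m of the lattice is therefore chosen with m^2 >= K, and the resulting
   constants depend only on n. *)
From HB Require Import structures.
Require Import Defs.
From mathcomp Require Import all_boot all_order all_algebra.
From mathcomp Require Import all_classical all_reals all_analysis.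
From mathcomp Require Import measurable_realfun complex ring lra.
Set Implicit Arguments.
Unset Strict Implicit.
Unset Printing Implicit Defensive.
Import Order.TTheory GRing.Theory Num.Theory.
Import numFieldNormedType.Exports.
Local Open Scope classical_set_scope.
Local Open Scope ring_scope.

(** * Complex numbers and complex differentiability *)

(* [CC R] is [R[i]] seen through one fixed numFieldType instance.  It is made
   opaque to unification, which otherwise diverges comparing the many
   convertible instances of ring operations on the concrete type [R[i]]. *)
Definition CC (R : realType) : numFieldType := R[i].

Section modulus.
Variable R : realType.
Local Notation C := (CC R).
Implicit Types (x y : C) (r s : R).

Definition cabs x : R := Normc.normc x.
Definition Re x : R := complex.Re x.
Definition Im x : R := complex.Im x.
Definition mkC r s : C := Complex r s.
Definition conjC x : C := conjc x.
Definition toC r : C := mkC r 0.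

Lemma Re_mkC r s : Re (mkC r s) = r. Proof. by []. Qed.
Lemma Im_mkC r s : Im (mkC r s) = s. Proof. by []. Qed.
Lemma CC_ext x y : Re x = Re y -> Im x = Im y -> x = y.
Proof. by rewrite /Re /Im; case: x y => [a b] [c d] /= -> ->. Qed.

Lemma ReD x y : Re (x + y) = Re x + Re y. Proof. by case: x y => [a b] [c d]. Qed.
Lemma ImD x y : Im (x + y) = Im x + Im y. Proof. by case: x y => [a b] [c d]. Qed.
Lemma ReN x : Re (- x) = - Re x. Proof. by case: x. Qed.
Lemma ImN x : Im (- x) = - Im x. Proof. by case: x. Qed.
Lemma ReB x y : Re (x - y) = Re x - Re y. Proof. by rewrite ReD ReN. Qed.
Lemma ImB x y : Im (x - y) = Im x - Im y. Proof. by rewrite ImD ImN. Qed.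
Lemma ReM x y : Re (x * y) = Re x * Re y - Im x * Im y.
Proof. by case: x y => [a b] [c d]. Qed.
Lemma ImM x y : Im (x * y) = Re x * Im y + Im x * Re y.
Proof. by case: x y => [a b] [c d]. Qed.
Lemma Re0 : Re 0 = 0. Proof. by []. Qed.
Lemma Im0 : Im 0 = 0. Proof. by []. Qed.
Lemma Re1 : Re 1 = 1. Proof. by []. Qed.
Lemma Im1 : Im 1 = 0. Proof. by []. Qed.
Lemma Re_conjC x : Re (conjC x) = Re x. Proof. by case: x. Qed.
Lemma Im_conjC x : Im (conjC x) = - Im x. Proof. by case: x. Qed.
Lemma Re_toC r : Re (toC r) = r. Proof. by []. Qed.
Lemma Im_toC r : Im (toC r) = 0. Proof. by []. Qed.

Definition CE := (ReD, ImD, ReN, ImN, ReM, ImM, Re_mkC, Im_mkC, Re0, Im0, Re1, Im1,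
  Re_conjC, Im_conjC, Re_toC, Im_toC).

Lemma mkC_Re_Im x : mkC (Re x) (Im x) = x.
Proof. by apply: CC_ext. Qed.
Lemma toC0 : toC 0 = 0. Proof. by []. Qed.
Lemma toC1 : toC 1 = 1. Proof. by []. Qed.
Lemma toCD r s : toC (r + s) = toC r + toC s.
Proof. by apply: CC_ext; rewrite !CE//; ring. Qed.
Lemma toCM r s : toC (r * s) = toC r * toC s.
Proof. by apply: CC_ext; rewrite !CE//; ring. Qed.
Lemma toCN r : toC (- r) = - toC r.
Proof. by apply: CC_ext; rewrite !CE//; ring. Qed.
Lemma ltr_toC r s : (toC r < toC s) = (r < s). Proof. exact: ltcR. Qed.
Lemma ler_toC r s : (toC r <= toC s) = (r <= s). Proof. exact: lecR. Qed.
Lemma gt0_toC x : 0 < x -> x = toC (Re x) /\ 0 < Re x.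
Proof.
case: x => a b; rewrite ltcE /= => /andP[/eqP b0 a0]; split => //.
by rewrite /toC /mkC /Re /= b0.
Qed.
Lemma ge0_toC x : 0 <= x -> x = toC (Re x) /\ 0 <= Re x.
Proof.
case: x => a b; rewrite lecE /= => /andP[/eqP b0 a0]; split => //.
by rewrite /toC /mkC /Re /= b0.
Qed.

Lemma norm_cabs x : `|x| = toC (cabs x).
Proof. by case: x. Qed.

Lemma sqr_cabs x : cabs x ^+ 2 = Re x ^+ 2 + Im x ^+ 2.
Proof.
by case: x => a b; rewrite /cabs /Re /Im /= sqr_sqrtr// addr_ge0// sqr_ge0.
Qed.

Lemma cabs_ge0 x : 0 <= cabs x.
Proof. by case: x => a b; exact: sqrtr_ge0. Qed.

Lemma cabsD x y : cabs (x + y) <= cabs x + cabs y.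
Proof. exact: le_normcD. Qed.

Lemma cabsM x y : cabs (x * y) = cabs x * cabs y.
Proof. exact: Normc.normcM. Qed.

Lemma cabsV x : cabs x^-1 = (cabs x)^-1.
Proof. exact: Normc.normcV. Qed.

Lemma cabsN x : cabs (- x) = cabs x.
Proof. exact: normcN. Qed.

Lemma cabs0 : cabs 0 = 0. Proof. exact: Normc.normc0. Qed.

Lemma cabs1 : cabs 1 = 1. Proof. exact: Normc.normc1. Qed.

Lemma cabs_eq0 x : (cabs x == 0) = (x == 0).
Proof.
apply/eqP/eqP => [/Normc.eq0_normc//|->]; exact: cabs0.
Qed.

Lemma conjCV x : conjC x^-1 = (conjC x)^-1.
Proof. exact: conjc_inv. Qed.

End modulus.

#[global] Opaque CC.

Section modulus_theory.
Variable R : realType.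
Local Notation C := (CC R).
Implicit Types (x y : C) (r s : R).

Lemma cabsB x y : cabs (x - y) <= cabs x + cabs y.
Proof. by rewrite -(cabsN y) cabsD. Qed.

Lemma cabsC x y : cabs (x - y) = cabs (y - x).
Proof. by rewrite -cabsN opprB. Qed.

Lemma cabsX x k : cabs (x ^+ k) = cabs x ^+ k.
Proof.
elim: k => [|k IH]; first by rewrite !expr0 cabs1.
by rewrite !exprS cabsM IH.
Qed.

Lemma cabs_gt0 x : (0 < cabs x) = (x != 0).
Proof. by rewrite lt_def cabs_ge0 andbT cabs_eq0. Qed.

Lemma cabs_sqrt x : cabs x = Num.sqrt (Re x ^+ 2 + Im x ^+ 2).
Proof. by rewrite -sqr_cabs sqrtr_sqr ger0_norm ?cabs_ge0. Qed.

Lemma cabs_toC r : cabs (toC r) = `|r|.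
Proof. by rewrite cabs_sqrt !CE expr0n addr0 sqrtr_sqr. Qed.

Lemma Re_le_cabs x : `|Re x| <= cabs x.
Proof.
by rewrite -(@ler_pXn2r _ 2) ?nnegrE ?cabs_ge0// sqr_cabs real_normK ?num_real// lerDl sqr_ge0.
Qed.

Lemma Im_le_cabs x : `|Im x| <= cabs x.
Proof.
by rewrite -(@ler_pXn2r _ 2) ?nnegrE ?cabs_ge0// sqr_cabs real_normK ?num_real// lerDr sqr_ge0.
Qed.

Lemma cabs_leD x : cabs x <= `|Re x| + `|Im x|.
Proof.
rewrite -(@ler_pXn2r _ 2) ?nnegrE ?cabs_ge0 ?addr_ge0// sqr_cabs sqrrD.
by rewrite !real_normK ?num_real// lerD2r lerDl mulrn_wge0// mulr_ge0.
Qed.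

Lemma cabsB_dist x y : `|cabs x - cabs y| <= cabs (x - y).
Proof.
rewrite ler_norml; apply/andP; split.
  rewrite lerNl opprB lerBlDr cabsC.
  by apply: le_trans (cabsD _ _); rewrite subrK.
by rewrite lerBlDr; apply: le_trans (cabsD _ _); rewrite subrK.
Qed.

Lemma conjC_mul x : conjC x * x = toC (cabs x ^+ 2).
Proof. by rewrite sqr_cabs; apply: CC_ext; rewrite !CE; ring. Qed.

Lemma cabs_conjC x : cabs (conjC x) = cabs x.
Proof. by rewrite !cabs_sqrt !CE sqrrN. Qed.

Lemma conjC1B x y : conjC (1 - x * y) = 1 - conjC x * conjC y.
Proof. by apply: CC_ext; rewrite !CE; ring. Qed.

(** Reduces bounds for a modulus to bounds for a real part, to which the real mean value theorem and
    real integrals apply. *)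
Lemma cabs_phase x : exists2 u, cabs u = 1 & Re (u * x) = cabs x.
Proof.
have [->|x0] := eqVneq x 0; first by exists 1; rewrite ?cabs1// mulr0 cabs0 Re0.
have n0 : cabs x != 0 by rewrite cabs_eq0.
exists (conjC x * toC (cabs x)^-1).
  by rewrite cabsM cabs_toC ger0_norm ?invr_ge0 ?cabs_ge0// cabs_conjC divff.
rewrite mulrAC conjC_mul -toCM Re_toC.
by rewrite expr2 mulfK.
Qed.

Lemma cabs_cvgP (T : Type) (F : set_system T) {FF : Filter F} (f : T -> C) l :
  (f @ F --> l) <-> forall e : R, 0 < e -> \forall x \near F, cabs (f x - l) < e.
Proof.
split.
  move=> /cvgrPdist_lt h e e0.
  have /h : 0 < toC e by rewrite -toC0 ltr_toC.
  by apply: filterS => x; rewrite norm_cabs ltr_toC cabsC.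
move=> h; apply/cvgrPdist_lt => e /gt0_toC[-> e2].
move: (h _ e2); apply: filterS => x.
by rewrite norm_cabs ltr_toC cabsC.
Qed.

End modulus_theory.

Section bridge.
Variable R : realType.
Local Notation C := (CC R).

(** Norms of modules over [CC R] take values in [CC R]; this is the same norm as a real number. *)
Definition rnorm (V : normedModType C) (v : V) : R := Re `|v|.

Lemma norm_rnorm (V : normedModType C) (v : V) : `|v| = toC (rnorm v).
Proof. by have [] : _ /\ _ := @ge0_toC R `|v| (normr_ge0 v). Qed.

Lemma rnorm_cabs (x : C) : rnorm x = cabs x.
Proof. by rewrite /rnorm norm_cabs Re_toC. Qed.

Lemma near0_rnormP (V : normedModType C) (P : V -> Prop) :
  (\forall h \near (0 : V), P h) <->
  exists2 d : R, 0 < d & forall h, rnorm h < d -> P h.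
Proof.
split=> [/nbhs_normP[d /= /gt0_toC[dE d0] h]|[d d0 h]].
  exists (Re d) => // k kd; apply: h.
  by rewrite /= sub0r normrN norm_rnorm dE ltr_toC.
apply/nbhs_normP; exists (toC d) => /=; first by rewrite -toC0 ltr_toC.
by move=> k; rewrite /= sub0r normrN norm_rnorm ltr_toC; apply: h.
Qed.

Lemma differentiable_expansion (V : normedModType C) (f : V -> C) (a : V) :
  differentiable f a ->
  forall e : R, 0 < e -> exists2 d : R, 0 < d & forall h : V, rnorm h < d ->
    cabs (f (a + h) - f a - 'd f a h) <= e * rnorm h.
Proof.
move=> /diff_locally /eqaddoP df e e0.
have e0' : 0 < toC e by rewrite -toC0 ltr_toC.
have /near0_rnormP[d d0 hd] := df _ e0'.
exists d => // h /hd /=.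
rewrite !fctE /shift /= norm_cabs norm_rnorm -toCM ler_toC.
by rewrite [h + a]addrC opprD addrA.
Qed.

Lemma expansion_differentiable (V : normedModType C) (f : V -> C) (a : V)
    (L : {linear V -> C}) : continuous L ->
  (forall e : R, 0 < e -> exists2 d : R, 0 < d & forall h : V, rnorm h < d ->
    cabs (f (a + h) - f a - L h) <= e * rnorm h) ->
  differentiable f a /\ forall h, 'd f a h = L h.
Proof.
move=> cL H.
have E : f \o shift a = cst (f a) + L +o_ 0 id.
  apply/eqaddoP => e /gt0_toC[eE e0].
  apply/near0_rnormP; have [d d0 hd] := H _ e0; exists d => // h /hd.
  rewrite !fctE /shift /= norm_cabs norm_rnorm eE -toCM ler_toC.
  by rewrite [h + a]addrC opprD addrA.
have dE := diff_unique cL E.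
split; last by move=> h; rewrite dE.
by apply/diff_locallyP; rewrite dE.
Qed.

(** The lock keeps conversion from unfolding the differential. *)
Fact cderive_key : unit. Proof. exact: tt. Qed.
Definition cderive : (C -> C) -> C -> C :=
  locked_with cderive_key (fun (f : C -> C) (a : C) => 'd f a 1).

Lemma cderiveE (f : C -> C) (a : C) : cderive f a = 'd f a 1.
Proof. by rewrite /cderive unlock. Qed.

Lemma cderive_expansion (f : C -> C) a : differentiable f a ->
  forall e : R, 0 < e -> exists2 d : R, 0 < d & forall h, cabs h < d ->
    cabs (f (a + h) - f a - h * cderive f a) <= e * cabs h.
Proof.
move=> df e e0; have [d d0 H] := differentiable_expansion df e0.
exists d => // h hd; have := H h; rewrite rnorm_cabs => /(_ hd).
rewrite cderiveE; have -> // : 'd f a h = h * 'd f a 1.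
by rewrite -[in LHS](mulr1 h) -[h * 1]/(h *: (1 : C)) linearZ.
Qed.

Lemma expansion_cderive (f : C -> C) a l :
  (forall e : R, 0 < e -> exists2 d : R, 0 < d & forall h, cabs h < d ->
    cabs (f (a + h) - f a - h * l) <= e * cabs h) ->
  differentiable f a /\ cderive f a = l.
Proof.
move=> H.
pose D (h : C) : C := h * l.
have linD : linear D by move=> k u v; rewrite /D mulrDl /= scalerAl.
pose LD : {linear C -> C} := HB.pack D (GRing.isLinear.Build _ _ _ _ _ linD).
have cL : continuous (LD : C -> C) by exact: (@scalel_continuous _ C l).
have [] := @expansion_differentiable C f a LD cL.
  move=> e e0; have [d d0 Hd] := H _ e0; by exists d => // h; rewrite ?rnorm_cabs; exact: Hd.
by move=> ? h; split => //; rewrite cderiveE h /= /D mul1r.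
Qed.

Lemma differentiable_cvg (f : C -> C) a : differentiable f a ->
  forall e : R, 0 < e -> exists2 d : R, 0 < d & forall h, cabs h < d ->
    cabs (f (a + h) - f a) <= e.
Proof.
move=> df e e0; have [d d0 H] := cderive_expansion df (@ltr01 R).
have K0 : 0 < 1 + cabs (cderive f a) by rewrite ltr_pwDl ?cabs_ge0.
exists (Num.min d (e / (1 + cabs (cderive f a)))).
  by rewrite lt_min d0 divr_gt0.
move=> h; rewrite lt_min => /andP[/H hd he].
rewrite -(subrK (h * cderive f a) (f (a + h) - f a)).
apply: le_trans (cabsD _ _) _; rewrite cabsM.
apply: le_trans (lerD hd (lexx _)) _.
by rewrite mul1r -{1}[cabs h]mulr1 -mulrDr ltW// -ltr_pdivlMr.
Qed.

End bridge.

(** * Goursat's theorem *)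

Section real_calculus.
Variable R : realType.
Implicit Types (f g P : R -> R).

Lemma is_derive_expansion f (x l : R) : is_derive x 1 f l ->
  forall e : R, 0 < e -> exists2 d : R, 0 < d & forall h, `|h| < d ->
    `|f (x + h) - f x - h * l| <= e * `|h|.
Proof.
move=> [df <-] e e0; have /cvgrPdist_le/(_ _ e0) := df.
rewrite near_withinE => /nbhs_normP[d /= d0 H]; exists d => // h hd.
have [->|h0] := eqVneq h 0; first by rewrite addr0 subrr mul0r subrr normr0 mulr0.
have := H h; rewrite /= sub0r normrN => /(_ hd h0).
rewrite -(ler_pM2l (x := `|h|)) ?normr_gt0// -normrM mulrBr [X in _ <= X]mulrC; apply: le_trans.
rewrite le_eqVlt; apply/predU1P; left.
have -> : f (x + h) - f x = h * (h^-1 *: (f (h *: 1 + x) - f x)).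
  by rewrite -[h^-1 *: _]/(h^-1 * _) mulrA divff// mul1r [h *: 1]mulr1 [h + x]addrC.
by rewrite distrC.
Qed.

Lemma expansion_is_derive f (x l : R) :
  (forall e : R, 0 < e -> exists2 d : R, 0 < d & forall h, `|h| < d ->
    `|f (x + h) - f x - h * l| <= e * `|h|) -> is_derive x 1 f l.
Proof.
move=> H.
have C : h^-1 *: ((f \o shift x) (h *: 1) - f x) @[h --> 0^'] --> l.
  apply/cvgrPdist_le => e e0; rewrite near_withinE.
  have [d d0 Hd] := H _ e0; apply/nbhs_normP; exists d => //= h.
  rewrite /= sub0r normrN => hd h0; have := Hd _ hd.
  rewrite [h *: 1]mulr1 /shift /= [h + x]addrC.
  rewrite -ler_pdivrMr ?normr_gt0//; apply: le_trans.
  rewrite -normfV -normrM distrC le_eqVlt; apply/predU1P; left; congr (`| _ |).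
  by rewrite mulrBl [h * l]mulrC -mulrA divff// mulr1 [X in X = _]addrC mulrC addrC.
split; first by apply/cvg_ex; exists l.
by apply/cvg_lim.
Qed.

Lemma mvt_bound f df (a b K : R) : a <= b ->
  (forall x, a <= x <= b -> is_derive x 1 f (df x)) ->
  (forall x, a <= x <= b -> `|df x| <= K) -> `|f b - f a| <= K * (b - a).
Proof.
move=> ab fd fK; have [] := @MVT_segment R f df a b ab.
- by move=> x; rewrite in_itv /= => /andP[ax xb]; apply: fd; rewrite !ltW.
- apply: derivable_within_continuous => x; rewrite in_itv /= => xab.
  by have [] := fd x xab.
- move=> c; rewrite in_itv /= => cab ->.
  by rewrite normrM (ger0_norm (x := b - a)) ?subr_ge0// ler_wpM2r ?subr_ge0// fK.
Qed.

Lemma continuous_antiderivative f (a b : R) : continuous f -> a < b ->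
  exists2 P, (forall x, a <= x <= b -> is_derive x 1 P (f x)) &
    \int[lebesgue_measure]_(x in `[a, b]) f x = P b - P a.
Proof.
move=> cf ab.
have intf u v : lebesgue_measure.-integrable `[u, v] (EFin \o f).
  apply: continuous_compact_integrable; first exact: segment_compact.
  exact: continuous_subspaceT.
(* Integrating from [a - 1], inside an interval that ends at [b + 1], makes [a] and [b] interior
   points, so that the derivative is two-sided there. *)
pose P x := \int[lebesgue_measure]_(t in `[a - 1, x]) f t.
have dP x : a <= x <= b -> is_derive x 1 P (f x).
  move=> /andP[ax xb].
  have [|||d e] := @continuous_FTC1_closed R f (a - 1) x (b + 1) _ (intf _ _).
  - by rewrite ltr_pwDr.
  - by rewrite ltrBlDr ltr_pwDr.
  - exact: cf.
  by split; [exact: d|rewrite -derive1E].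
exists P => //.
rewrite /Rintegral (@continuous_FTC2 R f P a b ab) //.
- exact: continuous_subspaceT.
- have dc x : a <= x <= b -> {for x, continuous P}.
    move=> xab; apply: differentiable_continuous; apply/derivable1_diffP.
    by have [] := dP x xab.
  split.
  + by move=> x; rewrite in_itv /= => /andP[ax xb]; have [] := dP x _; rewrite ?(ltW ax) ?(ltW xb).
  + by apply: cvg_at_right_filter; apply: dc; rewrite lexx ltW.
  + by apply: cvg_at_left_filter; apply: dc; rewrite lexx ltW.
- move=> x; rewrite in_itv /= => /andP[ax xb]; rewrite derive1E.
  by have [] := dP x _; rewrite ?(ltW ax) ?(ltW xb).
Qed.

End real_calculus.

Section goursat.
Variable R : realType.
Variables (U V A B : R -> R -> R).

(* [rect_form] is the imaginary part of the integral of [(U + iV) dw] along the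
   boundary of a rectangle, where [A t] is a primitive of [V] along the line
   [Im w = t] and [B s] is a primitive of [U] along the line [Re w = s]. *)
Definition rect_form s1 s2 t1 t2 : R :=
  (A t1 s2 - A t1 s1) - (A t2 s2 - A t2 s1)
  + (B s2 t2 - B s2 t1) - (B s1 t2 - B s1 t1).
Local Notation J := rect_form.

Lemma rect_form_hsplit s1 s2 s3 t1 t2 :
  J s1 s3 t1 t2 = J s1 s2 t1 t2 + J s2 s3 t1 t2.
Proof. by rewrite /J; ring. Qed.

Lemma rect_form_vsplit s1 s2 t1 t2 t3 :
  J s1 s2 t1 t3 = J s1 s2 t1 t2 + J s1 s2 t2 t3.
Proof. by rewrite /J; ring. Qed.

Lemma is_derive_quadratic (u b p c x : R) :
  is_derive x 1 (fun x : R => u * x + b * ((x - p) ^+ 2 / 2) + c * x)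
    (u + b * (x - p) + c).
Proof.
apply: expansion_is_derive => e e0.
have b1 : 0 < `|b| + 1 by rewrite ltr_pwDr.
exists (e / (`|b| + 1)); first by rewrite divr_gt0.
move=> h; rewrite ltr_pdivlMr// => he.
rewrite (_ : _ - _ = h * (b / 2 * h)); last by field.
rewrite normrM mulrC ler_wpM2r// !normrM (@ger0_norm _ 2^-1) ?invr_ge0//.
apply: le_trans (ltW he).
rewrite [leRHS]mulrC ler_wpM2r//.
by have := normr_ge0 b; lra.
Qed.

(** The affine function u0 + i v0 + (a + ib)(w - (p + iq)) has the explicit primitives [A0] and
    [B0], on which the form vanishes. Only the error contributes, over a perimeter of length 2 ((s2
    - s1) + (t2 - t1)). *)
Lemma rect_form_le (s1 s2 t1 t2 p q u0 v0 a b K : R) : s1 <= s2 -> t1 <= t2 ->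
  (forall s t, s1 <= s <= s2 -> t1 <= t <= t2 -> is_derive s 1 (A t) (V s t)) ->
  (forall s t, s1 <= s <= s2 -> t1 <= t <= t2 -> is_derive t 1 (B s) (U s t)) ->
  (forall s t, s1 <= s <= s2 -> t1 <= t <= t2 ->
     `|U s t - (u0 + a * (s - p) - b * (t - q))| <= K /\
     `|V s t - (v0 + b * (s - p) + a * (t - q))| <= K) ->
  `|J s1 s2 t1 t2| <= 2 * K * ((s2 - s1) + (t2 - t1)).
Proof.
move=> s12 t12 dA dB H.
pose A0 t s := v0 * s + b * ((s - p) ^+ 2 / 2) + (a * (t - q)) * s.
pose B0 s t := u0 * t + (- b) * ((t - q) ^+ 2 / 2) + (a * (s - p)) * t.
have HA t : t1 <= t <= t2 ->
    `|(A t s2 - A0 t s2) - (A t s1 - A0 t s1)| <= K * (s2 - s1).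
  move=> tt; apply: (@mvt_bound R (A t \- A0 t)
      (fun s => V s t - (v0 + b * (s - p) + a * (t - q)))) => //.
    move=> s ss; apply: is_deriveB; first exact: dA.
    exact: is_derive_quadratic.
  by move=> s ss; have [] := H s t ss tt.
have HB s : s1 <= s <= s2 ->
    `|(B s t2 - B0 s t2) - (B s t1 - B0 s t1)| <= K * (t2 - t1).
  move=> ss; apply: (@mvt_bound R (B s \- B0 s)
      (fun t => U s t - (u0 + (- b) * (t - q) + a * (s - p)))) => //.
    move=> t tt; apply: is_deriveB; first exact: dB.
    exact: is_derive_quadratic.
  move=> t tt; have [+ _] := H s t ss tt; congr (`| _ | <= _); ring.
have l1 : s1 <= s1 <= s2 by rewrite lexx.
have l2 : s1 <= s2 <= s2 by rewrite lexx andbT.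
have m1 : t1 <= t1 <= t2 by rewrite lexx.
have m2 : t1 <= t2 <= t2 by rewrite lexx andbT.
have -> : J s1 s2 t1 t2 =
    ((A t1 s2 - A0 t1 s2) - (A t1 s1 - A0 t1 s1))
  - ((A t2 s2 - A0 t2 s2) - (A t2 s1 - A0 t2 s1))
  + ((B s2 t2 - B0 s2 t2) - (B s2 t1 - B0 s2 t1))
  - ((B s1 t2 - B0 s1 t2) - (B s1 t1 - B0 s1 t1)).
  by rewrite /J /A0 /B0; field.
have := HA _ m1; have := HA _ m2; have := HB _ l1; have := HB _ l2.
by rewrite !ler_norml => /andP[? ?] /andP[? ?] /andP[? ?] /andP[? ?]; lra.
Qed.

Lemma rect_form_quarter x y l m k : k <= `|J x (x + l) y (y + m)| ->
  exists x' y', [/\ x' = x \/ x' = x + l / 2, y' = y \/ y' = y + m / 2 &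
    k / 4 <= `|J x' (x' + l / 2) y' (y' + m / 2)|].
Proof.
have e1 : x + l / 2 + l / 2 = x + l by field.
have e2 : y + m / 2 + m / 2 = y + m by field.
rewrite (rect_form_hsplit _ (x + l / 2)).
rewrite (rect_form_vsplit _ (x + l / 2) _ (y + m / 2)).
rewrite (rect_form_vsplit (x + l / 2) _ _ (y + m / 2)) => H.
have [|h1] := leP (k / 4) `|J x (x + l / 2) y (y + m / 2)|.
  by move=> ?; exists x, y; split; [left|left|].
have [|h2] := leP (k / 4) `|J x (x + l / 2) (y + m / 2) (y + m)|.
  by move=> ?; exists x, (y + m / 2); split; [left|right|rewrite e2].
have [|h3] := leP (k / 4) `|J (x + l / 2) (x + l) y (y + m / 2)|.
  by move=> ?; exists (x + l / 2), y; split; [right|left|rewrite e1].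
exists (x + l / 2), (y + m / 2); split; [by right|by right|].
rewrite e1 e2 leNgt; apply/negP => h4.
move: H; rewrite leNgt => /negP; apply.
apply: le_lt_trans (ler_normD _ _) _.
have := ler_normD (J x (x + l / 2) y (y + m / 2)) (J x (x + l / 2) (y + m / 2) (y + m)).
have := ler_normD (J (x + l / 2) (x + l) y (y + m / 2)) (J (x + l / 2) (x + l) (y + m / 2) (y + m)).
lra.
Qed.

End goursat.

Lemma dyadic_nested (R : realType) (x : nat -> R) (L : R) : 0 <= L ->
  (forall n, x n.+1 = x n \/ x n.+1 = x n + L / 2 ^+ n / 2) ->
  exists p, forall n, x n <= p <= x n + L / 2 ^+ n.
Proof.
move=> L0 Hx.
have E n : L / 2 ^+ n = L / 2 ^+ n / 2 + L / 2 ^+ n / 2 by rewrite -splitr.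
have S n : L / 2 ^+ n.+1 = L / 2 ^+ n / 2 by rewrite exprSr invfM mulrA.
have P n : 0 <= L / 2 ^+ n / 2 by rewrite !mulr_ge0// ?invr_ge0 ?exprn_ge0.
have up n : x n <= x n.+1 by have := P n; case: (Hx n) => ->; lra.
have dn n : x n.+1 + L / 2 ^+ n.+1 <= x n + L / 2 ^+ n.
  by rewrite S [in leRHS]E; have := P n; case: (Hx n) => ->; lra.
have mono : {homo x : m n / (m <= n)%N >-> m <= n} by exact: homo_leq le_trans up.
have anti m n : (m <= n)%N -> x n + L / 2 ^+ n <= x m + L / 2 ^+ m.
  elim: n => [|n IH]; first by rewrite leqn0 => /eqP->.
  rewrite leq_eqVlt => /predU1P[->//|]; rewrite ltnS => /IH; exact: le_trans.
have ub m : ubound (range x) (x m + L / 2 ^+ m).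
  move=> _ [n _ <-]; have [mn|/ltnW nm] := leqP m n.
    apply: le_trans (anti _ _ mn); rewrite lerDl E; have := P n; lra.
  by apply: le_trans (mono _ _ nm) _; rewrite lerDl E; have := P m; lra.
exists (sup (range x)) => n; apply/andP; split.
  by apply: ub_le_sup; [exists (x 0%N + L / 2 ^+ 0)|exists n].
by apply: ge_sup => //; exists (x 0%N); exists 0%N.
Qed.

Lemma itv_sub (R : realType) (a b c d x : R) : a <= c -> d <= b ->
  c <= x <= d -> a <= x <= b.
Proof. by move=> ac db /andP[cx xd]; rewrite (le_trans ac) ?(le_trans xd). Qed.

Lemma itv_dist (R : realType) (x l p s : R) : x <= p <= x + l -> x <= s <= x + l ->
  `|s - p| <= l.
Proof. by move=> ? ?; rewrite ler_norml; lra. Qed.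

Section goursat_theorem.
Variable R : realType.
Variables (U V A B : R -> R -> R).
Local Notation J := (rect_form A B).

(** Complex differentiability of U + iV at s + it, with derivative a + ib, in real terms. *)
Definition cauchy_riemann_at (s t : R) := exists a b : R, forall e : R, 0 < e ->
  exists2 d : R, 0 < d & forall s' t', `|s' - s| < d -> `|t' - t| < d ->
    `|U s' t' - (U s t + a * (s' - s) - b * (t' - t))| <= e * (`|s' - s| + `|t' - t|) /\
    `|V s' t' - (V s t + b * (s' - s) + a * (t' - t))| <= e * (`|s' - s| + `|t' - t|).

Lemma goursat (s1 s2 t1 t2 : R) : s1 < s2 -> t1 < t2 ->
  (forall s t, s1 <= s <= s2 -> t1 <= t <= t2 -> is_derive s 1 (A t) (V s t)) ->
  (forall s t, s1 <= s <= s2 -> t1 <= t <= t2 -> is_derive t 1 (B s) (U s t)) ->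
  (forall s t, s1 <= s <= s2 -> t1 <= t <= t2 -> cauchy_riemann_at s t) ->
  J s1 s2 t1 t2 = 0.
Proof.
move=> s12 t12 dA dB CR; apply/eqP; rewrite -normr_eq0; apply: contraT => j0.
set j := `|_| in j0; have {j0} j0 : 0 < j by rewrite lt_def j0 normr_ge0.
pose L := s2 - s1; pose M := t2 - t1.
have L0 : 0 < L by rewrite subr_gt0.
have M0 : 0 < M by rewrite subr_gt0.
pose Q (n : nat) (z : R * R) :=
  j / 4 ^+ n <= `|J z.1 (z.1 + L / 2 ^+ n) z.2 (z.2 + M / 2 ^+ n)|.
(* A state of the bisection is its depth and a lower left corner. The last clause is an implication
   so that [T] is total, as dependent choice requires. *)
pose T (u v : nat * (R * R)) := [/\ v.1 = u.1.+1,
  v.2.1 = u.2.1 \/ v.2.1 = u.2.1 + L / 2 ^+ u.1 / 2,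
  v.2.2 = u.2.2 \/ v.2.2 = u.2.2 + M / 2 ^+ u.1 / 2 &
  Q u.1 u.2 -> Q v.1 v.2].
have totT u : {v | T u v}.
  apply/cid; have [q|nq] := pselect (Q u.1 u.2).
    have [x [y [hx hy hk]]] := rect_form_quarter q.
    exists (u.1.+1, (x, y)); split => // _; rewrite /Q /=.
    by rewrite !exprSr !invfM !mulrA.
  by exists (u.1.+1, u.2); split => //; left.
have [f [f0 fT]] := dependent_choice totT (0%N, (s1, t1)).
have f1 n : (f n).1 = n by elim: n => [|n IH]; [rewrite f0|have [->] := fT n; rewrite IH].
have fQ n : Q n (f n).2.
  elim: n => [|n IH]; last by have [_ _ _] := fT n; rewrite !f1; exact.
  by rewrite f0 /Q /= !expr0 !divr1 [s1 + L]addrC [t1 + M]addrC /L /M !subrK.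
have [|p hp] := @dyadic_nested R (fun n => (f n).2.1) L (ltW L0).
  by move=> n; have [_ + _ _] := fT n; rewrite f1.
have [|q hq] := @dyadic_nested R (fun n => (f n).2.2) M (ltW M0).
  by move=> n; have [_ _ + _] := fT n; rewrite f1.

have inx n : s1 <= (f n).2.1 /\ (f n).2.1 + L / 2 ^+ n <= s2.
  elim: n => [|n [IH1 IH2]].
    by rewrite f0 /= expr0 divr1 [s1 + L]addrC subrK.
  have l0 : 0 < L / 2 ^+ n by rewrite divr_gt0 ?exprn_gt0.
  have [_ + _ _] := fT n; rewrite f1 exprSr invfM mulrA.
  by case=> ->; split => //; lra.
have iny n : t1 <= (f n).2.2 /\ (f n).2.2 + M / 2 ^+ n <= t2.
  elim: n => [|n [IH1 IH2]].
    by rewrite f0 /= expr0 divr1 [t1 + M]addrC subrK.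
  have l0 : 0 < M / 2 ^+ n by rewrite divr_gt0 ?exprn_gt0.
  have [_ _ + _] := fT n; rewrite f1 exprSr invfM mulrA.
  by case=> ->; split => //; lra.
have pin : s1 <= p <= s2.
  by have := hp 0%N; have := inx 0%N; lra.
have qin : t1 <= q <= t2.
  by have := hq 0%N; have := iny 0%N; lra.
have [a [b ab]] := CR p q pin qin.
have LM0 : 0 < L + M by rewrite addr_gt0.
(* With this precision [rect_form_le] bounds the n-th rectangle by 2 e ((L + M) / 2^n)^2 = j / 4^n /
   2, half of what the bisection guarantees. *)
have e0 : 0 < j / (4 * (L + M) ^+ 2) by rewrite divr_gt0// mulr_gt0// exprn_gt0.
have [d d0 Hd] := ab _ e0.
have [n Hn] : exists n, (L + M) / 2 ^+ n < d.
  have := @cvg_geometric R (L + M) 2^-1; rewrite ger0_norm ?invr_ge0// invf_lt1// ltr1n => /(_ isT).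
  move=> /cvgrPdist_lt/(_ _ d0)[n _ /(_ n)/=]; rewrite leqnn => /(_ isT).
  rewrite sub0r normrN => hn; exists n; apply: le_lt_trans hn.
  by rewrite exprVn ler_norm.
have n0 : 0 < (2 : R) ^+ n by rewrite exprn_gt0.
have l0 : 0 < L / 2 ^+ n by rewrite divr_gt0.
have m0 : 0 < M / 2 ^+ n by rewrite divr_gt0.
have {}Hn : L / 2 ^+ n + M / 2 ^+ n < d by rewrite -mulrDl.
have [x1 x2] := inx n; have [y1 y2] := iny n.
have px := hp n; have qy := hq n.
set x := (f n).2.1 in x1 x2 px; set y := (f n).2.2 in y1 y2 qy.
have := fQ n; rewrite /Q -/x -/y leNgt => /negP; case.
set e := j / _ in e0 Hd.
set l := L / _ in l0 Hn x2 px *; set m := M / _ in m0 Hn y2 qy *.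
apply: (@le_lt_trans _ _ (2 * (e * (l + m)) * ((x + l - x) + (y + m - y)))).
  apply: (@rect_form_le R U V A B x (x + l) y (y + m) p q (U p q) (V p q) a b).
  - by rewrite lerDl ltW.
  - by rewrite lerDl ltW.
  - by move=> s t ss tt; apply: dA; [exact: itv_sub x1 x2 ss|exact: itv_sub y1 y2 tt].
  - by move=> s t ss tt; apply: dB; [exact: itv_sub x1 x2 ss|exact: itv_sub y1 y2 tt].
  - move=> s t ss tt.
    have k1 := itv_dist px ss; have k2 := itv_dist qy tt.
    have s1d : `|s - p| < d by apply: le_lt_trans k1 (le_lt_trans _ Hn); rewrite lerDl ltW.
    have t1d : `|t - q| < d by apply: le_lt_trans k2 (le_lt_trans _ Hn); rewrite lerDr ltW.
    have [h1 h2] := Hd s t s1d t1d.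
    have k3 : e * (`|s - p| + `|t - q|) <= e * (l + m) by rewrite ler_pM2l// lerD.
    by split; [apply: le_trans h1 k3|apply: le_trans h2 k3].
have -> : x + l - x + (y + m - y) = l + m by ring.
have -> : 2 * (e * (l + m)) * (l + m) = j / 4 ^+ n / 2.
  have -> : l + m = (L + M) / 2 ^+ n by rewrite mulrDl.
  have -> : (4 : R) ^+ n = (2 ^+ n) ^+ 2 by rewrite -exprM mulnC exprM; congr (_ ^+ n); ring.
  by rewrite /e; field; rewrite ?gt_eqF.
have : 0 < j / 4 ^+ n by rewrite divr_gt0 ?exprn_gt0.
lra.
Qed.

(* The neighbourhood of the exceptional point contributes nothing in the limit,
   as its perimeter vanishes while [U] and [V] stay bounded there. *)
Lemma goursat_except (s1 s2 t1 t2 sa ta : R) : s1 < sa < s2 -> t1 < ta < t2 ->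
  (forall s t, s1 <= s <= s2 -> t1 <= t <= t2 -> is_derive s 1 (A t) (V s t)) ->
  (forall s t, s1 <= s <= s2 -> t1 <= t <= t2 -> is_derive t 1 (B s) (U s t)) ->
  (forall s t, s1 <= s <= s2 -> t1 <= t <= t2 -> (s, t) != (sa, ta) ->
     cauchy_riemann_at s t) ->
  (exists K d : R, 0 < d /\ forall s t, `|s - sa| <= d -> `|t - ta| <= d ->
     `|U s t| <= K /\ `|V s t| <= K) ->
  J s1 s2 t1 t2 = 0.
Proof.
move=> sas tat dA dB CR [K [d [d0 HK]]].
apply/eqP; rewrite -normr_eq0 eq_le normr_ge0 andbT; apply/ler_addgt0Pl => e e0.
rewrite addr0.
have K0 : 0 <= K.
  by have [||h _] := HK sa ta; rewrite ?subrr ?normr0 ?(ltW d0)//; apply: le_trans h.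
(* The square of half-side [r] around the exceptional point has perimeter 8 r, hence contributes at
   most 8 r K <= e; the other minima keep it strictly inside the rectangle. *)
pose r := Num.min (Num.min d (e / (8 * (K + 1))))
  (Num.min (Num.min ((sa - s1) / 2) ((s2 - sa) / 2)) (Num.min ((ta - t1) / 2) ((t2 - ta) / 2))).
have r0 : 0 < r by rewrite !lt_min d0 !divr_gt0 ?mulr_gt0 //; lra.
have : r <= r by [].
rewrite {2}/r !le_min => /andP[/andP[rd re] /andP[/andP[r1 r2] /andP[r3 r4]]].
have Jz u1 u2 v1 v2 : s1 <= u1 -> u1 < u2 -> u2 <= s2 -> t1 <= v1 -> v1 < v2 -> v2 <= t2 ->
    (forall s t, u1 <= s <= u2 -> v1 <= t <= v2 -> (s, t) != (sa, ta)) -> J u1 u2 v1 v2 = 0.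
  move=> a1 a2 a3 a4 a5 a6 H; apply: goursat => // s t ss tt.
  - by apply: dA; [exact: itv_sub a1 a3 ss|exact: itv_sub a4 a6 tt].
  - by apply: dB; [exact: itv_sub a1 a3 ss|exact: itv_sub a4 a6 tt].
  - by apply: CR; [exact: itv_sub a1 a3 ss|exact: itv_sub a4 a6 tt|exact: H].
have [b1 b2 b3] : [/\ s1 < sa - r, sa - r < sa & sa < sa + r] by split; lra.
have [c1 c2 c3] : [/\ t1 < ta - r, ta - r < ta & ta < ta + r] by split; lra.
have b4 : sa + r < s2 by lra.
have c4 : ta + r < t2 by lra.
have b5 := lt_trans b2 b3; have c5 := lt_trans c2 c3.
have b6 := lt_trans b5 b4; have b7 := lt_trans b1 b5.
have c6 := lt_trans c5 c4; have c7 := lt_trans c1 c5.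
have [s12 t12] := (lt_trans b1 b6, lt_trans c1 c6).
have ne s t : s != sa \/ t != ta -> (s, t) != (sa, ta).
  by rewrite xpair_eqE negb_and => -[->|->]; rewrite ?orbT.
rewrite (rect_form_hsplit _ _ _ (sa - r)) (rect_form_hsplit _ _ (sa - r) (sa + r)).
rewrite (Jz s1 (sa - r)) ?(ltW b6)//; last first.
  by move=> s t /andP[_ h] _; apply: ne; left; rewrite lt_eqF// (le_lt_trans h).
rewrite (Jz (sa + r) s2) ?(ltW b7)//; last first.
  by move=> s t /andP[h _] _; apply: ne; left; rewrite gt_eqF// (lt_le_trans b3).
rewrite (rect_form_vsplit _ _ _ _ _ (ta - r)) (rect_form_vsplit _ _ _ _ (ta - r) (ta + r)).
rewrite (Jz (sa - r) (sa + r) t1) ?(ltW b1) ?(ltW b4) ?(ltW c6)//; last first.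
  by move=> s t _ /andP[_ h]; apply: ne; right; rewrite lt_eqF// (le_lt_trans h).
rewrite (Jz (sa - r) (sa + r) (ta + r)) ?(ltW b1) ?(ltW b4) ?(ltW c7)//; last first.
  by move=> s t _ /andP[h _]; apply: ne; right; rewrite gt_eqF// (lt_le_trans c3).
rewrite add0r !addr0 add0r.
have := @rect_form_le R U V A B (sa - r) (sa + r) (ta - r) (ta + r) 0 0 0 0 0 0 K.
move=> /(_ (ltW b5) (ltW c5) _ _ _)/le_trans; apply.
- by move=> s t ss tt; apply: dA;
    [exact: itv_sub (ltW b1) (ltW b4) ss|exact: itv_sub (ltW c1) (ltW c4) tt].
- by move=> s t ss tt; apply: dB;
    [exact: itv_sub (ltW b1) (ltW b4) ss|exact: itv_sub (ltW c1) (ltW c4) tt].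
- move=> s t ss tt; rewrite !(mul0r, addr0, subr0).
  by apply: HK; apply: le_trans rd; rewrite ler_norml; [move: ss|move: tt]; clear; lra.
- have : r * (8 * (K + 1)) <= e by rewrite -ler_pdivlMr// mulr_gt0//; lra.
  have := mulr_ge0 (ltW r0) K0; nra.
Qed.

End goursat_theorem.

(** * Cauchy's theorem on circles and its consequences *)

Section complex_exponential.
Variable R : realType.
Implicit Types (w z : CC R) (s t : R).

Definition cexp w : CC R :=
  mkC (expR (Re w) * cos (Im w)) (expR (Re w) * sin (Im w)).

Lemma cexpD w z : cexp (w + z) = cexp w * cexp z.
Proof.
by apply: CC_ext; rewrite /cexp !CE expRD ?cosD ?sinD; ring.
Qed.

Lemma cabs_cexp w : cabs (cexp w) = expR (Re w).
Proof.
by rewrite cabs_sqrt !CE !exprMn -mulrDr cos2Dsin2 mulr1 sqrtr_sqr ger0_norm// expR_ge0.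
Qed.

Lemma cexp_neq0 w : cexp w != 0.
Proof. by rewrite -cabs_gt0 cabs_cexp expR_gt0. Qed.

Lemma cexp_expansion0 (e : R) : 0 < e -> exists2 d : R, 0 < d &
  forall h, cabs h < d -> cabs (cexp h - 1 - h) <= e * cabs h.
Proof.
move=> e0; have [k k0 [ke k1]] : exists2 k : R, 0 < k & k <= e / 8 /\ k <= 1.
  exists (Num.min (e / 8) 1); first by rewrite lt_min ltr01 divr_gt0.
  by rewrite !ge_min !lexx orbT.
have [d1 d10 H1] := is_derive_expansion (is_derive_expR (0 : R)) k0.
have [d2 d20 H2] := is_derive_expansion (is_derive_cos (0 : R)) k0.
have [d3 d30 H3] := is_derive_expansion (is_derive_sin (0 : R)) k0.
exists (Num.min (Num.min d1 d2) (Num.min d3 k)).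
  by rewrite !lt_min d10 d20 d30.
move=> h; rewrite !lt_min => /andP[/andP[hd1 hd2] /andP[hd3 h1]].
have hr := Re_le_cabs h; have hi := Im_le_cabs h.
have {H1} := H1 (Re h) (le_lt_trans hr hd1).
have {H2} := H2 (Im h) (le_lt_trans hi hd2).
have {H3} := H3 (Im h) (le_lt_trans hi hd3).
rewrite !(add0r, expR0, cos0, sin0, oppr0, mulr1, mulr0, addr0, subr0).
set x := Re h in hr *; set y := Im h in hi *.
set E := expR x; set C := cos y; set S := sin y; set n := cabs h in hr hi h1 *.
move=> hS hC hE.
have n0 : 0 <= n by apply: cabs_ge0.
have hS' : `|S - y| <= k * n by apply: le_trans hS _; rewrite ler_wpM2l// ltW.
have hC' : `|C - 1| <= k * n by apply: le_trans hC _; rewrite ler_wpM2l// ltW.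
have hE' : `|E - 1 - x| <= k * n by apply: le_trans hE _; rewrite ler_wpM2l// ltW.
have kn : k * n <= n by rewrite -[leRHS]mul1r ler_wpM2r.
apply: le_trans (cabs_leD _) _; rewrite /cexp !CE -/x -/y -/E -/C -/S oppr0 addr0.
have C1 : `|C| <= 1 by rewrite ler_norml cos_geN1 cos_le1.
have x1 : `|1 + x| <= 2.
  by apply: le_trans (ler_normD _ _) _; rewrite normr1; lra.
have A : `|E * C - 1 - x| <= 3 * (k * n).
  have -> : E * C - 1 - x = (E - 1 - x) * C + (1 + x) * (C - 1) by ring.
  apply: le_trans (ler_normD _ _) _; rewrite !normrM.
  have -> : 3 * (k * n) = (k * n) * 1 + 2 * (k * n) by ring.
  by apply: lerD; apply: ler_pM.
have B : `|E * S - y| <= 3 * (k * n) + 2 * n * n.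
  have -> : E * S - y = (E - 1 - x) * (S - y) + (E - 1 - x) * y + (1 + x) * (S - y) + x * y by ring.
  apply: le_trans (ler_normD _ _) _.
  apply: le_trans (lerD (ler_normD _ _) (lexx _)) _.
  apply: le_trans (lerD (lerD (ler_normD _ _) (lexx _)) (lexx _)) _; rewrite !normrM.
  have a1 : `|E - 1 - x| * `|S - y| <= (k * n) * 1.
    by apply: ler_pM => //; apply: le_trans hS' _; lra.
  have a2 : `|E - 1 - x| * `|y| <= n * n by apply: ler_pM => //; apply: le_trans hE' _.
  have a3 : `|1 + x| * `|S - y| <= 2 * (k * n) by apply: ler_pM.
  have a4 : `|x| * `|y| <= n * n by apply: ler_pM.
  lra.
apply: le_trans (lerD A B) _.
have nk : 2 * n * n <= 2 * (k * n) by rewrite -mulrA ler_pM2l// ler_wpM2r// ltW.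
have : k * n <= e / 8 * n by rewrite ler_wpM2r.
lra.
Qed.

Lemma differentiable_cexp w : differentiable cexp w.
Proof.
suff [] : differentiable cexp w /\ cderive cexp w = cexp w by [].
apply: expansion_cderive => e e0.
have c0 : 0 < cabs (cexp w) by rewrite cabs_gt0 cexp_neq0.
have [d d0 H] := cexp_expansion0 (divr_gt0 e0 c0).
exists d => // h /H {}H.
have -> : cexp (w + h) - cexp w - h * cexp w = cexp w * (cexp h - 1 - h).
  by rewrite cexpD; ring.
rewrite cabsM; apply: le_trans (ler_wpM2l (ltW c0) H) _.
by rewrite mulrA [_ * (e / _)]mulrC divfK ?gt_eqF.
Qed.

(** The positive number [a] has a single logarithm in the closed strip, so the rectangle mapped to
    an annulus contains only one exceptional point. *)
Lemma cexp_eq_real (a s t : R) : 0 < a -> - pi <= t <= pi ->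
  cexp (mkC s t) = toC a -> s = ln a /\ t = 0.
Proof.
move=> a0 tpi E; have ca := congr1 (@Re R) E; have sa0 := congr1 (@Im R) E.
move: ca sa0; rewrite /cexp !CE => ca sa0 {E}.
have E0 := expR_gt0 s.
have st : sin t = 0 by apply/eqP; move: sa0 => /eqP; rewrite mulf_eq0 gt_eqF.
have ct : 0 < cos t by rewrite -(pmulr_rgt0 _ E0) ca.
have c1 : cos t = 1 by rewrite -(sin0cos1 st) gtr0_norm.
split; first by rewrite -ca c1 mulr1 expRK.
have : `|t| = 0.
  apply: (@cos_inj R); rewrite ?in_itv /= ?normr_ge0 ?ler_norml ?lexx ?pi_ge0//.
  by rewrite cos0; case: (ler0P t) => _; rewrite ?cosN.
by move/normr0P/eqP.
Qed.

End complex_exponential.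

Section mean_value.
Variable R : realType.
Implicit Types (g : CC R -> CC R).

Definition ccontinuous_at g z := forall e : R, 0 < e -> exists2 d : R, 0 < d &
  forall h, cabs h < d -> cabs (g (z + h) - g z) <= e.

Lemma real_continuous (f : R -> R) :
  (forall x e : R, 0 < e -> exists2 d : R, 0 < d &
     forall h, `|h| < d -> `|f (x + h) - f x| <= e) -> continuous f.
Proof.
move=> H x; apply/cvgrPdist_le => e e0.
have [d d0 Hd] := H x e e0; apply/nbhs_normP; exists d => //= y xy.
by rewrite distrC -(subrK x y) [y - x + x]addrC; apply: Hd; rewrite distrC.
Qed.

Lemma ccontinuous_comp g (u : R -> CC R) (x : R) :
  (forall e : R, 0 < e -> exists2 d : R, 0 < d &
     forall h, `|h| < d -> cabs (u (x + h) - u x) <= e) ->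
  ccontinuous_at g (u x) ->
  forall e : R, 0 < e -> exists2 d : R, 0 < d &
     forall h, `|h| < d -> cabs (g (u (x + h)) - g (u x)) <= e.
Proof.
move=> hu hg e e0; have [d d0 H] := hg e e0.
have [d' d'0 H'] := hu (d / 2) (divr_gt0 d0 (ltr0n _ 2)).
exists d' => // h /H' k; rewrite -{1}(subrK (u x) (u (x + h))) [_ - _ + _]addrC.
by apply: H; apply: le_lt_trans k _; rewrite ltr_pdivrMr// mulr2n mulrDr mulr1 ltrDl.
Qed.

Definition cpolar (r t : R) : CC R := mkC (r * cos t) (r * sin t).

Lemma cabs_cpolar (r t : R) : 0 <= r -> cabs (cpolar r t) = r.
Proof.
by move=> r0; rewrite cabs_sqrt !CE !exprMn -mulrDr cos2Dsin2 mulr1 sqrtr_sqr ger0_norm.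
Qed.

Lemma cauchy_riemann_cderive g (s t : R) : differentiable g (mkC s t) ->
  cauchy_riemann_at (fun s t => Re (g (mkC s t))) (fun s t => Im (g (mkC s t))) s t.
Proof.
move=> dg; exists (Re (cderive g (mkC s t))), (Im (cderive g (mkC s t))) => e e0.
have [d d0 H] := cderive_expansion dg e0.
exists (d / 2); first by rewrite divr_gt0.
move=> s' t' hs ht; pose h : CC R := mkC (s' - s) (t' - t).
have hh : cabs h <= `|s' - s| + `|t' - t|.
    by apply: le_trans (cabs_leD _) _; rewrite !CE.
have hd : cabs h < d by apply: le_lt_trans hh _; lra.
have := H h hd.
have -> : mkC s t + h = mkC s' t'.
  by apply: CC_ext; rewrite !CE; ring.
set c := cderive g _; move=> K.
have {}K : cabs (g (mkC s' t') - g (mkC s t) - h * c) <= e * (`|s' - s| + `|t' - t|).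
  by apply: le_trans K _; rewrite ler_pM2l.
split.
  apply: le_trans _ (le_trans (Re_le_cabs _) K).
  by rewrite !CE le_eqVlt; apply/predU1P; left; congr (`| _ |); ring.
apply: le_trans _ (le_trans (Im_le_cabs _) K).
by rewrite !CE le_eqVlt; apply/predU1P; left; congr (`| _ |); ring.
Qed.

(** The imaginary part of the integral of g(z) dz / z over the circle. *)
Definition circle_integral g (r : R) : R :=
  \int[lebesgue_measure]_(t in `[- pi, pi]) Re (g (cpolar r t)).

Lemma circle_continuous g (r : R) : (forall t, ccontinuous_at g (cpolar r t)) ->
  continuous (fun t => Re (g (cpolar r t))).
Proof.
move=> cg; apply: real_continuous => t e e0.
have [|d d0 H] := @ccontinuous_comp g (cpolar r) t _ (cg t) e e0.
  move=> {e0}e e0.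
  have r1 : 0 < `|r| + 1 by rewrite ltr_pwDr.
  have k0 : 0 < e / 2 / (`|r| + 1) by rewrite !divr_gt0.
  have /cvgrPdist_lt/(_ _ k0)/nbhs_normP[d1 d10 H1] := @continuous_cos R t.
  have /cvgrPdist_lt/(_ _ k0)/nbhs_normP[d2 d20 H2] := @continuous_sin R t.
  rewrite /= in d10 d20.
  have key : `|r| * (e / 2 / (`|r| + 1)) <= e / 2.
    by rewrite mulrA ler_pdivrMr// mulrC ler_pM2l ?divr_gt0// lerDl.
  exists (Num.min d1 d2); first by rewrite lt_min d10.
  move=> h; rewrite lt_min => /andP[h1 h2].
  have {}H1 := H1 (t + h); rewrite /= (_ : t - (t + h) = - h) ?normrN in H1; last by ring.
  have {H1} H1 := H1 h1.
  have {}H2 := H2 (t + h); rewrite /= (_ : t - (t + h) = - h) ?normrN in H2; last by ring.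
  have {H2} H2 := H2 h2.
  apply: le_trans (cabs_leD _) _; rewrite !CE -!mulrBr !normrM.
  rewrite [e]splitr; apply: lerD.
    rewrite distrC; apply: le_trans (ler_wpM2l (normr_ge0 _) (ltW H1)) _.
    exact: key.
  rewrite distrC; apply: le_trans (ler_wpM2l (normr_ge0 _) (ltW H2)) _.
  exact: key.
exists d => // h /H; rewrite -ReB; apply: le_trans; exact: Re_le_cabs.
Qed.

Lemma itv_pi_lt : - pi < pi :> R.
Proof. by have := @pi_gt0 R; lra. Qed.

(* The annulus is the image under [cexp] of a rectangle, to which [goursat_except]
   applies. *)
Lemma circle_integral_cst g (a r1 r R0 : R) : 0 < r1 -> r1 < r -> r < R0 ->
  0 <= a -> a < r -> (0 < a -> r1 < a) ->
  (forall z, cabs z < R0 -> ccontinuous_at g z) ->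
  (forall z, z != 0 -> z != toC a -> cabs z < R0 -> differentiable g z) ->
  circle_integral g r1 = circle_integral g r.
Proof.
move=> r10 r1r rR a0 ar ra cg dg.
have r0 : 0 < r by apply: lt_trans r1r.
pose s1 := ln r1; pose s2 := ln r.
have s12 : s1 < s2 by rewrite /s1 /s2 ltr_ln ?posrE.
have e1 : expR s1 = r1 by rewrite /s1 lnK ?posrE.
have e2 : expR s2 = r by rewrite /s2 lnK ?posrE.
pose G w := g (cexp w).
have inR s : s <= s2 -> expR s < R0.
  by move=> ss; apply: le_lt_trans rR; rewrite -e2 ler_expR.
have ccexp w : ccontinuous_at (@cexp R) w.
  by move=> e e0; exact: differentiable_cvg (differentiable_cexp w) _ e0.
have cG s t : s <= s2 -> ccontinuous_at G (mkC s t).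
  move=> ss e e0; have [|d d0 H] := cg (cexp (mkC s t)) _ e e0.
    by rewrite cabs_cexp; exact: inR.
  have [d' d'0 H'] := ccexp (mkC s t) (d / 2) (divr_gt0 d0 (ltr0n _ 2)).
  exists d' => // h /H' k; rewrite /G -{1}(subrK (cexp (mkC s t)) (cexp _)) [_ - _ + _]addrC.
  by apply: H; apply: le_lt_trans k _; rewrite ltr_pdivrMr// mulr2n mulrDr mulr1 ltrDl.
(* Primitives are available for functions continuous on the whole line, while [G] is only known to
   be continuous up to abscissa [s2]; clamping changes nothing on [s1, s2]. *)
pose cl s := Num.min s s2.
have cls s : cl s <= s2 by rewrite /cl ge_min lexx orbT.
have cl_id s : s <= s2 -> cl s = s by move=> ?; rewrite /cl min_l.
have cl_lip s h : `|cl (s + h) - cl s| <= `|h|.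
  have hh := ler_norm h; have hN := ler_norm (- h); rewrite normrN in hN.
  have h0 := normr_ge0 h.
  rewrite /cl /Num.min; case: ifPn => k1; case: ifPn => k2; rewrite -?leNgt in k1 k2 *;
    rewrite ler_norml; lra.
have VA t : exists P : R -> R, (forall s, s1 <= s <= s2 -> is_derive s 1 P (Im (G (mkC s t))))
   /\ P s2 - P s1 = \int[lebesgue_measure]_(s in `[s1, s2]) Im (G (mkC (cl s) t)).
  have [|P dP ->] := @continuous_antiderivative R (fun s => Im (G (mkC (cl s) t))) s1 s2 _ s12.
    apply: real_continuous => s e e0.
    have [|d d0 H] := @ccontinuous_comp G (fun s => mkC (cl s) t) s _ (cG _ _ (cls s)) e e0.
      move=> {e0} e e0; exists e => // h he.
      apply: le_trans (cabs_leD _) _; rewrite !CE subrr normr0 addr0.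
      exact: le_trans (cl_lip _ _) (ltW he).
    exists d => // h /H; rewrite -ImB; apply: le_trans; exact: Im_le_cabs.
  exists P; split => // s ss; by have := dP s ss; rewrite cl_id //; case/andP: ss.
have UB s : s1 <= s <= s2 -> exists P : R -> R,
   (forall t, -pi <= t <= pi -> is_derive t 1 P (Re (G (mkC s t))))
   /\ P pi - P (- pi) = circle_integral g (expR s).
  move=> ss; have [|P dP E] := @continuous_antiderivative R
      (fun t => Re (g (cpolar (expR s) t))) (-pi) pi _ itv_pi_lt.
    apply: circle_continuous => t; apply: cg.
    by rewrite cabs_cpolar ?expR_ge0//; apply: inR; case/andP: ss.
  by exists P.
have [A hA] := choice VA.
(* Beyond [s2] the circle of radius e^s may leave the disk where [g] is continuous; the value 0 is
   arbitrary. *)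
pose B s := if pselect (s1 <= s <= s2) is left H then projT1 (cid (UB s H)) else fun=> 0.
have hB s : s1 <= s <= s2 -> (forall t, -pi <= t <= pi -> is_derive t 1 (B s) (Re (G (mkC s t))))
   /\ B s pi - B s (- pi) = circle_integral g (expR s).
  by move=> ss; rewrite /B; case: pselect => // H; case: cid.
have dA s t : s1 <= s <= s2 -> - pi <= t <= pi -> is_derive s 1 (A t) (Im (G (mkC s t))).
  by move=> ss _; have [h _] := hA t; exact: h.
have dB s t : s1 <= s <= s2 -> - pi <= t <= pi -> is_derive t 1 (B s) (Re (G (mkC s t))).
  by move=> ss; have [h _] := hB s ss; exact: h.
have CR s t : s1 <= s <= s2 -> - pi <= t <= pi -> cexp (mkC s t) != toC a ->
    cauchy_riemann_at (fun s t => Re (G (mkC s t))) (fun s t => Im (G (mkC s t))) s t.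
  move=> ss tt na; apply: cauchy_riemann_cderive.
  apply: differentiable_comp; first exact: differentiable_cexp.
  by apply: dg => //; [exact: cexp_neq0|rewrite cabs_cexp; apply: inR; case/andP: ss].
have J0 : rect_form A B s1 s2 (- pi) pi = 0.
  have [a1|na1] := ltP 0 a; last first.
    have az : a = 0 by apply/eqP; rewrite eq_le na1.
    apply: (goursat s12 itv_pi_lt dA dB) => s t ss tt; apply: CR => //.
    by rewrite az; exact: cexp_neq0.
  apply: (@goursat_except R _ _ A B s1 s2 (- pi) pi (ln a) 0 _ _ dA dB).
  - by rewrite /s1 /s2 !ltr_ln ?posrE//; rewrite ra.
  - by have := @pi_gt0 R; lra.
  - move=> s t ss tt; rewrite xpair_eqE => ne; apply: CR => //.
    apply/eqP => E; move: ne; have [-> ->] := cexp_eq_real a1 tt E.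
    by rewrite !eqxx.
  - have sas : ln a <= s2 by rewrite /s2 ler_ln ?posrE// ltW.
    have [d d0 H] := cG (ln a) 0 sas 1 (@ltr01 R).
    exists (1 + cabs (G (mkC (ln a) 0))), (d / 4); split; first by rewrite divr_gt0.
    move=> s t hs ht; pose h : CC R := mkC (s - ln a) (t - 0).
    have hd : cabs h < d.
      apply: (@le_lt_trans _ _ (d / 4 + d / 4)); last by lra.
      by apply: le_trans (cabs_leD _) _; rewrite !CE; exact: lerD.
    have := H h hd; have -> : mkC (ln a) 0 + h = mkC s t.
      by apply: CC_ext; rewrite !CE; ring.
    move=> k.
    have K : cabs (G (mkC s t)) <= 1 + cabs (G (mkC (ln a) 0)).
      rewrite -(subrK (G (mkC (ln a) 0)) (G (mkC s t))).
      by apply: le_trans (cabsD _ _) _; rewrite lerD2r.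
    by split; apply: le_trans K; [exact: Re_le_cabs|exact: Im_le_cabs].
(* The horizontal sides cancel, since [cexp] takes the same values on the lines Im w = pi and Im w =
   - pi. *)
have per : A pi s2 - A pi s1 = A (- pi) s2 - A (- pi) s1.
  have [_ ->] := hA pi; have [_ ->] := hA (- pi).
  by congr Rintegral; apply/funext => s; rewrite /G /cexp !CE cosN sinN sinpi oppr0.
have [|_ E1] := hB s1; first by rewrite lexx ltW.
have [|_ E2] := hB s2; first by rewrite lexx ltW.
rewrite e1 in E1; rewrite e2 in E2.
move: J0; rewrite /rect_form E1 E2 per subrr add0r => /eqP.
by rewrite subr_eq0 => /eqP.
Qed.

Lemma integral_near_cst (f : R -> R) (a b c e : R) : a < b -> continuous f ->
  (forall t, a <= t <= b -> `|f t - c| <= e) ->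
  `|\int[lebesgue_measure]_(t in `[a, b]) f t - c * (b - a)| <= e * (b - a).
Proof.
move=> ab cf H; have [P dP ->] := continuous_antiderivative cf ab.
have -> : P b - P a - c * (b - a) = (P b - c * b) - (P a - c * a) by ring.
apply: (@mvt_bound R (fun x => P x - c * x) (fun x => f x - c)) => //; first exact: ltW.
move=> x xab; apply: is_deriveB; first exact: dP.
apply: expansion_is_derive => k k0; exists 1 => // h _.
by rewrite (_ : _ - _ = 0) ?normr0 ?mulr_ge0 ?(ltW k0)//; ring.
Qed.

Lemma mean_value g (a r R0 : R) : 0 <= a -> a < r -> r < R0 ->
  (forall z, cabs z < R0 -> ccontinuous_at g z) ->
  (forall z, z != 0 -> z != toC a -> cabs z < R0 -> differentiable g z) ->
  circle_integral g r = Re (g 0) * (pi - - pi).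
Proof.
move=> a0 ar rR cg dg.
have r0 : 0 < r by apply: le_lt_trans ar.
have R00 : 0 < R0 by apply: lt_trans rR.
apply/eqP; rewrite -subr_eq0 -normr_eq0 eq_le normr_ge0 andbT.
apply/ler_addgt0Pl => e e0; rewrite addr0.
have pp : 0 < pi - - pi :> R by rewrite subr_gt0 itv_pi_lt.
have [|d d0 H] := cg 0 _ (e / (pi - - pi)) (divr_gt0 e0 pp); first by rewrite cabs0.
(* The small circle must leave the exceptional point [a] outside, so that [a] lies in the
   annulus. *)
pose q := if 0 < a then a else r.
have q0 : 0 < q by rewrite /q; case: ifP.
have qr : q <= r by rewrite /q; case: ifP => // _; exact: ltW.
pose r1 := Num.min (q / 2) (d / 2).
have r10 : 0 < r1 by rewrite lt_min !divr_gt0.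
have r1d : r1 < d.
  by apply: (@le_lt_trans _ _ (d / 2)); [rewrite /r1 ge_min lexx orbT|lra].
have r1q : r1 < q.
  by apply: (@le_lt_trans _ _ (q / 2)); [rewrite /r1 ge_min lexx|lra].
rewrite -(@circle_integral_cst g a r1 r R0) //; last 2 first.
- exact: lt_le_trans qr.
- by move=> a1; move: r1q; rewrite /q a1.
have := @integral_near_cst (fun t => Re (g (cpolar r1 t))) (-pi) pi (Re (g 0)) (e / (pi - -pi)) itv_pi_lt.
rewrite divfK ?gt_eqF//; apply.
  apply: circle_continuous => t; apply: cg; rewrite cabs_cpolar ?(ltW r10)//.
  by apply: lt_trans rR; exact: lt_le_trans qr.
move=> t _; rewrite -ReB; apply: le_trans (Re_le_cabs _) _.
by have := H (cpolar r1 t); rewrite add0r cabs_cpolar ?(ltW r10)//; apply.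
Qed.

(* [g] will be a difference quotient at 0, hence no differentiability there. *)
Lemma max_principle_center g (r R0 M : R) : 0 < r -> r < R0 ->
  (forall z, cabs z < R0 -> ccontinuous_at g z) ->
  (forall z, z != 0 -> cabs z < R0 -> differentiable g z) ->
  (forall z, cabs z = r -> cabs (g z) <= M) -> cabs (g 0) <= M.
Proof.
move=> r0 rR cg dg gM.
have [u u1 <-] := cabs_phase (g 0).
have pp : 0 < pi - - pi :> R by rewrite subr_gt0 itv_pi_lt.
pose k z := u * g z.
have ck z : cabs z < R0 -> ccontinuous_at k z.
  move=> zR e e0; have [d d0 H] := cg z zR e e0; exists d => // h /H.
  by rewrite /k -mulrBr cabsM u1 mul1r.
have kM z : cabs z = r -> `|Re (k z) - 0| <= M.
  by move=> zr; rewrite subr0; apply: le_trans (Re_le_cabs _) _; rewrite cabsM u1 mul1r gM.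
have := @integral_near_cst (fun t => Re (k (cpolar r t))) (-pi) pi 0 M itv_pi_lt.
move=> /(_ _ _)/wrap[].
  by apply: circle_continuous => t; apply: ck; rewrite cabs_cpolar ?(ltW r0).
  by move=> t _; apply: kM; rewrite cabs_cpolar ?(ltW r0).
rewrite mul0r subr0 -/(circle_integral k r) (@mean_value k 0 r R0) //; last first.
  move=> z z0 _ zR; rewrite /k; apply: differentiableM; last exact: dg.
  exact: differentiable_cst.
rewrite normrM (gtr0_norm pp) ler_pM2r//; apply: le_trans; exact: ler_norm.
Qed.

End mean_value.

(** * Cauchy estimates, and a bound by the mean over a circle *)

Section cauchy_estimates.
Variable R : realType.
Implicit Types (f g : CC R -> CC R) (a z h : CC R).

Lemma differentiable_ccontinuous f z : differentiable f z -> ccontinuous_at f z.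
Proof. by move=> df e e0; exact: differentiable_cvg. Qed.

Lemma cderive_ext f g z (d : R) : 0 < d ->
  (forall h, cabs h < d -> f (z + h) = g (z + h)) -> differentiable f z ->
  differentiable g z.
Proof.
move=> d0 E df; suff [] : differentiable g z /\ cderive g z = cderive f z by [].
have E0 : f z = g z by have := E 0; rewrite addr0 cabs0; exact.
apply: expansion_cderive => e e0; have [d' d'0 H] := cderive_expansion df e0.
exists (Num.min d d'); first by rewrite lt_min d0.
by move=> h; rewrite lt_min => /andP[h1 h2]; rewrite -E// -E0; exact: H.
Qed.

Lemma differentiable_cmul (c z : CC R) : differentiable (fun w : CC R => c * w) z.
Proof.
suff [] : differentiable (fun w : CC R => c * w) z /\
  cderive (fun w : CC R => c * w) z = c by [].
apply: expansion_cderive => e e0; exists 1 => // h _.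
have -> : c * (z + h) - c * z - h * c = 0 by ring.
by rewrite cabs0 mulr_ge0 ?cabs_ge0 ?ltW.
Qed.

Definition difference_quotient f a z :=
  if z == a then cderive f a else (f z - f a) / (z - a).

Lemma difference_quotient_differentiable f a z : z != a -> differentiable f z ->
  differentiable (difference_quotient f a) z.
Proof.
move=> za df; have d0 : 0 < cabs (z - a) by rewrite cabs_gt0 subr_eq0.
apply: (@cderive_ext (fun w => (f w - f a) * (w - a)^-1) _ z _ d0).
  move=> h hz; rewrite /difference_quotient ifN//; apply/eqP => E.
  by move: hz; rewrite -E opprD addNKr cabsN ltxx.
apply: differentiableM; first by apply: differentiableB.
by apply: (@differentiableV _ _ (fun w : CC R => w - a)) => //; rewrite subr_eq0.
Qed.

Lemma difference_quotient_continuous f a z : differentiable f a ->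
  differentiable f z -> ccontinuous_at (difference_quotient f a) z.
Proof.
move=> da dz; have [->|za] := eqVneq z a; last first.
  exact/differentiable_ccontinuous/difference_quotient_differentiable.
move=> e e0; have [d d0 H] := cderive_expansion da e0.
exists d => // h /H; rewrite /difference_quotient eqxx.
have [->|h0] := eqVneq h 0; first by move=> _; rewrite addr0 eqxx subrr cabs0 ltW.
have -> : (a + h == a) = false by apply/negbTE; rewrite -subr_eq0 addrAC subrr add0r.
have -> : a + h - a = h by rewrite addrAC subrr add0r.
rewrite -ler_pdivrMr ?cabs_gt0// -cabsV -cabsM mulrBl.
by rewrite [h * _]mulrC mulfK.
Qed.

Lemma cderive_shift f a h : differentiable f (a + h) ->
  differentiable (fun z => f (z + h)) a /\
  cderive (fun z => f (z + h)) a = cderive f (a + h).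
Proof.
move=> df; apply: expansion_cderive => e e0.
have [d d0 H] := cderive_expansion df e0; exists d => // k /H.
by rewrite (addrAC a h k).
Qed.

Lemma cderiveB f g a : differentiable f a -> differentiable g a ->
  differentiable (fun z => f z - g z) a /\
  cderive (fun z => f z - g z) a = cderive f a - cderive g a.
Proof.
move=> df dg; apply: expansion_cderive => e e0.
have e2 : 0 < e / 2 by rewrite divr_gt0.
have [d1 d10 H1] := cderive_expansion df e2.
have [d2 d20 H2] := cderive_expansion dg e2.
exists (Num.min d1 d2); first by rewrite lt_min d10.
move=> h; rewrite lt_min => /andP[/H1 {}H1 /H2 {}H2].
have E (p q r s c d k : CC R) :
  p - q - (r - s) - k * (c - d) = (p - r - k * c) - (q - s - k * d) by ring.
rewrite E {E}.
by apply: le_trans (cabsB _ _) _; rewrite [e]splitr mulrDl; exact: lerD.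
Qed.

(** The maximum principle for the difference quotient at [a], which on the circle is at most |f z -
    f a| / r; hence the factor 2 instead of the optimal 1. *)
Lemma cauchy_estimate f a (r R0 M : R) : 0 < r -> r < R0 ->
  (forall z, cabs (z - a) < R0 -> differentiable f z) ->
  (forall z, cabs (z - a) < R0 -> cabs (f z) <= M) ->
  cabs (cderive f a) <= 2 * M / r.
Proof.
move=> r0 rR df fM.
have zin z : cabs z < R0 -> cabs (z + a - a) < R0 by rewrite addrK.
have R00 : 0 < R0 by exact: lt_trans rR.
have da : differentiable f a by apply: df; rewrite subrr cabs0.
pose q z := difference_quotient f a (z + a).
have -> : cderive f a = q 0 by rewrite /q add0r /difference_quotient eqxx.
apply: (@max_principle_center R q r R0 _ r0 rR).
- move=> z zR e e0.
  have [d d0 H] := difference_quotient_continuous da (df _ (zin _ zR)) e0.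
  by exists d => // h /H; rewrite /q (addrAC z a h).
- move=> z z0 zR.
  have dz : differentiable (difference_quotient f a) (z + a).
    apply: difference_quotient_differentiable; last exact/df/zin.
    by rewrite -subr_eq0 addrK.
  exact: (cderive_shift dz).1.
- move=> z zr; have zR : cabs z < R0 by rewrite zr.
  have z0 : z != 0 by rewrite -cabs_gt0 zr.
  rewrite /q /difference_quotient ifN; last by rewrite -subr_eq0 addrK.
  rewrite addrK cabsM cabsV zr ler_wpM2r ?invr_ge0 ?(ltW r0)//.
  apply: le_trans (cabsB _ _) _; rewrite mulrC mulr_natr mulr2n.
  by apply: lerD; apply: fM; [exact: zin|rewrite subrr cabs0].
Qed.

Lemma cderive_le_lipschitz f a h (K : R) :
  (forall t : R, 0 <= t <= 1 -> differentiable f (a + toC t * h) /\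
     cabs (cderive f (a + toC t * h)) <= K) ->
  cabs (f (a + h) - f a) <= K * cabs h.
Proof.
move=> H; have [u u1 <-] := cabs_phase (f (a + h) - f a).
pose F (t : R) := Re (u * f (a + toC t * h)).
pose dF (t : R) := Re (u * (h * cderive f (a + toC t * h))).
have -> : Re (u * (f (a + h) - f a)) = F 1 - F 0.
  by rewrite /F mulrBr ReB toC1 toC0 mul1r mul0r addr0.
apply: le_trans (ler_norm _) _.
have -> : K * cabs h = K * cabs h * (1 - 0) by rewrite subr0 mulr1.
apply: (@mvt_bound R F dF) => //; last first.
  move=> t t01; apply: le_trans (Re_le_cabs _) _; rewrite !cabsM u1 mul1r mulrC.
  by rewrite ler_wpM2r ?cabs_ge0//; have [] := H t t01.
move=> t t01; apply: expansion_is_derive => e e0.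
have [dt _] := H t t01.
have h1 : 0 < cabs h + 1 by rewrite ltr_wpDl ?cabs_ge0.
have [d d0 Hd] := cderive_expansion dt (divr_gt0 e0 h1).
exists (d / (cabs h + 1)); first by rewrite divr_gt0.
move=> k; rewrite ltr_pdivlMr// => kd.
have kh : cabs (toC k * h) < d.
  by rewrite cabsM cabs_toC; apply: le_lt_trans kd; rewrite ler_wpM2l// lerDl.
have := Hd _ kh; set c := cderive _ _ in dF *.
have -> : a + toC t * h + toC k * h = a + toC (t + k) * h.
  by rewrite toCD mulrDl addrA.
move=> E; have -> : F (t + k) - F t - k * Re (u * (h * c)) =
   Re (u * (f (a + toC (t + k) * h) - f (a + toC t * h) - toC k * h * c)).
  rewrite /F; set x := f (a + toC (t + k) * h); set y := f (a + toC t * h).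
  have E' (p q r s w v : CC R) : p * (q - r - s * w * v) = p * q - p * r - s * (p * (w * v)) by ring.
  rewrite E'.
  by rewrite !ReB [Re (toC k * _)]ReM !CE mul0r subr0.
apply: le_trans (Re_le_cabs _) _; rewrite cabsM u1 mul1r.
apply: le_trans E _; rewrite cabsM cabs_toC mulrA mulrAC ler_wpM2r//.
rewrite mulrAC ler_pdivrMr// ler_wpM2l ?(ltW e0)// lerDl //.
Qed.

Lemma bounded_holomorphic_lipschitz f a h (R0 M : R) : 0 < R0 ->
  (forall z, cabs (z - a) < R0 -> differentiable f z) ->
  (forall z, cabs (z - a) < R0 -> cabs (f z) <= M) ->
  cabs h <= R0 / 2 -> cabs (f (a + h) - f a) <= 8 * M / R0 * cabs h.
Proof.
move=> R00 df fM hR; apply: cderive_le_lipschitz => t /andP[t0 t1].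
have th : cabs (toC t * h) <= R0 / 2.
  by rewrite cabsM cabs_toC ger0_norm//; apply: le_trans hR; rewrite ler_piMl ?cabs_ge0.
have zin z : cabs (z - (a + toC t * h)) < R0 / 2 -> cabs (z - a) < R0.
  move=> k; have E (p q r : CC R) : p - q = (p - (q + r)) + r by ring.
  rewrite (E z a (toC t * h)).
  by apply: le_lt_trans (cabsD _ _) _; lra.
split; first by apply: df; apply: zin; rewrite subrr cabs0 divr_gt0.
(* Each point of the segment is the centre of a disk of radius R0 / 2 in the domain; Cauchy's
   estimate is applied with radius R0 / 4. *)
have -> : 8 * M / R0 = 2 * M / (R0 / 4) by field; rewrite gt_eqF.
apply: (@cauchy_estimate f _ (R0 / 4) (R0 / 2)).
- by rewrite divr_gt0.
- by lra.
- by move=> z /zin; exact: df.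
- by move=> z /zin; exact: fM.
Qed.

(** The difference z |-> f (z + k) - f z is at most a multiple of |k|, so Cauchy's estimate for it
    shows that the derivative of [f] is Lipschitz, without any second derivative. The function f z -
    z f'(a) then has a derivative of order |h| on the segment from [a] to a + h. *)
Lemma bounded_holomorphic_taylor2 f a h (R0 M : R) : 0 < R0 ->
  (forall z, cabs (z - a) < R0 -> differentiable f z) ->
  (forall z, cabs (z - a) < R0 -> cabs (f z) <= M) ->
  cabs h <= R0 / 4 ->
  cabs (f (a + h) - f a - h * cderive f a) <= 128 * M / R0 ^+ 2 * cabs h ^+ 2.
Proof.
move=> R00 df fM hR.
have lip k : cabs k <= R0 / 4 -> cabs (cderive f (a + k) - cderive f a) <=
    128 * M / R0 ^+ 2 * cabs k.
  move=> kR.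
  have zin z : cabs (z - a) < R0 / 2 -> cabs (z + k - a) < R0.
    move=> zR; rewrite addrAC; apply: le_lt_trans (cabsD _ _) _; lra.
  have dk z : cabs (z - a) < R0 / 2 -> differentiable (fun z => f (z + k)) z /\
      cderive (fun z => f (z + k)) z = cderive f (z + k).
    by move=> zR; apply: cderive_shift; exact/df/zin.
  have da : differentiable f a by apply: df; rewrite subrr cabs0.
  have [|da1 da2] := dk a; first by rewrite subrr cabs0 divr_gt0.
  have -> : cderive f (a + k) - cderive f a = cderive (fun z => f (z + k) - f z) a.
    by rewrite (cderiveB da1 da).2 da2.
  have -> : 128 * M / R0 ^+ 2 * cabs k = 2 * (8 * M / (R0 / 2) * cabs k) / (R0 / 4).
    by field; rewrite gt_eqF.
  apply: (@cauchy_estimate _ a (R0 / 4) (R0 / 2)); [by rewrite divr_gt0|lra| |].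
    move=> z zR; apply: (cderiveB (dk z zR).1 _).1.
    by apply: df; lra.
  move=> z zR; apply: bounded_holomorphic_lipschitz; [by rewrite divr_gt0| | |lra].
  - move=> w wz; apply: df; rewrite -(subrK z w) -addrA.
    by apply: le_lt_trans (cabsD _ _) _; lra.
  - move=> w wz; apply: fM; rewrite -(subrK z w) -addrA.
    by apply: le_lt_trans (cabsD _ _) _; lra.
have -> : 128 * M / R0 ^+ 2 * cabs h ^+ 2 = (128 * M / R0 ^+ 2 * cabs h) * cabs h by ring.
pose c := cderive f a.
have E (p q r s t : CC R) : p - q - s * t = (p - (r + s) * t) - (q - r * t) by ring.
rewrite (E _ _ a).
apply: (@cderive_le_lipschitz (fun z => f z - z * c)) => t /andP[t0 t1].
have th : cabs (toC t * h) <= cabs h.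
  by rewrite cabsM cabs_toC ger0_norm// ler_piMl ?cabs_ge0.
have M0 : 0 <= M by apply: le_trans (fM a _); rewrite ?cabs_ge0// subrr cabs0.
set b := a + _ * h.
have db : differentiable f b by apply: df; rewrite /b addrAC subrr add0r; lra.
have [dl cl] : differentiable (fun z : CC R => f z - z * c) b /\
    cderive (fun z : CC R => f z - z * c) b = cderive f b - c.
  apply: expansion_cderive => e e0; have [d d0 H] := cderive_expansion db e0.
  exists d => // k /H; congr (cabs _ <= _).
  have E' (p q r s v w : CC R) : p - q - s * v = p - (r + s) * w - (q - r * w) - s * (v - w) by ring.
  exact: E'.
split => //; rewrite cl; apply: le_trans (lip _ _) _; first by lra.
by rewrite ler_wpM2l// mulr_ge0 ?invr_ge0 ?exprn_ge0 ?(ltW R00)// mulr_ge0.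
Qed.

Lemma circle_cabs_continuous f : (forall t : R, ccontinuous_at f (cpolar 1 t)) ->
  continuous (fun t => cabs (f (cpolar 1 t))).
Proof.
move=> cf; apply: real_continuous => t e e0.
have ec : forall e : R, 0 < e -> exists2 d : R, 0 < d &
    forall h : R, `|h| < d -> cabs (cpolar 1 (t + h) - cpolar 1 t) <= e.
  move=> k k0; have [d d0 H] := differentiable_cvg (differentiable_cexp (mkC 0 t)) k0.
  exists d => // h hd; have := H (mkC 0 h); rewrite cabs_sqrt !CE expr0n add0r sqrtr_sqr => /(_ hd).
  by rewrite /cpolar /cexp !CE add0r expR0.
have [d d0 H] := ccontinuous_comp ec (cf t) e0.
by exists d => // h /H; apply: le_trans; exact: cabsB_dist.
Qed.

(* The function integrated is u (z f z / (z - a)), corrected by a holomorphic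
   function whose real part vanishes with it on the circle. *)
Lemma cauchy_circle_bound f (a R0 : R) : 0 <= a -> a < 1 -> 1 < R0 ->
  (forall z, cabs z < R0 -> differentiable f z) ->
  cabs (f (toC a)) * (pi - - pi) <=
    (1 - a)^-1 * \int[lebesgue_measure]_(t in `[- pi, pi]) cabs (f (cpolar 1 t)).
Proof.
move=> a0 a1 R1 df.
have [u u1 uE] := cabs_phase (f (toC a)).
pose v := u * f (toC a).
pose q := difference_quotient f (toC a).
have b0 : 0 < 1 - a by rewrite subr_gt0.
(* The radius 2 / (1 + a) exceeds 1, and a * S < 1 keeps 1 - a z away from 0. *)
pose S := Num.min R0 (2 / (1 + a)).
have a10 : 0 < 1 + a by rewrite ltr_pwDl.
have S1 : 1 < S by rewrite lt_min R1/= ltr_pdivlMr// mul1r; lra.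
have SR : S <= R0 by rewrite ge_min lexx.
have Sa z : cabs z < S -> 1 - toC a * z != 0.
  rewrite lt_min => /andP[_]; rewrite ltr_pdivlMr// => zS.
  rewrite subr_eq0; apply/eqP => E; have := congr1 (@cabs R) E.
  rewrite cabs1 cabsM cabs_toC ger0_norm// => E'.
  have : a * cabs z <= a * (2 / (1 + a)) by rewrite ler_wpM2l// ler_pdivlMr// ltW.
  by rewrite -E' mulrA ler_pdivlMr// mul1r; lra.
have zR z : cabs z < S -> cabs z < R0 by move=> zS; exact: lt_le_trans SR.
have da : differentiable f (toC a).
  by apply: df; rewrite cabs_toC ger0_norm//; exact: lt_trans R1.
(* On the unit circle z / (z - a) is the conjugate of 1 / (1 - a z). So the term v z / (z - a),
   which the difference quotient subtracts, has the same real part as [K z] and is compensated by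
   it. At the centre, where the other term vanishes, [K] has real part |f a|. *)
pose K z := conjC v * (1 - toC a * z)^-1.
pose G z := u * z * q z + K z.
have dK z : cabs z < S -> differentiable K z.
  move=> zS; apply: differentiableM; first exact: differentiable_cst.
  apply: (@differentiableV _ _ (fun z => 1 - toC a * z)); last exact: Sa.
  apply: differentiableB; first exact: differentiable_cst.
  exact: differentiable_cmul.
have cM (f1 f2 : CC R -> CC R) z : ccontinuous_at f1 z -> ccontinuous_at f2 z ->
   ccontinuous_at (fun z => f1 z * f2 z) z.
  move=> c1 c2 e e0; pose k := cabs (f1 z) + cabs (f2 z) + 1.
  have k0 : 0 < k by rewrite ltr_wpDl// addr_ge0 ?cabs_ge0.
  have k1 : 1 <= k by rewrite lerDr addr_ge0 ?cabs_ge0.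
  have [m [m0 m1 mk]] : exists m : R, [/\ 0 < m, m <= 1 & m * k <= e / 2].
    exists (Num.min 1 (e / 2 / k)); split; rewrite ?lt_min ?ltr01 ?divr_gt0 ?ge_min ?lexx//.
    by rewrite -ler_pdivlMr// ge_min lexx orbT.
  have [d1 d10 H1] := c1 m m0; have [d2 d20 H2] := c2 m m0.
  exists (Num.min d1 d2); first by rewrite lt_min d10.
  move=> h; rewrite lt_min => /andP[/H1 {}H1 /H2 {}H2].
  have E (x y r s : CC R) : x * y - r * s =
     (x - r) * (y - s) + (x - r) * s + r * (y - s) by ring.
  rewrite E.
  apply: le_trans (cabsD _ _) _; apply: le_trans (lerD (cabsD _ _) (lexx _)) _.
  rewrite !cabsM.
  have x1 : cabs (f1 (z + h) - f1 z) * cabs (f2 (z + h) - f2 z) <= m * 1.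
    by apply: ler_pM; rewrite ?cabs_ge0//; exact: le_trans m1.
  have x2 : cabs (f1 (z + h) - f1 z) * cabs (f2 z) <= m * cabs (f2 z).
    by rewrite ler_wpM2r ?cabs_ge0.
  have x3 : cabs (f1 z) * cabs (f2 (z + h) - f2 z) <= cabs (f1 z) * m.
    by rewrite ler_wpM2l ?cabs_ge0.
  by move: mk; rewrite /k; lra.
have cG z : cabs z < S -> ccontinuous_at G z.
  move=> zS e e0.
  have c1 : ccontinuous_at (fun z => u * z * q z) z.
    apply: cM; last exact: difference_quotient_continuous da (df _ (zR _ zS)).
    exact/differentiable_ccontinuous/differentiable_cmul.
  have e2 : 0 < e / 2 by rewrite divr_gt0.
  have [d1 d10 H1] := c1 _ e2.
  have [d2 d20 H2] := differentiable_ccontinuous (dK z zS) e2.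
  exists (Num.min d1 d2); first by rewrite lt_min d10.
  move=> h; rewrite lt_min => /andP[/H1 {}H1 /H2 {}H2].
  rewrite /G opprD addrACA; apply: le_trans (cabsD _ _) _; lra.
have dG z : z != 0 -> z != toC a -> cabs z < S -> differentiable G z.
  move=> _ za zS; apply: differentiableD; last exact: dK.
  apply: differentiableM; last exact: difference_quotient_differentiable (df _ (zR _ zS)).
  exact: differentiable_cmul.
have := mean_value a0 a1 S1 cG dG.
have -> : Re (G 0) = cabs (f (toC a)).
  by rewrite /G /K !(mulr0, mul0r, add0r, subr0, invr1, mulr1) -uE /v Re_conjC.
move=> <-.
have ipi (k : R -> R) : continuous k ->
    lebesgue_measure.-integrable `[- pi, pi] (EFin \o k).
  move=> ck; apply: continuous_compact_integrable; first exact: segment_compact.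
  exact: continuous_subspaceT.
have p1 t : cabs (cpolar 1 t : CC R) = 1 by exact: cabs_cpolar.
have cf : continuous (fun t : R => cabs (f (cpolar 1 t))).
  by apply: circle_cabs_continuous => t; apply/differentiable_ccontinuous/df; rewrite p1.
rewrite -RintegralZl//; last exact: ipi.
apply: le_Rintegral => //.
- by apply: ipi; apply: circle_continuous => t; apply: cG; rewrite p1.
- apply: ipi => t; apply: cvgM; [exact: cvg_cst|exact: cf].
move=> t _; set z := cpolar 1 t.
have z1 : cabs z = 1 by exact: p1.
have za : z != toC a.
  by apply/eqP => E; move: z1; rewrite E cabs_toC ger0_norm// => E'; move: a1; rewrite E' ltxx.
have za0 : z - toC a != 0 by rewrite subr_eq0.
have zb : 1 - a <= cabs (z - toC a).
  have := cabsD (z - toC a) (toC a); rewrite subrK z1 cabs_toC ger0_norm//; lra.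
have -> : Re (G z) = Re (u * z * f z / (z - toC a)).
  have E (x y p k w c : CC R) : w - p != 0 ->
      x * w * ((y - k) / (w - p)) + c = x * w * y / (w - p) + (c - x * k * (w / (w - p))).
    by move=> ?; field.
  rewrite /G /q /difference_quotient ifN// E// -/v ReD ReB.
  have -> : z / (z - toC a) = conjC (1 - toC a * z)^-1.
    have zz : conjC z * z = 1 by rewrite conjC_mul z1 expr1n toC1.
    have cz0 : conjC z != 0 by apply/eqP => E'; move: zz; rewrite E' mul0r => /eqP; rewrite eq_sym oner_eq0.
    have ca : conjC (toC a) = toC a by apply: CC_ext; rewrite !CE ?oppr0.
    rewrite conjCV conjC1B ca.
    have -> : 1 - toC a * conjC z = conjC z * (z - toC a).
      by rewrite mulrBr zz [_ * conjC z]mulrC.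
    by rewrite invfM; congr (_ * _); apply: (mulfI cz0); rewrite zz divff.
  rewrite /K; set x := (1 - _)^-1; rewrite [Re (conjC v * x)]ReM [Re (v * conjC x)]ReM !CE.
  ring.
apply: le_trans (le_trans (ler_norm _) (Re_le_cabs _)) _.
rewrite !cabsM u1 z1 !mul1r cabsV mulrC ler_wpM2r ?cabs_ge0//.
by rewrite lef_pV2 ?posrE//; apply: lt_le_trans zb.
Qed.

End cauchy_estimates.

(** * Several variables *)

Section vnorm.
Variables (R : realType) (n : nat).
Local Notation C := (CC R).
Local Notation V := ('rV[C]_n).
Implicit Types (x y z h : V) (c : C).

(** The Euclidean norm; the norm carried by row vectors, and hence [rnorm], is the supremum norm. *)
Definition vnorm z : R := Num.sqrt (\sum_k cabs (z 0 k) ^+ 2).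

Lemma sum_cabs_ge0 z : 0 <= \sum_k cabs (z 0 k) ^+ 2.
Proof. by apply: sumr_ge0 => k _; rewrite sqr_ge0. Qed.

Lemma vnorm_ge0 z : 0 <= vnorm z. Proof. exact: sqrtr_ge0. Qed.

Lemma sqr_vnorm z : vnorm z ^+ 2 = \sum_k cabs (z 0 k) ^+ 2.
Proof. by rewrite sqr_sqrtr// sum_cabs_ge0. Qed.

Lemma vnormZ c z : vnorm (c *: z) = cabs c * vnorm z.
Proof.
rewrite /vnorm (eq_bigr (fun k => cabs c ^+ 2 * cabs (z 0 k) ^+ 2)) => [|k _].
  by rewrite -mulr_sumr sqrtrM ?sqr_ge0// sqrtr_sqr ger0_norm ?cabs_ge0.
by rewrite mxE cabsM exprMn.
Qed.

Lemma vnorm0 : vnorm 0 = 0.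
Proof. by rewrite -(scale0r (0 : V)) vnormZ cabs0 mul0r. Qed.

Lemma vnormN z : vnorm (- z) = vnorm z.
Proof. by rewrite -scaleN1r vnormZ cabsN cabs1 mul1r. Qed.

Lemma vnormB x y : vnorm (x - y) = vnorm (y - x).
Proof. by rewrite -vnormN opprB. Qed.

Lemma cabs_le_vnorm z k : cabs (z 0 k) <= vnorm z.
Proof.
rewrite -(@ler_pXn2r _ 2) ?nnegrE ?cabs_ge0 ?vnorm_ge0// sqr_vnorm (bigD1 k)//=.
by rewrite lerDl sumr_ge0// => j _; rewrite sqr_ge0.
Qed.

(** Cauchy-Schwarz, from 2 x y <= x^2 + y^2 applied to the normalized families a / A and b / B. *)
Lemma sum_prod_le (I : finType) (a b : I -> R) :
  \sum_i a i * b i <= Num.sqrt (\sum_i a i ^+ 2) * Num.sqrt (\sum_i b i ^+ 2).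
Proof.
have s0 (u : I -> R) : 0 <= \sum_i u i ^+ 2 by apply: sumr_ge0 => i _; rewrite sqr_ge0.
have z0 (u : I -> R) : \sum_i u i ^+ 2 = 0 -> forall i, u i = 0.
  move=> /eqP; rewrite psumr_eq0 => [/allP h i|i _]; last by rewrite sqr_ge0.
  by have := h i (mem_index_enum i); rewrite /= sqrf_eq0 => /eqP.
set A := Num.sqrt _; set B := Num.sqrt _.
have [A0|A0] := eqVneq (\sum_i a i ^+ 2) 0.
  rewrite big1 => [|i _]; last by rewrite (z0 _ A0) mul0r.
  by rewrite mulr_ge0 ?sqrtr_ge0.
have [B0|B0] := eqVneq (\sum_i b i ^+ 2) 0.
  rewrite big1 => [|i _]; last by rewrite (z0 _ B0) mulr0.
  by rewrite mulr_ge0 ?sqrtr_ge0.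
have Ap : 0 < A by rewrite sqrtr_gt0 lt_def A0 s0.
have Bp : 0 < B by rewrite sqrtr_gt0 lt_def B0 s0.
have A2 : \sum_i a i ^+ 2 = A ^+ 2 by rewrite sqr_sqrtr.
have B2 : \sum_i b i ^+ 2 = B ^+ 2 by rewrite sqr_sqrtr.
have -> : A * B = \sum_i (A * B / 2 * (a i ^+ 2 / A ^+ 2 + b i ^+ 2 / B ^+ 2)).
  rewrite -mulr_sumr big_split /= -!mulr_suml A2 B2 !divff ?sqrf_eq0 ?gt_eqF//.
  by field.
apply: ler_sum => i _; rewrite -subr_ge0.
have -> : A * B / 2 * (a i ^+ 2 / A ^+ 2 + b i ^+ 2 / B ^+ 2) - a i * b i =
   A * B / 2 * (a i / A - b i / B) ^+ 2 by field; rewrite ?gt_eqF.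
by rewrite mulr_ge0 ?sqr_ge0 ?mulr_ge0 ?invr_ge0 ?(ltW Ap) ?(ltW Bp).
Qed.

Lemma vnormD x y : vnorm (x + y) <= vnorm x + vnorm y.
Proof.
rewrite -(@ler_pXn2r _ 2) ?nnegrE ?addr_ge0 ?vnorm_ge0// sqrrD !sqr_vnorm.
apply: (@le_trans _ _ (\sum_k (cabs (x 0 k) ^+ 2 + (cabs (x 0 k) * cabs (y 0 k)) *+ 2 + cabs (y 0 k) ^+ 2))).
  apply: ler_sum => k _; rewrite mxE -sqrrD ler_pXn2r ?nnegrE ?addr_ge0 ?cabs_ge0//.
  exact: cabsD.
rewrite big_split /= lerD2r big_split /= lerD2l sumrMnl.
by rewrite mulr2n [X in _ <= X]mulr2n lerD// sum_prod_le.
Qed.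

Lemma rnorm_le_vnorm z : rnorm z <= vnorm z.
Proof.
have [z0|z0] := eqVneq `|z| 0; first by rewrite /rnorm z0 Re0 vnorm_ge0.
have [[i j] /= E] := mx_norm_neq0 z0.
by rewrite /rnorm [`|z|]E (ord1 i) norm_cabs Re_toC cabs_le_vnorm.
Qed.

Lemma cabs_le_rnorm z k : cabs (z 0 k) <= rnorm z.
Proof.
rewrite -ler_toC -norm_cabs -norm_rnorm.
have -> : `|z| = mx_norm z by [].
rewrite mx_normE -[`|z 0 k|]nngE num_le.
by apply/bigmax_geP; right => /=; exists (0, k).
Qed.

Lemma vnorm_le_rnorm z : vnorm z <= Num.sqrt n%:R * rnorm z.
Proof.
have r0 : 0 <= rnorm z by have [] := ge0_toC (normr_ge0 z).
rewrite -(@ler_pXn2r _ 2) ?nnegrE ?mulr_ge0 ?vnorm_ge0 ?sqrtr_ge0//.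
rewrite sqr_vnorm exprMn sqr_sqrtr// mulr_natl.
rewrite -[X in _ <= _ *+ X]card_ord -sumr_const; apply: ler_sum => k _.
by rewrite ler_pXn2r ?nnegrE ?cabs_ge0// cabs_le_rnorm.
Qed.

End vnorm.

Section slices.
Variables (R : realType) (n : nat).
Local Notation C := (CC R).
Local Notation V := ('rV[C]_n).
Implicit Types (f : V -> C) (z h : V).

Lemma slice_cderive f z h (l : C) : differentiable f (z + l *: h) ->
  differentiable (fun l : C => f (z + l *: h)) l /\
  cderive (fun l : C => f (z + l *: h)) l = 'd f (z + l *: h) h.
Proof.
move=> df; apply: expansion_cderive => e e0.
have h0 : 0 <= vnorm h := vnorm_ge0 h.
have h1 : 0 < vnorm h + 1 by rewrite ltr_wpDl.
have [d d0 H] := differentiable_expansion df (divr_gt0 e0 h1).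
exists (d / (vnorm h + 1)); first by rewrite divr_gt0.
move=> k; rewrite ltr_pdivlMr// => kd.
have kh : rnorm (k *: h) <= cabs k * (vnorm h + 1).
  apply: le_trans (rnorm_le_vnorm _) _; rewrite vnormZ ler_wpM2l ?cabs_ge0//.
  by rewrite lerDl.
have := H _ (le_lt_trans kh kd).
have -> : z + l *: h + k *: h = z + (l + k) *: h by rewrite scalerDl addrA.
have -> : 'd f (z + l *: h) (k *: h) = k * 'd f (z + l *: h) h by rewrite linearZ.
move/le_trans; apply.
rewrite mulrAC ler_pdivrMr// -mulrA ler_pM2l//; exact: kh.
Qed.

(* All the estimates for [f] near [z] come from its restrictions to complex lines. *)
Lemma slice_ball z h (r : R) (l : C) : vnorm h != 0 ->
  cabs l < r / vnorm h -> vnorm (z + l *: h) < vnorm z + r.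
Proof.
move=> h0 lr; have h1 : 0 < vnorm h by rewrite lt_def h0 vnorm_ge0.
apply: le_lt_trans (vnormD _ _) _; rewrite ltrD2l vnormZ.
by rewrite -ltr_pdivlMr.
Qed.

Lemma vnorm_eq0 h : vnorm h = 0 -> h = 0.
Proof.
move=> h0; apply/rowP => k; rewrite mxE; apply/eqP; rewrite -cabs_eq0.
by rewrite eq_le cabs_ge0 -h0 cabs_le_vnorm.
Qed.

Lemma holomorphic_diff_le f z h (r M : R) : 0 < r ->
  (forall w, vnorm w < vnorm z + r -> differentiable f w) ->
  (forall w, vnorm w < vnorm z + r -> cabs (f w) <= M) ->
  cabs ('d f z h) <= 4 * M / r * vnorm h.
Proof.
move=> r0 df fM.
have zr : vnorm z < vnorm z + r by rewrite ltrDl.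
have [h0|h0] := eqVneq (vnorm h) 0.
  by rewrite h0 (vnorm_eq0 h0) linear0 cabs0 mulr0.
have h1 : 0 < vnorm h by rewrite lt_def h0 vnorm_ge0.
have dz : differentiable f (z + 0 *: h) by rewrite scale0r addr0; exact: df.
have [_] := slice_cderive dz; rewrite scale0r addr0 => <-.
have -> : 4 * M / r * vnorm h = 2 * M / (r / vnorm h / 2) by field; rewrite ?gt_eqF.
apply: (@cauchy_estimate R _ 0 (r / vnorm h / 2) (r / vnorm h)).
- by rewrite !divr_gt0.
- by have : 0 < r / vnorm h := divr_gt0 r0 h1; lra.
- move=> l; rewrite subr0 => lr.
  exact: (slice_cderive (df _ (slice_ball z h0 lr))).1.
- by move=> l; rewrite subr0 => lr; exact: fM (slice_ball z h0 lr).
Qed.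

Lemma holomorphic_lipschitz f z h (r M : R) : 0 < r ->
  (forall w, vnorm w < vnorm z + r -> differentiable f w) ->
  (forall w, vnorm w < vnorm z + r -> cabs (f w) <= M) ->
  vnorm h <= r / 2 ->
  cabs (f (z + h) - f z) <= 8 * M / r * vnorm h.
Proof.
move=> r0 df fM hr.
have [h0|h0] := eqVneq (vnorm h) 0.
  by rewrite h0 (vnorm_eq0 h0) addr0 subrr cabs0 mulr0.
have h1 : 0 < vnorm h by rewrite lt_def h0 vnorm_ge0.
have -> : 8 * M / r * vnorm h = 8 * M / (r / vnorm h) * cabs (1 : C).
  by rewrite cabs1; field; rewrite ?gt_eqF.
have := @bounded_holomorphic_lipschitz R (fun l : C => f (z + l *: h)) 0 1 (r / vnorm h) M.
rewrite add0r scale1r scale0r addr0; apply.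
- by rewrite divr_gt0.
- move=> l; rewrite subr0 => lr.
  exact: (slice_cderive (df _ (slice_ball z h0 lr))).1.
- by move=> l; rewrite subr0 => lr; exact: fM (slice_ball z h0 lr).
- by rewrite cabs1 mulrAC ler_pdivlMr// mul1r.
Qed.

Lemma holomorphic_taylor2 f z h (r M : R) : 0 < r ->
  (forall w, vnorm w < vnorm z + r -> differentiable f w) ->
  (forall w, vnorm w < vnorm z + r -> cabs (f w) <= M) ->
  vnorm h <= r / 4 ->
  cabs (f (z + h) - f z - 'd f z h) <= 128 * M / r ^+ 2 * vnorm h ^+ 2.
Proof.
move=> r0 df fM hr.
have [h0|h0] := eqVneq (vnorm h) 0.
  by rewrite h0 (vnorm_eq0 h0) addr0 linear0 subrr subr0 cabs0 expr0n mulr0.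
have h1 : 0 < vnorm h by rewrite lt_def h0 vnorm_ge0.
have -> : 128 * M / r ^+ 2 * vnorm h ^+ 2 = 128 * M / (r / vnorm h) ^+ 2 * cabs (1 : C) ^+ 2.
  by rewrite cabs1; field; rewrite ?gt_eqF.
have zr : vnorm z < vnorm z + r by rewrite ltrDl.
have dz : differentiable f (z + 0 *: h) by rewrite scale0r addr0; exact: df.
have [_] := slice_cderive dz; rewrite scale0r addr0 => E.
have := @bounded_holomorphic_taylor2 R (fun l : C => f (z + l *: h)) 0 1 (r / vnorm h) M.
rewrite add0r scale1r scale0r addr0 mul1r E; apply.
- by rewrite divr_gt0.
- move=> l; rewrite subr0 => lr.
  exact: (slice_cderive (df _ (slice_ball z h0 lr))).1.
- by move=> l; rewrite subr0 => lr; exact: fM (slice_ball z h0 lr).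
- by rewrite cabs1 mulrAC ler_pdivlMr// mul1r.
Qed.

End slices.

(** * Limits of bounded holomorphic functions along an ultrafilter *)

Section filter_limits.
Variables (R : realType) (U : set_system nat).
Local Notation C := (CC R).
Implicit Types (u v : nat -> C) (l : C).

Definition clim u l := forall e : R, 0 < e -> U [set k | cabs (u k - l) < e].

Context {FU : ProperFilter U}.

Lemma clim_le u l (B : R) : clim u l -> U [set k | cabs (u k) <= B] -> cabs l <= B.
Proof.
move=> ul uB; apply/ler_addgt0Pl => e e0.
have [k [/= k1 k2]] := filter_ex (filterI (ul _ e0) uB).
rewrite -(subrK (u k) l); apply: le_trans (cabsD _ _) _; rewrite cabsC.
by apply: lerD => //; exact: ltW.
Qed.

Lemma clim_unique u l l' : clim u l -> clim u l' -> l = l'.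
Proof.
move=> ul ul'; apply/eqP; rewrite -subr_eq0 -cabs_eq0 eq_le cabs_ge0 andbT.
apply/ler_addgt0Pl => e e0; rewrite addr0; have e2 : 0 < e / 2 by rewrite divr_gt0.
have [k [/= k1 k2]] := filter_ex (filterI (ul _ e2) (ul' _ e2)).
rewrite -(subrK (u k) l) -addrA; apply: le_trans (cabsD _ _) _; rewrite cabsC; lra.
Qed.

Lemma climD u v l m : clim u l -> clim v m -> clim (fun k => u k + v k) (l + m).
Proof.
move=> ul vm e e0; have e2 : 0 < e / 2 by rewrite divr_gt0.
apply: filterS (filterI (ul _ e2) (vm _ e2)) => k /= [k1 k2].
rewrite opprD addrACA; apply: le_lt_trans (cabsD _ _) _; lra.
Qed.

Lemma climZ (c : C) u l : clim u l -> clim (fun k => c * u k) (c * l).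
Proof.
move=> ul e e0; have c0 : 0 < cabs c + 1 by rewrite ltr_wpDl ?cabs_ge0.
apply: filterS (ul _ (divr_gt0 e0 c0)) => k /=; rewrite -mulrBr cabsM ltr_pdivlMr// => h.
by apply: le_lt_trans h; rewrite mulrC ler_wpM2l ?cabs_ge0// lerDl.
Qed.

Lemma climB u v l m : clim u l -> clim v m -> clim (fun k => u k - v k) (l - m).
Proof.
move=> ul vm; have := climD ul (climZ (-1) vm); rewrite mulN1r.
by have -> // : (fun k => u k + -1 * v k) = (fun k => u k - v k); apply/funext => k; rewrite mulN1r.
Qed.

End filter_limits.

(** By compactness the real and imaginary parts cluster somewhere along [U], and an ultrafilter
    converges to each of its cluster points: a neighbourhood outside [U] would have its complement
    in [U]. *)
Lemma clim_ultra (R : realType) (U : set_system nat) (u : nat -> CC R) (B : R) :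
  UltraFilter U -> (forall k, cabs (u k) <= B) -> exists l, clim U u l.
Proof.
move=> UU uB.
have real (v : nat -> R) : (forall k, `|v k| <= B) ->
    exists l, forall e, 0 < e -> U [set k | `|v k - l| < e].
  move=> vB; have cB := @segment_compact R (- B) B.
  have [|l [_ cl]] := cB (v @ U) _ _.
    by apply: (@filterE _ U _) => k; rewrite /= in_itv /= -ler_norml.
  exists l => e e0.
  have [//|nU] := in_ultra_setVsetC [set k | `|v k - l| < e] UU.
  have [||x [/= xn xl]] := cl [set x | ~ `|x - l| < e] (ball l e) _ _.
  - exact: nU.
  - exact: nbhsx_ballx.
  by case: xn; rewrite distrC.
have [|a ha] := real (fun k => Re (u k)).
  by move=> k; apply: le_trans (uB k); exact: Re_le_cabs.
have [|b hb] := real (fun k => Im (u k)).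
  by move=> k; apply: le_trans (uB k); exact: Im_le_cabs.
exists (mkC a b) => e e0; have e2 : 0 < e / 2 by rewrite divr_gt0.
apply: filterS (filterI (ha _ e2) (hb _ e2)) => k /= [k1 k2].
by apply: le_lt_trans (cabs_leD _) _; rewrite !CE; lra.
Qed.

Section limits_of_holomorphic_functions.
Variables (R : realType) (n : nat).
Local Notation C := (CC R).
Local Notation V := ('rV[C]_n).

(* The second order expansions of the functions of a bounded sequence are uniform,
   so that they pass to the limit. *)
Lemma clim_differentiable (U : set_system nat) (f : nat -> V -> C) (g : V -> C) (M : R) z :
  UltraFilter U ->
  (forall k w, vnorm w < 1 -> differentiable (f k) w) ->
  (forall k w, vnorm w < 1 -> cabs (f k w) <= M) ->
  (forall w, vnorm w < 1 -> clim U (fun k => f k w) (g w)) ->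
  vnorm z < 1 -> differentiable g z.
Proof.
move=> UU df fM fg z1.
have PU : ProperFilter U by exact: ultra_proper.
pose r := 1 - vnorm z; have r0 : 0 < r by rewrite subr_gt0.
have zr : vnorm z + r = 1 by rewrite /r addrC subrK.
have df' k w : vnorm w < vnorm z + r -> differentiable (f k) w by rewrite zr; exact: df.
have fM' k w : vnorm w < vnorm z + r -> cabs (f k w) <= M by rewrite zr; exact: fM.
have M0 : 0 <= M by apply: le_trans (fM 0%N z z1); exact: cabs_ge0.
have dB h k : cabs ('d (f k) z h) <= 4 * M / r * vnorm h.
  exact: (holomorphic_diff_le _ r0 (df' k) (fM' k)).
(* The differentials are bounded uniformly in [k], so they converge along [U] as well, to the
   candidate for the differential of [g]. *)
have /choice[L hL] : forall h, exists l, clim U (fun k => 'd (f k) z h) l.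
  by move=> h; apply: clim_ultra => k; exact: dB.
have linL : linear L.
  move=> c x y; apply: (@clim_unique R U _ (fun k => 'd (f k) z (c *: x + y))); first exact: hL.
  have := @climD R U PU _ _ _ _ (@climZ R U PU c _ _ (hL x)) (hL y).
  have -> // : (fun k : nat => c * 'd (f k) z x + 'd (f k) z y) =
    (fun k => 'd (f k) z (c *: x + y)).
  by apply/funext => k; rewrite linearP.
pose linM := GRing.isLinear.Build _ _ _ _ _ linL.
pose LL : {linear V -> C} := HB.pack L linM.
have LB h : cabs (L h) <= 4 * M / r * vnorm h.
  by apply: clim_le (hL h) _; apply: filterE => k; exact: dB.
pose K := 4 * M / r * Num.sqrt n%:R + 1.
have K0' : 0 <= 4 * M / r by rewrite !mulr_ge0// invr_ge0 ltW.
have K0 : 0 < K by rewrite ltr_wpDl// mulr_ge0 ?sqrtr_ge0.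
have cL : continuous (LL : V -> C).
  apply: continuousfor0_continuous => /=.
  rewrite /prop_for /continuous_at /=.
  have -> : L 0 = 0 by exact: (linear0 LL).
  apply/(@cabs_cvgP R V (nbhs (0 : V)) (nbhs_filter (0 : V)) L 0) => e e0.
  apply: (@near0_rnormP R V (fun h => cabs (L h - 0) < e)).2.
  exists (e / K); first by rewrite divr_gt0.
  move=> h; rewrite ltr_pdivlMr// subr0 => hk.
  apply: le_lt_trans (LB h) _; apply: le_lt_trans hk.
  apply: le_trans (ler_wpM2l K0' (vnorm_le_rnorm h)) _.
  have rh : 0 <= rnorm h by have [] := ge0_toC (normr_ge0 h).
  by rewrite mulrA [leRHS]mulrC ler_wpM2r// /K lerDl.
have [] // := @expansion_differentiable R V g z LL cL.
move=> e e0.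
(* Differentiability refers to the supremum norm, whence the factor [n] in |h|^2 <= n
   [rnorm h]^2. *)
pose Q := 128 * M / r ^+ 2 * n%:R + 1.
have Q0' : 0 <= 128 * M / r ^+ 2.
  by rewrite !mulr_ge0// invr_ge0 exprn_ge0// ltW.
have Q0 : 0 < Q by rewrite ltr_wpDl// mulr_ge0.
have s0 : 0 < Num.sqrt n%:R + 1 :> R by rewrite ltr_wpDl ?sqrtr_ge0.
exists (Num.min (r / 4 / (Num.sqrt n%:R + 1)) (e / Q)).
  by rewrite lt_min !divr_gt0.
move=> h; rewrite lt_min (ltr_pdivlMr _ _ s0) (ltr_pdivlMr _ _ Q0) => /andP[h1 h2].
have rh : 0 <= rnorm h by have [] := ge0_toC (normr_ge0 h).
have hr : vnorm h <= r / 4.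
  apply: le_trans (vnorm_le_rnorm h) _; apply: le_trans (ltW h1).
  by rewrite mulrC ler_wpM2l// lerDl.
have zh1 : vnorm (z + h) < 1.
  by apply: le_lt_trans (vnormD _ _) _; rewrite -zr ltrD2l; lra.
have lim := @climB R U PU _ _ _ _ (@climB R U PU _ _ _ _ (fg _ zh1) (fg _ z1)) (hL h).
apply: (@le_trans _ _ (128 * M / r ^+ 2 * vnorm h ^+ 2)).
  apply: clim_le lim _; apply: filterE => k.
  exact: (holomorphic_taylor2 r0 (df' k) (fM' k) hr).
have v2 : vnorm h ^+ 2 <= n%:R * rnorm h ^+ 2.
  have := vnorm_le_rnorm h; rewrite -(@ler_pXn2r _ 2) ?nnegrE ?mulr_ge0 ?vnorm_ge0 ?sqrtr_ge0//.
  by rewrite exprMn (@sqr_sqrtr R n%:R) ?ler0n.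
apply: le_trans (ler_wpM2l Q0' v2) _.
rewrite expr2 !mulrA ler_wpM2r//; apply: le_trans (ltW h2).
by rewrite [leRHS]mulrC ler_wpM2r// /Q lerDl.
Qed.

End limits_of_holomorphic_functions.

(** * The surface measure *)

Section open_sets.
Variables (R : realType) (d : nat).
Local Notation T := (Rspace R d).

Definition cube (t : T) (r : R) : set T :=
  [set s | forall i, `|(tnth s i : R) - tnth t i| < r].

Lemma measurable_cube (t : T) r : measurable (cube t r).
Proof.
rewrite (_ : cube t r = \bigcap_(i in [set: 'I_d])
   ((fun s : T => tnth s i) @^-1` (ball (tnth t i : R) r))); last first.
  apply/seteqP; split => [s h i _|s h i] /=.
    by rewrite /ball /= distrC; exact: h.
  by have := h i I; rewrite /= /ball /= distrC.
apply: fin_bigcap_measurable => // i _; rewrite -[X in measurable X]setTI.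
apply: measurable_tnth => //; exact: measurable_ball.
Qed.

(** An open set is a countable union of cubes with rational centres and radii 1 / (k + 1). Taking 1
    / (k + 1) < r / 2 puts the cube around a rational point close to [t] inside [cube t r]. *)
Lemma cube_open_measurable (A : set T) :
  (forall t, A t -> exists2 r : R, 0 < r & cube t r `<=` A) -> measurable A.
Proof.
move=> oA.
pose F (q : (d.-tuple rat * nat)%type) : set T :=
  let c := [tuple (ratr (tnth q.1 i) : R) | i < d] in
  let Q := cube c (q.2.+1%:R^-1) in
  if `[< Q `<=` A >] then Q else set0.
rewrite (_ : A = \bigcup_q F q).
  apply: countable_bigcupT_measurable; first exact: countableP.
  move=> q; rewrite /F; case: asboolP => // _; exact: measurable_cube.
apply/seteqP; split => [t /oA[r r0 rA]|t [q _]]; last first.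
  by rewrite /F; case: asboolP => // qA; exact: qA.
have [k kr] : exists k : nat, k.+1%:R^-1 < r / 2.
  have r2 : 0 < r / 2 by rewrite divr_gt0.
  by case: (near_infty_natSinv_lt (PosNum r2)) => k _ H; exists k; exact: (H k (leqnn k)).
have k0 : 0 < k.+1%:R^-1 :> R by rewrite invr_gt0.
have [e eE] : exists e : R, e = k.+1%:R^-1 by exists (k.+1%:R^-1).
rewrite -eE in kr k0.
have /choice[q hq] : forall i : 'I_d, exists q : rat, `|(tnth t i : R) - ratr q| < e.
  move=> i; have : (tnth t i : R) - e < tnth t i + e by lra.
  move=> /rat_in_itvoo[q]; rewrite in_itv /= => /andP[h1 h2]; exists q.
  by rewrite ltr_norml; lra.
exists ([tuple q i | i < d], k) => //; rewrite /F /= -eE; case: asboolP => [_ i|] /=.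
  by rewrite !tnth_mktuple; exact: hq.
case=> s /= hs; apply: rA => i; have := hs i; have := hq i; rewrite !tnth_mktuple.
rewrite !ltr_norml => /andP[? ?] /andP[? ?]; lra.
Qed.

Lemma cube_continuous_measurable (A : set T) (f : T -> R) :
  (forall t, A t -> forall e : R, 0 < e -> exists2 r : R, 0 < r &
     forall s, cube t r s -> A s /\ `|f s - f t| < e) ->
  measurable A /\ measurable_fun A f.
Proof.
move=> H; have mA : measurable A.
  apply: cube_open_measurable => t /H/(_ _ (@ltr01 R))[r r0 h].
  by exists r => // s /h[].
split => // _; apply: (measurability _ (RGenOInfty.measurableE R)) => //.
move=> _ [_ [x ->] <-]; apply: cube_open_measurable => t [At /=].
rewrite in_itv /= andbT => xt.
have [|r r0 h] := H t At (f t - x); first by rewrite subr_gt0.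
exists r => // s /h[As]; rewrite ltr_norml => /andP[fs _]; split => //=.
by rewrite in_itv /= andbT; move: fs; rewrite ltrBrDr; lra.
Qed.

End open_sets.

(** * Invariance of Lebesgue measure under shears *)

Section shears.
Variable R : realType.
Local Notation lam := (lebesgue_measure_Rspace R).

Lemma lebesgue_measure_translation (c : R) (A : set (measurableTypeR R)) :
  measurable A ->
  lebesgue_measure ((fun x : measurableTypeR R => (x + c : R)) @^-1` A) = lebesgue_measure A.
Proof.
have mc : measurable_fun [set: measurableTypeR R] (fun x : measurableTypeR R => (x + c : R) : measurableTypeR R).
  exact: measurable_funD.
move=> mA.
pose mu := (measure_function_pushforward__canonical__measure_function_Measure (@lebesgue_measure R) mc).
rewrite -[LHS]/(mu A); apply/esym/lebesgue_measure_unique => // X [[a b] _ <-].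
rewrite /mu /= /pushforward.
rewrite (_ : _ @^-1` _ = `](a - c), (b - c)]%classic); last first.
  by apply/seteqP; split => x /=; rewrite !in_itv /=; lra.
rewrite !lebesgue_measure_itv /= !lte_fin ltrD2r; case: ifP => // _.
by congr EFin; lra.
Qed.

Definition shear (d : nat) (I : pred 'I_d) (c : 'I_d -> Rspace R d -> R) (t : Rspace R d) : Rspace R d :=
  [tuple (if I i then (tnth t i : R) + c i t else tnth t i) | i < d].

Lemma measurable_shear d I c : (forall i, measurable_fun [set: Rspace R d] (c i)) ->
  measurable_fun [set: Rspace R d] (shear I c).
Proof.
move=> mc; apply/measurable_fun_tnthP => i.
rewrite (_ : _ \o _ = fun t : Rspace R d => if I i then (tnth t i : R) + c i t else tnth t i).
  case: (I i); last exact: measurable_tnth.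
  by apply: measurable_funD => //; exact: measurable_tnth.
by apply/funext => t /=; rewrite tnth_mktuple.
Qed.

Lemma measure_preserving_integral d (T : measurableType d) (mu : {measure set T -> \bar R})
  (f : T -> T) (g : T -> \bar R) : measurable_fun setT f ->
  (forall A, measurable A -> mu (f @^-1` A) = mu A) ->
  measurable_fun setT g -> (forall x, (0 <= g x)%E) ->
  (\int[mu]_x g (f x) = \int[mu]_x g x)%E.
Proof.
move=> mf fmu mg g0.
have := @ge0_integral_pushforward _ _ T T R f mf mu setT g measurableT mg.
rewrite preimage_setT => <- //; apply: eq_measure_integral => A mA _.
exact: fmu.
Qed.

(** By the second hypothesis the increments depend only on coordinates that are not moved. Fubini
    then allows induction on the dimension. If coordinate 0 is fixed, every slice over it undergoes
    a shear in dimension [d]. If it is moved, its increment does not depend on it, so it is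
    integrated first, in the product of reversed order, and translation invariance removes it; the
    shear of the other coordinates is then the same in every slice. *)
Lemma shear_measure d (I : pred 'I_d) (c : 'I_d -> Rspace R d -> R) :
  (forall i, measurable_fun [set: Rspace R d] (c i)) ->
  (forall i t s, (forall j, ~~ I j -> tnth t j = tnth s j) -> c i t = c i s) ->
  forall A, measurable A -> lam d (shear I c @^-1` A) = lam d A.
Proof.
elim: d I c => [|d IH] I c mc hc A mA.
  congr (lam 0 _); apply/seteqP; split => t /=.
    by rewrite (tuple0 (shear I c t)) (tuple0 t).
  by rewrite (tuple0 (shear I c t)) (tuple0 t).
pose cp := @cons_pair R d.
have mcp : measurable_fun setT cp := @measurable_cons_pair R d.
have mT := measurable_shear I mc.
have mA' : measurable (cp @^-1` A) by rewrite -[X in measurable X]setTI; exact: mcp.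
have mTA : measurable (shear I c @^-1` A) by rewrite -[X in measurable X]setTI; exact: mT.
have mTA' : measurable (cp @^-1` (shear I c @^-1` A)).
  by rewrite -[X in measurable X]setTI; exact: mcp.
rewrite -[LHS]/((@lebesgue_measure R \x lam d)%E (cp @^-1` (shear I c @^-1` A))).
rewrite -[RHS]/((@lebesgue_measure R \x lam d)%E (cp @^-1` A)).
have mx x : measurable_fun setT (fun t : Rspace R d => cp (x, t)).
  by apply: measurableT_comp => //; exact: measurable_pair1.
have mcx x i : measurable_fun setT (fun t => c i (cp (x, t))).
  by apply: measurableT_comp => //; exact: mc.
pose I' : pred 'I_d := fun i => I (lift ord0 i).
pose c' x (i : 'I_d) t := c (lift ord0 i) (cp (x, t)).
have IH' x (B : set (Rspace R d)) : measurable B -> lam d (shear I' (c' x) @^-1` B) = lam d B.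
  apply: IH => [i|i t s h]; first exact: mcx.
  apply: hc => j; case: (unliftP ord0 j) => [k|] -> Ij; first by rewrite !tnthS h.
  by rewrite !tnth0.
have shE x t : shear I c (cp (x, t)) =
   cp ((if I ord0 then x + c ord0 (cp (x, t)) else x), shear I' (c' x) t).
  apply: eq_from_tnth => i; rewrite tnth_mktuple.
  by case: (unliftP ord0 i) => [k|] ->; rewrite ?tnthS ?tnth0 ?tnth_mktuple.
case: (boolP (I ord0)) => I0; last first.
  apply: eq_integral => x _ /=; rewrite -[RHS](IH' x); last exact: measurable_xsection.
  congr (lam d _); apply/seteqP; split => t; rewrite /xsection /= !inE /= shE (negbTE I0)//.
have c0 (x : R) t i : c i (cp (x, t)) = c i (cp (0, t)).
  apply: hc => j; case: (unliftP ord0 j) => [k|] ->; first by rewrite !tnthS.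
  by rewrite I0.
have pE B : measurable B ->
    (@lebesgue_measure R \x lam d)%E B = (@lebesgue_measure R \x^ lam d)%E B.
  by move=> mB; apply: product_measure_unique mB => *; exact: product_measure2E.
rewrite (pE _ mTA') (pE _ mA').
pose psi t := lebesgue_measure (ysection (cp @^-1` A) t).
rewrite -[RHS]/(\int[lam d]_t psi t)%E.
have mS : measurable_fun setT (shear I' (c' 0)).
  by apply: measurable_shear => i; exact: mcx.
rewrite -[RHS](@measure_preserving_integral _ _ (lam d) (shear I' (c' 0)) psi) //.
- apply: eq_integral => t _ /=; rewrite /psi.
  rewrite -[RHS](lebesgue_measure_translation (c ord0 (cp (0, t)))); last exact: measurable_ysection.
  congr lebesgue_measure; apply/seteqP; split => x; rewrite /ysection /= !inE /= shE I0 (c0 x);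
  by have -> : shear I' (c' x) t = shear I' (c' 0) t by
    apply: eq_from_tnth => i; rewrite !tnth_mktuple /c' c0.
- by move=> B mB; exact: IH'.
- exact: measurable_fun_ysection.
Qed.

End shears.

Section real_coordinates.
Variables (R : realType) (n : nat).
Local Notation C := (CC R).
Local Notation V := ('rV[C]_n).
Local Notation T := (Rspace R (n + n)).
Implicit Types (t s : T).

Definition cx (t : T) : V := complexify t.

Lemma cxE t k : cx t 0 k = mkC (tnth t (lshift n k)) (tnth t (rshift n k)).
Proof. by rewrite /cx /complexify mxE. Qed.

Definition uncx (z : V) : T :=
  [tuple match fintype.split i with inl k => Re (z 0 k) | inr k => Im (z 0 k) end | i < n + n].

Lemma cxK z : cx (uncx z) = z.
Proof.
apply/rowP => k; rewrite cxE !tnth_mktuple.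
have -> : fintype.split (lshift n k) = inl k by exact: (@unsplitK n n (inl k)).
have -> : fintype.split (rshift n k) = inr k by exact: (@unsplitK n n (inr k)).
exact: mkC_Re_Im.
Qed.

Lemma vnorm_cx t : vnorm (cx t) = enorm t.
Proof.
rewrite /vnorm /enorm big_split_ord /= -big_split /=; congr Num.sqrt.
by apply: eq_bigr => k _; rewrite cxE sqr_cabs !CE.
Qed.

Lemma cx_direction t : cx (direction t) = toC (enorm t)^-1 *: cx t.
Proof.
apply/rowP => k; rewrite [RHS]mxE !cxE !tnth_mktuple.
by apply: CC_ext; rewrite !CE; ring.
Qed.

Lemma vnorm_cx_direction t : enorm t != 0 -> vnorm (cx (direction t)) = 1.
Proof.
move=> t0; rewrite cx_direction vnormZ cabs_toC normfV vnorm_cx.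
by rewrite ger0_norm ?sqrtr_ge0// mulVf.
Qed.

Lemma vnorm_cx_direction_le1 t : vnorm (cx (direction t)) <= 1.
Proof.
have [t0|t0] := eqVneq (enorm t) 0; last by rewrite vnorm_cx_direction.
by rewrite cx_direction t0 invr0 toC0 scale0r vnorm0.
Qed.

Lemma direction_id t : enorm t = 1 -> direction t = t.
Proof.
by move=> t1; apply: eq_from_tnth => i; rewrite tnth_mktuple t1 divr1.
Qed.

Lemma vnorm_le_sum (z : V) : vnorm z <= \sum_k cabs (z 0 k).
Proof.
have s0 (r : seq 'I_n) : 0 <= \sum_(k <- r) cabs (z 0 k).
  by apply: sumr_ge0 => k _; exact: cabs_ge0.
rewrite -(@ler_pXn2r _ 2) ?nnegrE ?vnorm_ge0// sqr_vnorm.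
elim: (index_enum _) => [|k r IH]; first by rewrite !big_nil expr0n.
rewrite !big_cons sqrrD -addrA lerD2l; apply: le_trans IH _.
by rewrite lerDr mulrn_wge0// mulr_ge0 ?cabs_ge0.
Qed.

Lemma cube_vnorm t s r : cube t r s -> vnorm (cx s - cx t) <= (n + n)%:R * r.
Proof.
move=> ts; apply: le_trans (vnorm_le_sum _) _.
have -> : (n + n)%:R * r = \sum_(k < n) (r + r).
  by rewrite sumr_const card_ord natrD mulrDl !mulr_natl mulrnDl.
apply: ler_sum => k _.
have -> : (cx s - cx t) 0 k = cx s 0 k - cx t 0 k by rewrite [LHS]mxE [X in _ + X]mxE.
by apply: le_trans (cabs_leD _) _; rewrite !cxE !CE lerD// ltW.
Qed.

Lemma cx_continuous_measurable (rho : R) (f : V -> R) :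
  (forall z, vnorm z < rho -> forall e : R, 0 < e -> exists2 d : R, 0 < d &
     forall h, vnorm h < d -> `|f (z + h) - f z| < e) ->
  measurable [set t | vnorm (cx t) < rho] /\
  measurable_fun [set t | vnorm (cx t) < rho] (fun t => f (cx t)).
Proof.
move=> H; apply: cube_continuous_measurable => t /= tr e e0.
have [d d0 Hd] := H _ tr _ e0.
pose m := Num.min d (rho - vnorm (cx t)).
have m0 : 0 < m by rewrite lt_min d0 subr_gt0.
have n1 : 0 < (n + n).+1%:R :> R by rewrite ltr0n.
exists (m / (n + n).+1%:R); first by rewrite divr_gt0.
move=> s /cube_vnorm ts.
have {}ts : vnorm (cx s - cx t) < m.
  apply: le_lt_trans ts _; rewrite mulrA ltr_pdivrMr// mulrC ltr_pM2l//.
  by rewrite ltr_nat.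
move: ts; rewrite lt_min => /andP[h1 h2]; split.
  rewrite -(subrK (cx t) (cx s)); apply: le_lt_trans (vnormD _ _) _; lra.
by rewrite -{1}(subrK (cx t) (cx s)) [_ - _ + _]addrC; apply: Hd.
Qed.

Definition crot (a b : R) (t : T) : T :=
  [tuple match fintype.split i with
         | inl k => a * tnth t (lshift n k) - b * tnth t (rshift n k)
         | inr k => b * tnth t (lshift n k) + a * tnth t (rshift n k)
         end | i < n + n].

Lemma split_lshift (k : 'I_n) : fintype.split (lshift n k) = inl k.
Proof. exact: (@unsplitK n n (inl k)). Qed.

Lemma split_rshift (k : 'I_n) : fintype.split (rshift n k) = inr k.
Proof. exact: (@unsplitK n n (inr k)). Qed.

Lemma tuple_lr (t s : T) : (forall k, tnth t (lshift n k) = tnth s (lshift n k)) ->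
  (forall k, tnth t (rshift n k) = tnth s (rshift n k)) -> t = s.
Proof.
move=> hl hr; apply: eq_from_tnth => i.
by rewrite -(splitK i); case: (fintype.split i) => k /=; [exact: hl|exact: hr].
Qed.

Lemma cx_crot a b t : cx (crot a b t) = mkC a b *: cx t.
Proof.
apply/rowP => k; rewrite [RHS]mxE !cxE !tnth_mktuple split_lshift split_rshift.
by apply: CC_ext; rewrite !CE; ring.
Qed.

Lemma enorm_crot a b t : a ^+ 2 + b ^+ 2 = 1 -> enorm (crot a b t) = enorm t.
Proof.
move=> ab; rewrite -!vnorm_cx cx_crot vnormZ cabs_sqrt !CE ab sqrtr1 mul1r//.
Qed.

Lemma direction_crot a b t : a ^+ 2 + b ^+ 2 = 1 ->
  direction (crot a b t) = crot a b (direction t).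
Proof.
move=> ab; apply: tuple_lr => k; rewrite !tnth_mktuple enorm_crot// ?split_lshift ?split_rshift ?tnth_mktuple; ring.
Qed.

Local Notation lam := (lebesgue_measure_Rspace R (n + n)).

Definition lshear (u : R) : T -> T := shear
  (fun i => if fintype.split i is inl _ then true else false)
  (fun i t => if fintype.split i is inl k then u * tnth t (rshift n k) else 0).

Definition rshear (u : R) : T -> T := shear
  (fun i => if fintype.split i is inr _ then true else false)
  (fun i t => if fintype.split i is inr k then u * tnth t (lshift n k) else 0).

Lemma lshear_measure u A : measurable A -> lam (lshear u @^-1` A) = lam A.
Proof.
apply: shear_measure => [i|i t s h].
  case: (fintype.split i) => k; last exact: measurable_cst.
  by apply: measurable_funM => //; exact: measurable_tnth.
by case: (fintype.split i) => // k; rewrite h// split_rshift.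
Qed.

Lemma rshear_measure u A : measurable A -> lam (rshear u @^-1` A) = lam A.
Proof.
apply: shear_measure => [i|i t s h].
  case: (fintype.split i) => k; first exact: measurable_cst.
  by apply: measurable_funM => //; exact: measurable_tnth.
by case: (fintype.split i) => // k; rewrite h// split_lshift.
Qed.

Lemma measurable_lshear u : measurable_fun setT (lshear u).
Proof.
apply: measurable_shear => i; case: (fintype.split i) => k; last exact: measurable_cst.
by apply: measurable_funM => //; exact: measurable_tnth.
Qed.

Lemma measurable_rshear u : measurable_fun setT (rshear u).
Proof.
apply: measurable_shear => i; case: (fintype.split i) => k; first exact: measurable_cst.
by apply: measurable_funM => //; exact: measurable_tnth.
Qed.

Lemma measurable_crot_fun d (X : measurableType d) (f g : X -> R) (h : X -> T) :
  measurable_fun setT f -> measurable_fun setT g -> measurable_fun setT h ->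
  measurable_fun setT (fun x => crot (f x) (g x) (h x)).
Proof.
move=> mf mg mh.
have mt j : measurable_fun setT (fun x => tnth (h x) j : R).
  by apply: (@measurableT_comp _ _ _ _ _ _ (fun t : T => tnth t j)) => //; exact: measurable_tnth.
apply/measurable_fun_tnthP => i.
rewrite (_ : _ \o _ = fun x => match fintype.split i with
         | inl k => f x * tnth (h x) (lshift n k) - g x * tnth (h x) (rshift n k)
         | inr k => g x * tnth (h x) (lshift n k) + f x * tnth (h x) (rshift n k)
         end); last by apply/funext => x /=; rewrite tnth_mktuple.
by case: (fintype.split i) => k; [apply: measurable_funB|apply: measurable_funD];
  apply: measurable_funM.
Qed.

Lemma measurable_crot a b : measurable_fun setT (crot a b).
Proof.
exact: (@measurable_crot_fun _ _ (fun=> a) (fun=> b) id (measurable_cst _) (measurable_cst _)).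
Qed.

(* A rotation of the plane by an angle other than pi is a product of three shears. *)
Lemma crot_measure a b A : a ^+ 2 + b ^+ 2 = 1 -> measurable A ->
  lam (crot a b @^-1` A) = lam A.
Proof.
have step a' b' B : a' ^+ 2 + b' ^+ 2 = 1 -> a' != -1 -> measurable B ->
    lam (crot a' b' @^-1` B) = lam B.
  move=> ab a1 mB.
  have a10 : 1 + a' != 0 by rewrite addrC addr_eq0.
  (* For the rotation of angle th this is - tan(th / 2). *)
  pose u := - b' / (1 + a').
  have E : crot a' b' = lshear u \o rshear b' \o lshear u.
    apply/funext => t; apply: tuple_lr => k /=;
    rewrite !tnth_mktuple ?split_lshift ?split_rshift /= !tnth_mktuple
      ?split_lshift ?split_rshift /= ?tnth_mktuple ?split_lshift ?split_rshift /=.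
      set x := tnth t (lshift n k); set y := tnth t (rshift n k).
      have b2 : b' ^+ 2 = (1 - a') * (1 + a') by lra.
      have -> : x + u * y + u * (y + b' * (x + u * y)) =
        x * (1 + u * b') + y * (u * (2 + u * b')) by ring.
      have -> : u * b' = a' - 1.
        by rewrite /u mulrAC mulNr -expr2 b2 mulNr mulfK// opprB.
      have -> : u * (2 + (a' - 1)) = - b' by rewrite /u; field.
      by ring.
    set x := tnth t (lshift n k); set y := tnth t (rshift n k).
    have b2 : b' ^+ 2 = (1 - a') * (1 + a') by lra.
    have -> : y + b' * (x + u * y) = b' * x + y * (1 + u * b') by ring.
    have -> : u * b' = a' - 1.
      by rewrite /u mulrAC mulNr -expr2 b2 mulNr mulfK// opprB.
    by ring.
  rewrite E !comp_preimage lshear_measure; last first.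
    rewrite -[X in measurable X]setTI; apply: measurable_rshear => //.
    by rewrite -[X in measurable X]setTI; exact: measurable_lshear.
  rewrite rshear_measure ?lshear_measure//.
  by rewrite -[X in measurable X]setTI; exact: measurable_lshear.
move=> ab mA; have [a1|a1] := eqVneq a (-1); last exact: step.
have b0 : b = 0.
  by apply/eqP; rewrite -sqrf_eq0; apply/eqP; move: ab; rewrite a1 sqrrN expr1n; lra.
(* The excluded angle pi is twice a right angle. *)
have -> : crot a b = crot 0 1 \o crot 0 1.
  apply/funext => t; apply: tuple_lr => k /=;
    rewrite !tnth_mktuple ?split_lshift ?split_rshift /= ?tnth_mktuple ?split_lshift ?split_rshift a1 b0; ring.
have o1 : (0 : R) ^+ 2 + 1 ^+ 2 = 1 by rewrite expr0n expr1n add0r.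
have o2 : (0 : R) != -1 by rewrite eq_sym oppr_eq0 oner_eq0.
rewrite comp_preimage !step//.
by rewrite -[X in measurable X]setTI; exact: measurable_crot.
Qed.

Local Notation sigma := (surface_measure R (n + n)).

Lemma surface_crot a b A : a ^+ 2 + b ^+ 2 = 1 -> measurable A ->
  sigma (crot a b @^-1` A) = sigma A.
Proof.
move=> ab mA; rewrite !surface_measureE; congr (_ * _)%E.
have -> : direction (d:=n + n) @^-1` (crot a b @^-1` A) `&` punctured_ball (d:=n + n) =
    crot a b @^-1` (direction (d:=n + n) @^-1` A `&` punctured_ball (d:=n + n)).
  apply/seteqP; split => t [/= h1 h2]; split;
    rewrite /= ?direction_crot// /punctured_ball /= ?enorm_crot//;
    by move: h1 h2; rewrite /punctured_ball /= ?direction_crot ?enorm_crot.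
apply: crot_measure => //; apply: measurableI; last exact: measurable_punctured_ball.
by rewrite -[X in measurable X]setTI; exact: measurable_direction.
Qed.

Lemma surface_finite : (sigma setT < +oo)%E.
Proof.
rewrite surface_measureE preimage_setT setTI.
apply: lte_mul_pinfty => //.
pose Q : set (measurableTypeR R) := `[-1, 1]%classic.
have mQ : measurable Q by exact: measurable_itv.
have E := @lebesgue_measure_Rspace_box R (n + n) (fun=> Q) (fun=> mQ).
apply: (@le_lt_trans _ _ (lam [set t | forall i, Q (tnth t i)])).
  apply: le_measure; rewrite ?inE.
  - exact: measurable_punctured_ball.
  - rewrite (_ : [set t | _] = \bigcap_(i in [set: 'I_(n + n)])
      ((fun t : T => tnth t i) @^-1` Q)); last first.
      by apply/seteqP; split => [t At i _|t At i] /=; [exact: At|exact: At].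
    apply: fin_bigcap_measurable => // i _; rewrite -[X in measurable X]setTI.
    exact: measurable_tnth.
  - move=> t /andP[_ t1] i /=; rewrite /Q /= in_itv /= -ler_norml.
    apply: le_trans t1; rewrite -(@ler_pXn2r _ 2) ?nnegrE ?sqrtr_ge0//.
    rewrite sqr_sqrtr ?sumr_ge0// => [|j _]; last exact: sqr_ge0.
    rewrite real_normK ?num_real// (bigD1 i)//= lerDl sumr_ge0// => j _; exact: sqr_ge0.
rewrite [X in (X < _)%E]E.
suff H (r : seq 'I_(n + n)) : (0 <= \prod_(i <- r) lebesgue_measure Q)%E /\
    (\prod_(i <- r) lebesgue_measure Q < +oo)%E by have [_] := H (index_enum _).
elim: r => [|i r [x0 xo]]; first by rewrite !big_nil lee01 ltry.
rewrite big_cons; split; first by rewrite mule_ge0.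
apply: lte_mul_pinfty => //; rewrite /Q lebesgue_measure_itv /=; first by case: ifP.
Qed.

(** A synonym of the surface measure, introduced to carry the structure of a finite measure. *)
Definition sphere_measure : set T -> \bar R := sigma.
HB.instance Definition _ := Measure.on sphere_measure.
HB.instance Definition _ := Measure_isFinite.Build _ T R sphere_measure
  (lty_fin_num_fun surface_finite).

(** A cone over [W] that contains a cube has positive volume; the dimension factor in
    [surface_measure] is positive only for positive [n]. *)
Lemma surface_gt0 (t0 : T) (r : R) (W : set T) : (0 < n)%N -> 0 < r ->
  measurable W -> cube t0 r `<=` direction (d:=n + n) @^-1` W `&` punctured_ball (d:=n + n) ->
  (0 < sigma W)%E.
Proof.
move=> n0 r0 mW sub; rewrite surface_measureE mule_gt0//.
  by rewrite lte_fin ltr0n addn_gt0 n0.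
apply: (@lt_le_trans _ _ (lam (cube t0 r))); last first.
  apply: le_measure => //; rewrite inE; first exact: measurable_cube.
  apply: measurableI; last exact: measurable_punctured_ball.
  by rewrite -[X in measurable X]setTI; exact: measurable_direction.
pose B i : set (measurableTypeR R) := ball (tnth t0 i : R) r.
have mB i : measurable (B i) by exact: measurable_ball.
have E := lebesgue_measure_Rspace_box mB.
have -> : cube t0 r = [set t | forall i, B i (tnth t i)].
  by apply/seteqP; split => t h i; have := h i; rewrite /B /ball /= distrC.
rewrite [X in (0 < X)%E]E.
elim/big_ind : _ => [|x y x0 y0|i _].
- exact: lte01.
- exact: mule_gt0.
- by rewrite /B lebesgue_measure_ball ?(ltW r0)// lte_fin mulrn_wgt0.
Qed.

End real_coordinates.

(** * Boundary values *)

Section boundary_values.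
Variables (R : realType) (n : nat).
Local Notation C := (CC R).
Local Notation V := ('rV[C]_n).
Local Notation T := (Rspace R (n + n)).

Lemma has_boundary_valueP (phi : V -> C) (z : V) (l : C) :
  has_boundary_value phi z l <-> forall e : R, 0 < e -> exists2 d : R, 0 < d &
    forall r, 1 - d < r -> r < 1 -> cabs (phi (toC r *: z) - l) < e.
Proof.
rewrite /has_boundary_value.
have P : (phi (toC r *: z) @[r --> (1 : R)^'-] --> l) <->
   forall e : R, 0 < e -> \forall r \near (1 : R)^'-, cabs (phi (toC r *: z) - l) < e.
  exact: (@cabs_cvgP R R ((1 : R)^'-) _ (fun r => phi (toC r *: z)) l).
apply: (iff_trans P); split => H e e0.
  have := H e e0; rewrite near_withinE => /nbhs_normP[d /= d0 h]; exists d => // r r1 r2.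
  by apply: h => //=; rewrite gtr0_norm ?subr_gt0//; lra.
have [d d0 h] := H e e0; rewrite near_withinE; apply/nbhs_normP; exists d => //= r.
by rewrite /= ltr_norml => /andP[r1 r2] r3; apply: h => //; lra.
Qed.

End boundary_values.

Section holomorphic_continuity.
Variables (R : realType) (n : nat) (f : 'rV[CC R]_n -> CC R) (rho M : R).

Lemma bounded_holomorphic_continuous z (e : R) :
  (forall z, vnorm z < rho -> differentiable f z) ->
  (forall z, vnorm z < rho -> cabs (f z) <= M) -> vnorm z < rho -> 0 < e ->
  exists2 d : R, 0 < d & forall h, vnorm h < d -> cabs (f (z + h) - f z) < e.
Proof.
move=> df fM zr e0; pose r := rho - vnorm z; have r0 : 0 < r by rewrite subr_gt0.
have Er : vnorm z + r = rho by rewrite /r addrC subrK.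
have M0 : 0 <= M by apply: le_trans (fM z zr); exact: cabs_ge0.
have K0 : 0 <= 8 * M / r by rewrite !mulr_ge0// invr_ge0 ltW.
have K1 : 0 < 8 * M / r + 1 by rewrite ltr_wpDl.
exists (Num.min (r / 2) (e / (8 * M / r + 1))); first by rewrite lt_min !divr_gt0.
move=> h; rewrite lt_min (ltr_pdivlMr _ _ K1) => /andP[h1 h2].
have dz w : vnorm w < vnorm z + r -> differentiable f w by rewrite Er; exact: df.
have dM w : vnorm w < vnorm z + r -> cabs (f w) <= M by rewrite Er; exact: fM.
apply: le_lt_trans (holomorphic_lipschitz r0 dz dM (ltW h1)) _.
by apply: le_lt_trans h2; rewrite mulrC ler_wpM2l ?vnorm_ge0// lerDl.
Qed.

End holomorphic_continuity.

Section bounded_by_boundary_values.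
Variables (R : realType) (n : nat).
Local Notation C := (CC R).
Local Notation V := ('rV[C]_n).
Local Notation T := (Rspace R (n + n)).
Variables (phi : V -> C) (M : R).
Hypothesis dphi : forall z, vnorm z < 1 -> differentiable phi z.
Hypothesis phiM : forall z, vnorm z < 1 -> cabs (phi z) <= M.

(** Sampling at [direction t] keeps the argument in the ball for every [t], on the sphere or not. *)
Definition sphere_modulus (r : R) (t : T) : R := cabs (phi (toC r *: cx (direction t))).

Lemma sphere_modulus_in r t : 0 <= r -> r < 1 -> vnorm (toC r *: cx (@direction R (n + n) t)) < 1.
Proof.
move=> r0 r1; rewrite vnormZ cabs_toC ger0_norm//; apply: le_lt_trans r1.
by rewrite ler_piMr// vnorm_cx_direction_le1.
Qed.

Lemma measurable_sphere_modulus r : 0 <= r -> r < 1 ->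
  measurable_fun setT (sphere_modulus r).
Proof.
move=> r0 r1; have q0 : 0 < 1 + r by rewrite ltr_pwDl.
(* As rho > 1 and r * rho < 1, the function z |-> phi (r z) is continuous on an open neighbourhood
   of the closed ball. *)
pose rho := 2 / (1 + r).
have rho1 : 1 < rho by rewrite ltr_pdivlMr// mul1r; lra.
have inb (z : V) : vnorm z < rho -> vnorm (toC r *: z) < 1.
  move=> zr; rewrite vnormZ cabs_toC ger0_norm//.
  have : r * vnorm z <= r * rho by rewrite ler_wpM2l// ltW.
  move/le_lt_trans; apply; rewrite mulrA ltr_pdivrMr//; lra.
have [|mD mf] := @cx_continuous_measurable R n rho (fun z => cabs (phi (toC r *: z))).
  move=> z zr e e0; have [d d0 H] := bounded_holomorphic_continuous dphi phiM (inb _ zr) e0.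
  exists d => // h hd; rewrite scalerDr; apply: le_lt_trans (cabsB_dist _ _) _.
  apply: H; rewrite vnormZ cabs_toC ger0_norm//; apply: le_lt_trans hd.
  by rewrite ler_piMl ?vnorm_ge0// ltW.
apply: (measurable_comp mD _ mf); last exact: measurable_direction.
by move=> _ [t _ <-] /=; apply: le_lt_trans rho1; exact: vnorm_cx_direction_le1.
Qed.

Lemma differentiable_expr (f : C -> C) a k : differentiable f a ->
  differentiable (fun z => f z ^+ k) a.
Proof.
move=> df; elim: k => [|k IH].
  have -> : (fun z => f z ^+ 0) = cst 1 by apply/funext => z; rewrite expr0.
  exact: differentiable_cst.
have -> : (fun z => f z ^+ k.+1) = (fun z => f z * f z ^+ k).
  by apply/funext => z; rewrite exprS.
exact: differentiableM.
Qed.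

Lemma slice_differentiable_expr (u : V) (r : R) N l : vnorm u <= 1 -> 0 < r -> cabs l < r^-1 ->
  differentiable (fun l : C => phi (l *: (toC r *: u)) ^+ N) l.
Proof.
move=> u1 r0 lr; apply: differentiable_expr.
have zin : vnorm (0 + l *: (toC r *: u)) < 1.
  rewrite add0r !vnormZ cabs_toC gtr0_norm// mulrA.
  apply: (@le_lt_trans _ _ (cabs l * r)).
    by rewrite ler_piMr// mulr_ge0 ?cabs_ge0 ?(ltW r0).
  by rewrite -ltr_pdivlMr// mul1r.
have [+ _] := slice_cderive (dphi zin).
have -> // : (fun l : C => phi (0 + l *: (toC r *: u))) = (fun l : C => phi (l *: (toC r *: u))).
by apply/funext => k; rewrite add0r.
Qed.

(** The bound is applied to the N-th power, again holomorphic on the slice, and not raised to it;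
    hence a factor that does not depend on [N]. *)
Lemma slice_circle_bound (u : V) (a r : R) N : vnorm u <= 1 -> 0 <= a -> a < 1 -> 0 < r -> r < 1 ->
  cabs (phi (toC (a * r) *: u)) ^+ N * (pi - - pi) <= (1 - a)^-1 *
   \int[lebesgue_measure]_(t in `[- pi, pi]) cabs (phi (toC r *: (cpolar 1 t *: u))) ^+ N
  /\ continuous (fun t : R => cabs (phi (toC r *: (cpolar 1 t *: u))) ^+ N).
Proof.
move=> u1 a0 a1 r0 r1.
pose f (l : C) := phi (l *: (toC r *: u)) ^+ N.
have R1 : 1 < r^-1 by rewrite invf_gt1.
have df l : cabs l < r^-1 -> differentiable f l by exact: slice_differentiable_expr.
have := cauchy_circle_bound a0 a1 R1 df.
have fE l : cabs (f l) = cabs (phi (l *: (toC r *: u))) ^+ N by rewrite /f cabsX.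
have cE t : cabs (f (cpolar 1 t)) = cabs (phi (toC r *: (cpolar 1 t *: u))) ^+ N.
  by rewrite fE !scalerA mulrC.
have E : toC a *: (toC r *: u) = toC (a * r) *: u by rewrite scalerA toCM.
have aE := etrans (fE (toC a)) (congr1 (fun v => cabs (phi v) ^+ N) E).
move=> H; split.
  by rewrite -aE; apply: le_trans H _; rewrite (_ : (fun t : R => cabs (f (cpolar 1 t))) =
    (fun t : R => cabs (phi (toC r *: (cpolar 1 t *: u))) ^+ N))//; exact/funext.
have := @circle_cabs_continuous R f; rewrite (_ : (fun t : R => cabs (f (cpolar 1 t))) =
  (fun t : R => cabs (phi (toC r *: (cpolar 1 t *: u))) ^+ N)); last exact/funext.
by apply => t; apply: differentiable_ccontinuous; apply: df; rewrite cabs_cpolar.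
Qed.

End bounded_by_boundary_values.

Section boundary_bound.
Variables (R : realType) (n : nat).
Local Notation C := (CC R).
Local Notation V := ('rV[C]_n).
Local Notation T := (Rspace R (n + n)).
Variables (phi : V -> C) (M : R).
Hypothesis dphi : forall z, vnorm z < 1 -> differentiable phi z.
Hypothesis phiM : forall z, vnorm z < 1 -> cabs (phi z) <= M.
Local Notation smod := (sphere_modulus phi).
Local Notation sigma := (@sphere_measure R n).
Local Notation leb := (@lebesgue_measure R).

Definition power_mean (r : R) (N : nat) : \bar R :=
  (\int[sigma]_t (smod r t ^+ N)%:E)%E.

Lemma sphere_measure_crot a b A : a ^+ 2 + b ^+ 2 = 1 -> measurable A ->
  sigma (crot a b @^-1` A) = sigma A.
Proof. exact: surface_crot. Qed.

Lemma sphere_modulus_crot r a b t : a ^+ 2 + b ^+ 2 = 1 ->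
  smod r (crot a b t) = cabs (phi (toC r *: (mkC a b *: cx (direction t)))).
Proof. by move=> ab; rewrite /sphere_modulus (direction_crot _ ab) cx_crot. Qed.

Lemma measurable_polar_crot :
  measurable_fun [set: (T * measurableTypeR R)%type]
    (fun x : T * measurableTypeR R => crot (cos (x.2 : R)) (sin (x.2 : R)) x.1).
Proof.
apply: measurable_crot_fun; last exact: measurable_fst.
  apply: (@measurableT_comp _ _ _ _ _ _ (@cos R)) => //.
  by apply: continuous_measurable_fun; exact: continuous_cos.
apply: (@measurableT_comp _ _ _ _ _ _ (@sin R)) => //.
by apply: continuous_measurable_fun; exact: continuous_sin.
Qed.

(* Integrates the one-variable bound along the rotations [z |-> e^(i th) z], which
   preserve the surface measure. *)
Lemma power_mean_bound (a r : R) N : 0 <= a -> a < 1 -> 0 < r -> r < 1 ->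
  (power_mean (a * r) N <= ((1 - a)^-1)%:E * power_mean r N)%E.
Proof.
move=> a0 a1 r0 r1.
have pp : 0 < pi - - pi :> R by rewrite subr_gt0 itv_pi_lt.
have r0' := ltW r0.
have ar0 : 0 <= a * r by rewrite mulr_ge0.
have ar1 : a * r < 1 by apply: le_lt_trans r1; rewrite ler_piMl// ltW.
have b0 : 0 <= (1 - a)^-1 by rewrite invr_ge0 subr_ge0 ltW.
have m1 := measurable_sphere_modulus dphi phiM ar0 ar1.
have m2 := measurable_sphere_modulus dphi phiM r0' r1.
have g0 q t : 0 <= smod q t by exact: cabs_ge0.
have e1 : measurable_fun setT (fun t => (smod (a * r) t ^+ N)%:E).
  exact: (measurable_EFinP _ _).2 (measurable_funX N m1).
have e2 : measurable_fun setT (fun t => (smod r t ^+ N)%:E).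
  exact: (measurable_EFinP _ _).2 (measurable_funX N m2).
pose D : set (measurableTypeR R) := `[- pi, pi]%classic.
have mD : measurable D by exact: measurable_itv.
have lebD : leb D = (pi - - pi)%:E.
  by rewrite /D lebesgue_measure_itv /= lte_fin itv_pi_lt.
(* The indicator of [- pi, pi] lets Tonelli's theorem be used on the whole product space. *)
pose F (x : T * measurableTypeR R) : \bar R :=
  (smod r (crot (cos (x.2 : R)) (sin (x.2 : R)) x.1) ^+ N * \1_D x.2)%:E.
have F0 x : (0 <= F x)%E by rewrite lee_fin mulr_ge0// exprn_ge0.
have mF : measurable_fun setT F.
  apply/measurable_EFinP; apply: measurable_funM.
    apply: measurable_funX; apply: (@measurableT_comp _ _ _ _ _ _ (smod r)) => //.
    exact: measurable_polar_crot.
  by apply: (@measurableT_comp _ _ _ _ _ _ (\1_D : measurableTypeR R -> R)).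
have pw t : ((smod (a * r) t ^+ N * (pi - - pi))%:E <=
    ((1 - a)^-1)%:E * \int[leb]_th F (t, th))%E.
  have [H cH] := slice_circle_bound dphi N (vnorm_cx_direction_le1 t) a0 a1 r0 r1.
  have E (th : R) : cabs (phi (toC r *: (cpolar 1 th *: cx (direction t)))) =
      smod r (crot (cos th) (sin th) t).
    by rewrite (sphere_modulus_crot r t (cos2Dsin2 th)) /cpolar !mul1r.
  have intH : leb.-integrable D (EFin \o (fun th : R =>
      cabs (phi (toC r *: (cpolar 1 th *: cx (direction t)))) ^+ N)).
    apply: continuous_compact_integrable; first exact: segment_compact.
    exact: continuous_subspaceT.
  have -> : (\int[leb]_th F (t, th) = \int[leb]_(th in D)
      (cabs (phi (toC r *: (cpolar 1 th *: cx (direction t)))) ^+ N)%:E)%E.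
    rewrite [RHS]integral_mkcond; apply: eq_integral => th _.
    rewrite patchE /F /= indicE; case: ifP => _; last by rewrite mulr0.
    by rewrite mulr1 -E.
  by rewrite -(fineK (integrable_fin_num mD intH)) -EFinM lee_fin.
have key : ((pi - - pi)%:E * power_mean (a * r) N <=
    (pi - - pi)%:E * (((1 - a)^-1)%:E * power_mean r N))%E.
  have g1 t : setT t -> (0 <= (smod (a * r) t ^+ N)%:E)%E by rewrite lee_fin exprn_ge0.
  have pe : (0 <= (pi - - pi)%:E :> \bar R)%E by rewrite lee_fin ltW.
  have -> : ((pi - - pi)%:E * power_mean (a * r) N =
      \int[sigma]_t ((pi - - pi)%:E * (smod (a * r) t ^+ N)%:E))%E.
    exact: (esym (ge0_integralZl sigma measurableT e1 g1 pe)).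
  have mG := @measurable_fun_fubini_tonelli_F _ _ _ _ _ leb F mF F0.
  have G0 t : setT t -> (0 <= fubini_F leb F t)%E by move=> _; exact: integral_ge0.
  have Zb : (0 <= ((1 - a)^-1)%:E)%E by rewrite lee_fin.
  apply: (@le_trans _ _ (\int[sigma]_t (((1 - a)^-1)%:E * fubini_F leb F t))%E).
    apply: (ge0_le_integral sigma measurableT).
    - by move=> t tT; exact: mule_ge0 pe (g1 t tT).
    - exact: emeasurable_funM (measurable_cst _) e1.
    - exact: emeasurable_funM (measurable_cst _) mG.
    - by move=> t _; rewrite -EFinM mulrC; exact: pw.
  rewrite (ge0_integralZl sigma measurableT mG G0 Zb).
  rewrite muleCA lee_wpmul2l ?lee_fin//.
  rewrite (@fubini_tonelli _ _ _ _ _ sigma leb F mF F0).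
  have -> : (\int[leb]_th \int[sigma]_t F (t, th) =
      \int[leb]_th (power_mean r N * (\1_D th)%:E))%E.
    apply: eq_integral => th _.
    pose h t : \bar R := (smod r (crot (cos (th : R)) (sin (th : R)) t) ^+ N)%:E.
    have mh : measurable_fun setT h by exact: measurableT_comp e2 (measurable_crot _ _).
    have h0 t : setT t -> (0 <= h t)%E by rewrite lee_fin exprn_ge0.
    have i0 : (0 <= (\1_D th)%:E :> \bar R)%E by rewrite lee_fin.
    have -> : (\int[sigma]_t F (t, th) = \int[sigma]_t (h t * (\1_D th)%:E))%E by [].
    apply: (etrans (ge0_integralZr sigma measurableT mh h0 i0)).
    apply: (congr1 (fun x => x * (\1_D th)%:E)%E).
    apply: (@measure_preserving_integral R _ _ sigma (crot (cos (th : R)) (sin (th : R)))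
      (fun t => (smod r t ^+ N)%:E)).
    - exact: measurable_crot.
    - by move=> A mA; apply: sphere_measure_crot mA; exact: cos2Dsin2.
    - exact: e2.
    - by move=> t; rewrite lee_fin exprn_ge0.
  have p0 : (0 <= power_mean r N)%E.
    by apply: integral_ge0 => t _; rewrite lee_fin exprn_ge0.
  have m1D : measurable_fun setT (EFin \o (\1_D : measurableTypeR R -> R)).
    exact/measurable_EFinP.
  have d0 t : setT t -> (0 <= (\1_D t)%:E :> \bar R)%E by rewrite lee_fin.
  rewrite (ge0_integralZl leb measurableT m1D d0 p0).
  by rewrite integral_indic// setIT [X in (_ * X <= _)%E]lebD muleC.
by move: key; rewrite lee_pmul2l//.
Qed.

End boundary_bound.

Section boundary_maximum.
Variables (R : realType) (n : nat).
Local Notation C := (CC R).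
Local Notation V := ('rV[C]_n).
Local Notation T := (Rspace R (n + n)).
Variables (phi : V -> C) (M : R).
Hypothesis n_gt0 : (0 < n)%N.
Hypothesis dphi : forall z, vnorm z < 1 -> differentiable phi z.
Hypothesis phiM : forall z, vnorm z < 1 -> cabs (phi z) <= M.
Hypothesis phi_bd : {ae @surface_measure R (n + n), forall t : T,
  exists2 l : C, has_boundary_value phi (cx t) l & cabs l = 1}.
Local Notation smod := (sphere_modulus phi).
Local Notation sigma := (@sphere_measure R n).

(** A sequence of radii, because dominated convergence is applied to sequences; it starts at 1/2 so
    as to be positive. *)
Let rj (j : nat) : R := 1 - (j.+2%:R)^-1.

Lemma rj_itv j : 0 < rj j < 1.
Proof.
rewrite /rj; have j0 : 0 < j.+2%:R :> R by rewrite ltr0n.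
have : (j.+2%:R : R)^-1 < 1 by rewrite invf_lt1// ltr1n.
by have : 0 < (j.+2%:R : R)^-1 by [rewrite invr_gt0]; move: (_^-1) => x x0 x1; apply/andP; split; lra.
Qed.

Lemma rj_near (d : R) : 0 < d -> \forall j \near \oo, 1 - d < rj j.
Proof.
move=> d0; have := near_infty_natSinv_lt (PosNum d0); apply: filterS => j /= jd.
rewrite /rj ltrD2l ltrN2; apply: le_lt_trans jd.
by rewrite lef_pV2 ?posrE ?ltr0n// ler_nat.
Qed.

Lemma power_mean_cvg N :
  (power_mean phi (rj j) N @[j --> \oo] --> sigma setT)%E.
Proof.
have M0 : 0 <= M.
  have v0 : vnorm (0 : V) < 1 by rewrite vnorm0.
  exact: le_trans (cabs_ge0 _) (phiM v0).
have mf j : measurable_fun setT (fun t : T => (smod (rj j) t ^+ N)%:E).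
  have /andP[r0 r1] := rj_itv j.
  exact: (measurable_EFinP _ _).2 (measurable_funX N (measurable_sphere_modulus dphi phiM (ltW r0) r1)).
have ae1 : {ae sigma, forall t : T, setT t ->
    ((smod (rj j) t ^+ N)%:E @[j --> \oo] --> (cst 1%:E : T -> \bar R) t)%E}.
  have sph : {ae surface_measure R (n + n), forall t : T, enorm t = 1} := surface_measure_sphere R (n + n).
  apply: filterS2 phi_bd sph => t [l bl l1] t1 _.
  apply: cvg_EFin; first exact: nearW.
  have c1 : smod (rj j) t @[j --> \oo] --> (1 : R).
    apply/cvgrPdist_lt => e e0.
    have [d d0 H] := (has_boundary_valueP phi (cx t) l).1 bl e e0.
    apply: filterS (rj_near d0) => j jd; have /andP[_ r1] := rj_itv j.
    rewrite distrC -l1 /sphere_modulus direction_id//.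
    exact: le_lt_trans (cabsB_dist _ _) (H _ jd r1).
  have := cvg_comp _ _ c1 (@exprn_continuous R N 1); rewrite /= expr1n; exact.
have ae2 : {ae sigma, forall t : T, forall j, setT t ->
    (`|(smod (rj j) t ^+ N)%:E| <= (EFin \o cst (M ^+ N)%R) t)%E}.
  apply: aeW => t j _; rewrite /= lee_fin ger0_norm ?exprn_ge0 ?cabs_ge0//.
  have /andP[r0 r1] := rj_itv j.
  rewrite lerXn2r ?nnegrE ?cabs_ge0//; apply: phiM.
  exact: sphere_modulus_in (ltW r0) r1.
have [_ _] := dominated_convergence measurableT mf (measurable_cst _) ae1
  (finite_measure_integrable_cst sigma (M ^+ N) measurableT) ae2.
by rewrite (integral_cst sigma measurableT 1%:E) mul1e.
Qed.

(** In [power_mean_bound] take the radius [rj j] and a = rho / rj j, and let [j] tend to infinity: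
    the right-hand mean tends to the area of the sphere. Once [rj j] exceeds the midpoint s of rho
    and 1, a is at most rho / s = 2 rho / (1 + rho), which gives the constant. *)
Lemma power_mean_le (rho : R) N : 0 < rho -> rho < 1 ->
  (power_mean phi rho N <= ((1 - 2 * rho / (1 + rho))^-1)%:E * sigma setT)%E.
Proof.
move=> r0 r1; pose s := (1 + rho) / 2; have s0 : 0 < s by rewrite /s; lra.
have -> : 2 * rho / (1 + rho) = rho / s by rewrite /s; field; lra.
pose K := (1 - rho / s)^-1.
have a1 : rho / s < 1 by rewrite ltr_pdivrMr// mul1r /s; lra.
have K0 : 0 < K by rewrite invr_gt0 subr_gt0.
rewrite -/K -lee_pdivrMl//.
apply: (cvge_ge _ (power_mean_cvg N)).
have d0 : 0 < 1 - s by rewrite /s; lra.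
apply: filterS (rj_near d0) => j; rewrite opprB addrC subrK => sj.
have /andP[j0 j1] := rj_itv j.
rewrite lee_pdivrMl//.
have aj0 : 0 <= rho / rj j by rewrite divr_ge0 ?ltW.
have aj : rho / rj j <= rho / s by rewrite ler_pM2l// lef_pV2 ?posrE// ltW.
have aj1 : rho / rj j < 1 by apply: le_lt_trans a1.
have := power_mean_bound dphi phiM N aj0 aj1 j0 j1.
rewrite divfK ?gt_eqF// => /le_trans; apply; apply: lee_wpmul2r.
  by apply: integral_ge0 => t _; rewrite lee_fin exprn_ge0// cabs_ge0.
rewrite lee_fin lef_pV2 ?posrE ?subr_gt0//.
by rewrite lerD2l lerN2.
Qed.

Lemma bernoulli_ge (b : R) N : 0 <= b -> 1 + N%:R * b <= (1 + b) ^+ N.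
Proof.
move=> b0; elim: N => [|N IH]; first by rewrite mul0r addr0 expr0.
rewrite exprS; apply: (@le_trans _ _ ((1 + b) * (1 + N%:R * b))); last first.
  by rewrite ler_wpM2l// addr_ge0.
rewrite -natr1; have : 0 <= N%:R * (b * b) by rewrite !mulr_ge0.
by move: (N%:R : R) => k; nra.
Qed.

(** If |phi z| = 1 + 2 e with e > 0, then by continuity |phi| >= 1 + e on the sphere through [z] for
    a set of directions of positive measure w. So (1 + e)^N w is at most the N-th power mean there,
    which is bounded independently of N: absurd for large N. The point 0 lies on no such sphere and
    is treated by continuity afterwards. *)
Lemma boundary_le1_neq0 z : vnorm z < 1 -> z != 0 -> cabs (phi z) <= 1.
Proof.
move=> z1 z0; rewrite leNgt; apply/negP => phi1.
have r0 : 0 < vnorm z by rewrite lt_def vnorm_ge0 andbT; apply: contra_neq z0; exact: vnorm_eq0.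
set rho := vnorm z in r0 z1.
pose e := (cabs (phi z) - 1) / 2; have e0 : 0 < e by rewrite /e; lra.
have [d d0 Hd] := bounded_holomorphic_continuous dphi phiM z1 e0.
pose q := Num.min (rho / 2) (Num.min (1 - rho) (d / 2)).
have q0 : 0 < q by rewrite !lt_min; apply/and3P; split; rewrite ?subr_gt0 ?divr_gt0.
have qr : q <= rho / 2 by rewrite ge_min lexx.
have q1 : q <= 1 - rho by rewrite !ge_min lexx orbT.
have qd : q <= d / 2 by rewrite !ge_min lexx !orbT.
pose r := q / (n + n).+1%:R.
have N0 : 0 < (n + n).+1%:R :> R by rewrite ltr0n.
have rr0 : 0 < r by rewrite divr_gt0.
have rq : (n + n)%:R * r < q.
  by rewrite /r mulrCA -[X in _ < X]mulr1 ltr_pM2l// ltr_pdivrMr// mul1r ltr_nat.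
have mW := measurable_sphere_modulus dphi phiM (ltW r0) z1.
pose W : set T := [set t | 1 + e <= smod rho t].
have mWW : measurable W.
  rewrite (_ : W = smod rho @^-1` `[1 + e, +oo[%classic).
    by rewrite -[X in measurable X]setTI; exact: mW.
  by apply/seteqP; split => t /=; rewrite in_itv/= andbT.
have sub : cube (uncx z) r `<=` direction (d:=n + n) @^-1` W `&` punctured_ball (d:=n + n).
  move=> t /cube_vnorm; rewrite cxK => /le_lt_trans/(_ rq) tz.
  have := vnormD (cx t - z) z; rewrite subrK vnorm_cx -/rho => t1.
  have := vnormD (z - cx t) (cx t); rewrite subrK vnorm_cx vnormB -/rho => t2.
  have e1 : 0 < enorm t by lra.
  split; last by rewrite /punctured_ball /= e1 /=; lra.
  rewrite /W /= /sphere_modulus.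
  have -> : direction (direction t) = direction t.
    by apply: direction_id; rewrite -vnorm_cx vnorm_cx_direction ?gt_eqF.
  rewrite cx_direction scalerA -toCM.
  set u := toC _ *: cx t.
  have ud : vnorm (u - z) < d.
    have -> : u - z = toC (rho / enorm t - 1) *: cx t + (cx t - z).
      by rewrite toCD scalerDl toCN toC1 scaleN1r addrA subrK.
    apply: le_lt_trans (vnormD _ _) _; rewrite vnormZ cabs_toC vnorm_cx.
    have -> : `|rho / enorm t - 1| * enorm t = `|rho - enorm t|.
      by rewrite -[X in _ * X = _]gtr0_norm// -normrM mulrBl mul1r divfK ?gt_eqF.
    have : `|rho - enorm t| <= vnorm (cx t - z) by rewrite ler_norml; apply/andP; split; lra.
    by move=> h; lra.
  have := Hd _ ud; rewrite (addrC z) subrK => uz.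
  have := le_lt_trans (cabsB_dist _ _) uz; rewrite ltr_norml => /andP[h _].
  by rewrite /e in h *; lra.
have sW := surface_gt0 n_gt0 rr0 mWW sub.
have fin A : measurable A -> sigma A \is a fin_num by exact: fin_num_measure.
pose w := fine (sigma W); pose c := fine (sigma setT).
have wE : sigma W = w%:E by rewrite fineK// fin.
have cE : sigma setT = c%:E by rewrite fineK// fin.
have w0 : 0 < w by rewrite -lte_fin -wE.
pose K := (1 - 2 * rho / (1 + rho))^-1.
have b0 : 0 <= 1 + e by lra.
have main N : (1 + e) ^+ N * w <= K * c.
  rewrite -lee_fin !EFinM -wE -cE.
  apply: le_trans (power_mean_le N r0 z1).
  have mS : measurable_fun setT (fun t : T => (smod rho t ^+ N)%:E).
    exact: (measurable_EFinP _ _).2 (measurable_funX N mW).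
  have b1 : 0 < (1 + e) ^+ N by rewrite exprn_gt0//; lra.
  have := le_integral_abse sigma measurableT mS b1.
  have -> : (\int[sigma]_x `|(smod rho x ^+ N)%:E| = power_mean phi rho N)%E.
    by apply: eq_integral => t _; rewrite /= ger0_norm ?exprn_ge0 ?cabs_ge0.
  apply: le_trans; rewrite lee_pmul2l//.
  apply: le_measure; rewrite ?inE//.
    rewrite (_ : _ `&` _ = setT `&` (fun t => smod rho t ^+ N) @^-1` `[(1 + e) ^+ N, +oo[%classic).
      exact: (measurable_funX N mW).
    congr (_ `&` _); apply/seteqP; split => t /=;
      by rewrite lee_fin in_itv/= andbT ger0_norm ?exprn_ge0 ?cabs_ge0.
  move=> t Wt; split => //=; rewrite lee_fin ger0_norm ?exprn_ge0 ?cabs_ge0//.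
  by rewrite lerXn2r ?nnegrE ?cabs_ge0.
have [N HN] : exists N : nat, K * c / w / e < N%:R.
  by exists (Num.truncn (K * c / w / e)).+1; exact: truncnS_gt.
have := main N; apply/negP; rewrite -ltNge.
apply: (@lt_le_trans _ _ (N%:R * e * w)).
  by rewrite -ltr_pdivrMr// -ltr_pdivrMr.
rewrite ler_wpM2r ?(ltW w0)//; apply: le_trans (bernoulli_ge N (ltW e0)).
by rewrite lerDr.
Qed.

Lemma boundary_le1 z : vnorm z < 1 -> cabs (phi z) <= 1.
Proof.
move=> z1; have [->|] := eqVneq z 0; last exact: boundary_le1_neq0.
have v0 : vnorm (0 : V) < 1 by rewrite vnorm0.
apply/ler_addgt0Pl => e e0.
have [d d0 H] := bounded_holomorphic_continuous dphi phiM v0 e0.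
pose k0 := Ordinal n_gt0; pose x := Num.min (d / 2) (1 / 2).
have x0 : 0 < x by rewrite lt_min !divr_gt0.
pose h : V := toC x *: delta_mx 0 k0.
have hx : vnorm h = x.
  rewrite vnormZ cabs_toC gtr0_norm// [X in x * X](_ : _ = 1) ?mulr1//.
  rewrite /vnorm (bigD1 k0)//= big1 => [|k kk0]; last first.
    by rewrite mxE (negPf kk0) andbF cabs0 expr0n.
  by rewrite mxE !eqxx cabs1 expr1n addr0 sqrtr1.
have h0 : h != 0 by apply/eqP => E; move: hx; rewrite E vnorm0 => E0; rewrite E0 ltxx in x0.
have h1 : vnorm h < 1 by rewrite hx gt_min; apply/orP; right; lra.
have hd : vnorm h < d by rewrite hx gt_min; apply/orP; left; lra.
have := H _ hd; rewrite add0r cabsC => /ltW hh.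
rewrite -(subrK (phi h) (phi 0)); apply: le_trans (cabsD _ _) _.
by apply: lerD => //; exact: boundary_le1_neq0.
Qed.

End boundary_maximum.

(** * The function classes of the statement in terms of [vnorm] and [cabs] *)

Section unit_ball_bridge.
Variables (R : realType) (n : nat).
Local Notation C := (CC R).
Local Notation V := ('rV[C]_n).
Local Notation T := (Rspace R (n + n)).

Lemma unit_ballP (z : V) : unit_ball z <-> vnorm z < 1.
Proof.
have E : \sum_(k < n) `|z 0 k| ^+ 2 = toC (vnorm z ^+ 2).
  rewrite sqr_vnorm (big_morph (@toC R) (@toCD R) (toC0 R)).
  by apply: eq_bigr => k _; rewrite norm_cabs !expr2 toCM.
have H : unit_ball z <-> toC (vnorm z ^+ 2) < toC 1 by rewrite -E.
apply: (iff_trans H); rewrite ltr_toC -{1}(expr1n _ 2).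
by rewrite ltr_pXn2r ?nnegrE ?vnorm_ge0.
Qed.

Lemma analytic_on_ballP (phi : V -> C) :
  analytic_on_ball phi <-> forall z, vnorm z < 1 -> differentiable phi z.
Proof.
split => H z /unit_ballP z1; first exact: H z1.
exact: H z z1.
Qed.

Lemma HinftyP (phi : V -> C) : Hinfty phi <->
  (forall z, vnorm z < 1 -> differentiable phi z) /\
  exists M : R, forall z, vnorm z < 1 -> cabs (phi z) <= M.
Proof.
split => -[/analytic_on_ballP d [M HM]]; split => //; exists M => z /unit_ballP z1;
  exact: HM z z1.
Qed.

Lemma schur_classP (phi : V -> C) : schur_class phi <->
  (forall z, vnorm z < 1 -> differentiable phi z) /\
  (forall z, vnorm z < 1 -> cabs (phi z) <= 1).
Proof.
have v0 : unit_ball (0 : V) by apply/unit_ballP; rewrite vnorm0.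
split.
  move=> [/HinftyP[d [M HM]] H]; split => // z z1; apply: le_trans H.
  apply: ub_le_sup; last by exists z => //; exact/unit_ballP.
  by exists M => _ [w w1 <-]; apply: HM; exact/unit_ballP.
move=> [d H]; split; first by apply/HinftyP; split => //; exists 1.
apply: ge_sup; first by exists (Normc.normc (phi 0)), 0.
by move=> _ [w w1 <-]; apply: H; exact/unit_ballP.
Qed.

Lemma inner_functionP (phi : V -> C) : inner_function phi <-> Hinfty phi /\
  {ae @surface_measure R (n + n), forall t : T,
    exists2 l : C, has_boundary_value phi (cx t) l & cabs l = 1}.
Proof.
have E (l : C) : `|l| = 1 <-> cabs l = 1.
  by rewrite norm_cabs -toC1; split => [/(congr1 (@Re R))//|->].
split => -[H ae]; split => //; apply: filterS ae => t [l bl l1]; exists l => //; exact/E.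
Qed.

Lemma inner_function_le1 (phi : V -> C) : (0 < n)%N -> inner_function phi ->
  forall z, vnorm z < 1 -> cabs (phi z) <= 1.
Proof.
move=> n0 /inner_functionP[/HinftyP[d [M HM]] bd] z z1.
exact: (boundary_le1 n0 d HM bd z1).
Qed.

(* Montel's theorem is replaced by the limit along an ultrafilter. *)
Lemma schur_class_limit (f : nat -> V -> C) :
  (forall k z, vnorm z < 1 -> differentiable (f k) z) ->
  (forall k z, vnorm z < 1 -> cabs (f k z) <= 1) ->
  exists phi : V -> C, schur_class phi /\
    forall z w, vnorm z < 1 -> f k z @[k --> \oo] --> w -> phi z = w.
Proof.
move=> df f1.
have [U [UU Uoo]] := ultraFilterLemma (F := \oo) _.
have ex z : exists l, vnorm z < 1 -> clim U (fun k => f k z) l.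
  have [z1|] := boolP (vnorm z < 1); last by exists 0.
  have [l Hl] := clim_ultra UU (fun k => f1 k z z1).
  by exists l.
have [phi Hphi] := choice ex; exists phi; split.
  apply/schur_classP; split => z z1.
    exact: (clim_differentiable UU df f1 Hphi z1).
  apply: (clim_le (Hphi z z1)); apply: filterS filterT => k _; exact: f1.
move=> z w z1 fw; apply: (clim_unique (Hphi z z1)) => e e0; apply: Uoo.
exact: (cabs_cvgP _ _).1 fw e e0.
Qed.

End unit_ball_bridge.

(** * Decreasing the defect 1 - |f|^2 *)

Section phase_average.
Variable R : realType.
Local Notation C := (CC R).
Implicit Types (F g : C) (s : seq C).

Definition defect F : R := Num.sqrt (1 - cabs F ^+ 2).

Lemma defect_ge0 F : 0 <= defect F. Proof. exact: sqrtr_ge0. Qed.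

Lemma defect_le1 F : defect F <= 1.
Proof.
by rewrite -[leRHS]sqrtr1 ler_sqrt// lerBlDr lerDl sqr_ge0.
Qed.

(** With x = t / h, the square of 1 - x/2 - x^2/16 exceeds 1 - x by x^2/16 + x^2 (1 + x)/16 +
    x^4/256, which is nonnegative for x >= -1. *)
Lemma sqrt_drop (h t : R) : 0 < h -> `|t| <= h ->
  Num.sqrt (h - t) <= Num.sqrt h * (1 - t / (2 * h) - (t / h) ^+ 2 / 16).
Proof.
move=> h0; rewrite ler_norml => /andP[t1 t2].
pose x := t / h; have xh : t = x * h by rewrite /x divfK ?gt_eqF.
have x1 : -1 <= x by rewrite /x ler_pdivlMr// mulN1r.
have x2 : x <= 1 by rewrite /x ler_pdivrMr// mul1r.
have -> : t / (2 * h) = x / 2 by rewrite /x; field; lra.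
rewrite -/x.
have -> : h - t = h * (1 - x) by rewrite xh; ring.
rewrite sqrtrM ?(ltW h0)// ler_wpM2l ?sqrtr_ge0//.
have p0 : 0 <= 1 - x / 2 - x ^+ 2 / 16 by nra.
rewrite -(@ler_pXn2r _ 2) ?nnegrE ?sqrtr_ge0// sqr_sqrtr ?subr_ge0//.
have : 0 <= x ^+ 2 * (1 + x) by rewrite mulr_ge0 ?sqr_ge0//; lra.
have : 0 <= x ^+ 2 * x ^+ 2 by rewrite mulr_ge0 ?sqr_ge0.
have := sqr_ge0 x.
nra.
Qed.

Definition phases : seq C := [:: 1; mkC 0 1; -1; mkC 0 (-1)].

Lemma cabs_phases u : u \in phases -> cabs u = 1.
Proof.
rewrite !inE => /or4P[] /eqP ->; rewrite ?cabsN ?cabs1// cabs_sqrt !CE;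
  by rewrite expr0n add0r ?sqrrN expr1n sqrtr1.
Qed.

(* The average over the phases kills the terms of first order in [g]; the strict
   concavity of the square root leaves a gain of order [|g|^2]. *)
Lemma four_phases F g : cabs F < 1 -> 16 * cabs g <= 1 - cabs F ^+ 2 ->
  (\sum_(u <- phases) defect (F + u * g)) / 4 <=
    defect F * (1 - (cabs g / (1 - cabs F ^+ 2)) ^+ 2 / 8).
Proof.
move=> F1 gF; set h := 1 - cabs F ^+ 2 in gF *.
have F0 := cabs_ge0 F; have g0 := cabs_ge0 g.
have h0 : 0 < h by rewrite /h; nra.
have h1 : h <= 1 by rewrite /h; nra.
(* The real and imaginary parts of F times the conjugate of g: the cross terms of |F + u g|^2 for
   the four phases are 2a, 2b, -2a and -2b. *)
pose a := Re F * Re g + Im F * Im g; pose b := Im F * Re g - Re F * Im g.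
have ab : a ^+ 2 + b ^+ 2 = (1 - h) * cabs g ^+ 2.
  by rewrite /h !sqr_cabs /a /b; ring.
have aF : `|a| <= cabs g.
  rewrite -(@ler_pXn2r _ 2) ?nnegrE// real_normK ?num_real//.
  have := sqr_ge0 b; have := sqr_ge0 (cabs g); nra.
have bF : `|b| <= cabs g.
  rewrite -(@ler_pXn2r _ 2) ?nnegrE// real_normK ?num_real//.
  have := sqr_ge0 a; have := sqr_ge0 (cabs g); nra.
have step (x : R) u : `|x| <= cabs g -> cabs (F + u * g) ^+ 2 = cabs F ^+ 2 + (2 * x + cabs g ^+ 2) ->
    defect (F + u * g) <= Num.sqrt h * (1 - (2 * x + cabs g ^+ 2) / (2 * h) - ((2 * x + cabs g ^+ 2) / h) ^+ 2 / 16).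
  move=> xg E; rewrite /defect E opprD addrA -/h; apply: sqrt_drop => //.
  move: xg; rewrite !ler_norml => /andP[xg1 xg2]; apply/andP; split; nra.
have e1 : cabs (F + 1 * g) ^+ 2 = cabs F ^+ 2 + (2 * a + cabs g ^+ 2).
  by rewrite !sqr_cabs /a !CE; ring.
have e2 : cabs (F + mkC 0 1 * g) ^+ 2 = cabs F ^+ 2 + (2 * b + cabs g ^+ 2).
  by rewrite !sqr_cabs /b !CE; ring.
have e3 : cabs (F + -1 * g) ^+ 2 = cabs F ^+ 2 + (2 * (- a) + cabs g ^+ 2).
  by rewrite !sqr_cabs /a !CE; ring.
have e4 : cabs (F + mkC 0 (-1) * g) ^+ 2 = cabs F ^+ 2 + (2 * (- b) + cabs g ^+ 2).
  by rewrite !sqr_cabs /b !CE; ring.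
rewrite /phases !big_cons big_nil addr0.
have := step _ _ aF e1; have := step _ _ bF e2.
have := step (- a) _ _ e3; rewrite normrN => /(_ aF).
have := step (- b) _ _ e4; rewrite normrN => /(_ bF).
rewrite /defect -/h; clear step e1 e2 e3 e4.
move: (Num.sqrt (1 - _ (F + 1 * _) ^+ 2)) (Num.sqrt (1 - _ (F + mkC 0 1 * _) ^+ 2))
  (Num.sqrt (1 - _ (F + -1 * _) ^+ 2)) (Num.sqrt (1 - _ (F + mkC 0 (-1) * _) ^+ 2)) => d1 d2 d3 d4.
have := sqrtr_ge0 h; move: (Num.sqrt h) => S S0 H4 H3 H2 H1.
rewrite ler_pdivrMr//.
apply: le_trans (lerD H1 (lerD H2 (lerD H3 H4))) _.
rewrite -!mulrDr -[leRHS]mulrA ler_wpM2l//.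
have hn : h != 0 by rewrite gt_eqF.
have -> : 1 - (2 * a + cabs g ^+ 2) / (2 * h) - ((2 * a + cabs g ^+ 2) / h) ^+ 2 / 16 +
  (1 - (2 * b + cabs g ^+ 2) / (2 * h) - ((2 * b + cabs g ^+ 2) / h) ^+ 2 / 16 +
   (1 - (2 * - a + cabs g ^+ 2) / (2 * h) - ((2 * - a + cabs g ^+ 2) / h) ^+ 2 / 16 +
    (1 - (2 * - b + cabs g ^+ 2) / (2 * h) - ((2 * - b + cabs g ^+ 2) / h) ^+ 2 / 16))) =
  4 - (2 * h * cabs g ^+ 2 + (a ^+ 2 + b ^+ 2) / 2 + cabs g ^+ 2 ^+ 2 / 4) / h ^+ 2 by field.
rewrite ab.
have -> : (1 - (cabs g / h) ^+ 2 / 8) * 4 = 4 - (cabs g ^+ 2 / 2) / h ^+ 2 by field.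
rewrite lerD2l lerN2 ler_pM2r ?invr_gt0 ?exprn_gt0//.
(* The gain comes from |g|^2 in the first order term when [h] is large and from the cross terms when
   [h] is small: 2 h |g|^2 + (1 - h) |g|^2 / 2 >= |g|^2 / 2. *)
have := sqr_ge0 (cabs g); have := sqr_ge0 (cabs g ^+ 2); nra.
Qed.

(** The mean of the defect of F + sum_i u_i g_i over all choices of phases, taken one summand at a
    time so that [four_phases] applies at each stage. *)
Fixpoint phase_mean F s : R :=
  if s is g :: s' then (\sum_(u <- phases) phase_mean (F + u * g) s') / 4 else defect F.

Lemma phase_mean_ge0 F s : 0 <= phase_mean F s.
Proof.
elim: s F => [F|g s IH F] /=; first exact: defect_ge0.
by rewrite divr_ge0// sumr_ge0.
Qed.

Lemma phase_step F g u : u \in phases ->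
  cabs F - cabs g <= cabs (F + u * g) <= cabs F + cabs g.
Proof.
move=> /cabs_phases u1; have ug : cabs (u * g) = cabs g by rewrite cabsM u1 mul1r.
apply/andP; split; last by rewrite -ug cabsD.
rewrite lerBlDr -ug -{1}(addrK (u * g) F); exact: cabsB.
Qed.

(** The condition on |F| plus the sum of the |g| survives any choice of phase, and at each stage it
    implies the hypothesis 16 |g| <= 1 - |F|^2 of [four_phases]. *)
Lemma phase_mean_le F s (b : R) : 0 < b ->
  (forall g, g \in s -> cabs g <= b) -> cabs F + \sum_(g <- s) cabs g <= 1 - 16 * b ->
  phase_mean F s <= defect F.
Proof.
move=> b0; elim: s F => [|g s IH] F sb Fs //=.
rewrite big_cons in Fs.
have s0 : 0 <= \sum_(g <- s) cabs g by apply: sumr_ge0 => *; exact: cabs_ge0.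
have gb := sb g (mem_head _ _); have F0 := cabs_ge0 F; have g0 := cabs_ge0 g.
have F1 : cabs F < 1 by lra.
have gF : 16 * cabs g <= 1 - cabs F ^+ 2 by nra.
apply: (@le_trans _ _ ((\sum_(u <- phases) defect (F + u * g)) / 4)).
  rewrite ler_pM2r// big_seq [leRHS]big_seq; apply: ler_sum => u up.
  have /andP[_ u2] := phase_step F g up.
  by apply: IH => [k ks|]; [apply: sb; rewrite inE ks orbT|lra].
apply: le_trans (four_phases F1 gF) _; rewrite ler_piMr ?defect_ge0//.
by rewrite lerBlDr lerDl divr_ge0// sqr_ge0.
Qed.

(** Whatever the earlier phases, 1 - |F| <= b2 when the turn of [g0] comes, so that 1 - |F|^2 <= 2
    b2 and |g0| / (1 - |F|^2) >= c / 2: a relative gain of (c / 2)^2 / 8. The other summands lose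
    nothing. *)
Lemma phase_mean_gain F s g0 (b b2 c : R) : 0 < b -> 0 <= c -> c <= 1 ->
  (forall g, g \in s -> cabs g <= b) -> cabs F + \sum_(g <- s) cabs g <= 1 - 16 * b ->
  1 - b2 <= cabs F - \sum_(g <- s) cabs g ->
  g0 \in s -> c * b2 <= cabs g0 ->
  phase_mean F s <= (1 - c ^+ 2 / 32) * defect F.
Proof.
move=> b0 c0 c1; elim: s F => [|g s IH] F // sb Fs Fb; rewrite inE => gs cg.
have Fs' := Fs; have Fb' := Fb; rewrite big_cons in Fs'; rewrite big_cons in Fb'.
have s0 : 0 <= \sum_(g <- s) cabs g by apply: sumr_ge0 => *; exact: cabs_ge0.
have gb := sb g (mem_head _ _); have F0 := cabs_ge0 F; have g00 := cabs_ge0 g.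
have F1 : cabs F < 1 by lra.
have gF : 16 * cabs g <= 1 - cabs F ^+ 2 by nra.
have st u : u \in phases -> cabs (F + u * g) + \sum_(g <- s) cabs g <= 1 - 16 * b /\
    1 - b2 <= cabs (F + u * g) - \sum_(g <- s) cabs g.
  by move=> up; have /andP[u1 u2] := phase_step F g up; split; lra.
have sb' k : k \in s -> cabs k <= b by move=> ks; apply: sb; rewrite inE ks orbT.
have [E|ng] := eqVneq g0 g.
  rewrite E in cg; apply: (@le_trans _ _ ((\sum_(u <- phases) defect (F + u * g)) / 4)).
    rewrite /= ler_pM2r// big_seq [leRHS]big_seq; apply: ler_sum => u up.
    have [u1 _] := st u up; exact: (phase_mean_le b0 sb' u1).
  apply: le_trans (four_phases F1 gF) _.
  rewrite mulrC ler_wpM2r ?defect_ge0// lerD2l lerN2.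
  have h0 : 0 < 1 - cabs F ^+ 2 by nra.
  have h2 : 1 - cabs F ^+ 2 <= 2 * b2 by nra.
  have : c / 2 <= cabs g / (1 - cabs F ^+ 2) by rewrite ler_pdivlMr//; nra.
  have : 0 <= c / 2 by rewrite divr_ge0.
  move: (_ / (1 - _)) => x c2 cx.
  have -> : c ^+ 2 / 32 = (c / 2) ^+ 2 / 8 by field.
  by rewrite ler_pM2r// lerXn2r// nnegrE; lra.
have gs' : g0 \in s by case/orP: gs => // /eqP E; rewrite E eqxx in ng.
apply: (@le_trans _ _ ((1 - c ^+ 2 / 32) * ((\sum_(u <- phases) defect (F + u * g)) / 4))).
  rewrite /= mulrA ler_pM2r// mulr_sumr big_seq [leRHS]big_seq; apply: ler_sum => u up.
  have [u1 u2] := st u up; exact: IH.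
have q0 : 0 <= 1 - c ^+ 2 / 32 by nra.
rewrite ler_wpM2l//; apply: le_trans (four_phases F1 gF) _; rewrite ler_piMr ?defect_ge0//.
by rewrite lerBlDr lerDl divr_ge0// sqr_ge0.
Qed.

End phase_average.

(** * Gaussian sums over a lattice *)

Section lattice_sums.
Variable R : realType.
Implicit Types (x u : R).

(* Comparing with the increments of [sigmoid] bounds lattice sums by telescoping. *)
Definition sigmoid x : R := x / (1 + `|x|).

Lemma sigmoid_itv x : -1 <= sigmoid x <= 1.
Proof.
have p : 0 < 1 + `|x| by rewrite ltr_pwDl.
rewrite /sigmoid ler_pdivlMr// ler_pdivrMr// mulN1r mul1r.
have := ler_norm x; have := ler_norm (- x); rewrite normrN => h1 h2.
by apply/andP; split; lra.
Qed.

Lemma sigmoid_step x : (1 + x ^+ 2)^-1 <= 4 * (sigmoid (x + 1) - sigmoid x).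
Proof.
have p : 0 < 1 + x ^+ 2 by have := sqr_ge0 x; lra.
rewrite -[leLHS]mul1r ler_pdivrMr// /sigmoid.
have [x0|x0] := leP 0 x.
  rewrite !ger0_norm//; last by lra.
  have -> : (x + 1) / (1 + (x + 1)) - x / (1 + x) = ((1 + x) * (2 + x))^-1 by field; lra.
  by rewrite mulrAC ler_pdivlMr; nra.
have [x1|x1] := leP 0 (x + 1).
  rewrite (ger0_norm x1) (ltr0_norm x0).
  have -> : (x + 1) / (1 + (x + 1)) - x / (1 - x) = (1 - 2 * x - 2 * x ^+ 2) / ((2 + x) * (1 - x)) by field; lra.
  by rewrite mulrA mulrAC ler_pdivlMr; nra.
rewrite (ltr0_norm x1) (ltr0_norm x0).
have -> : (x + 1) / (1 - (x + 1)) - x / (1 - x) = ((- x) * (1 - x))^-1 by field; lra.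
by rewrite mulrAC ler_pdivlMr; nra.
Qed.

Lemma expR_le_inv x : 0 <= x -> expR (- x) <= (1 + x)^-1.
Proof. by move=> x0; rewrite expRN lef_pV2 ?posrE ?expR_gt0 ?expR_ge1Dx//; lra. Qed.

(** Since exp(- x^2) <= 1 / (1 + x^2), each term is at most 4 times an increment of [sigmoid], whose
    values span an interval of length at most 2. *)
Lemma gauss_lattice_sum (p : nat) (u : R) :
  \sum_(i < p) expR (- (u - i%:R) ^+ 2) <= 8.
Proof.
apply: (@le_trans _ _ (4 * (sigmoid (p%:R - u) - sigmoid (- u)))).
  elim: p => [|p IH]; first by rewrite big_ord0 sub0r subrr mulr0.
  rewrite big_ord_recr /=; have := lerD IH (sigmoid_step (p%:R - u)).
  have -> : (p%:R - u + 1) = p.+1%:R - u by rewrite -natr1; ring.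
  have := expR_le_inv (sqr_ge0 (u - p%:R)).
  have -> : (u - p%:R) ^+ 2 = (p%:R - u) ^+ 2 by ring.
  by move: (expR _) (_^-1) => *; lra.
by have /andP[a1 a2] := sigmoid_itv (p%:R - u); have /andP[b1 b2] := sigmoid_itv (- u); lra.
Qed.

(** Rounding toward zero, and not to the nearest lattice point, keeps the node chosen for a point of
    the ball inside the ball. The index is shifted by [m] to run through the integers from - m to
    m. *)
Lemma round_toward_zero (m : nat) x : (0 < m)%N -> `|x| <= 1 ->
  exists2 a : 'I_(m.*2.+1), `|(a%:R - m%:R) / m%:R| <= `|x| & `|x - (a%:R - m%:R) / m%:R| <= m%:R^-1.
Proof.
move=> m0 x1; have M0 : 0 < m%:R :> R by rewrite ltr0n.
pose k := Num.truncn (m%:R * `|x|).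
have y0 : 0 <= m%:R * `|x| by rewrite mulr_ge0.
have k1 : k%:R <= m%:R * `|x| by rewrite truncn_le.
have k2 : m%:R * `|x| < k.+1%:R by rewrite truncnS_gt.
rewrite -natr1 in k2.
have km : (k <= m)%N.
  by rewrite -(ler_nat R); apply: le_trans k1 _; rewrite ler_piMr// ltW.
have d1 : k%:R / m%:R <= `|x| by rewrite ler_pdivrMr// mulrC.
have d2 : `|x| <= k%:R / m%:R + m%:R^-1 by rewrite -[X in _ + X]mul1r -mulrDl ler_pdivlMr// mulrC ltW.
have d0 : 0 <= k%:R / m%:R :> R by rewrite divr_ge0.
have [s0|s0] := leP 0 x.
  have lt : (m + k < m.*2.+1)%N by rewrite ltnS -addnn leq_add2l.
  exists (Ordinal lt); rewrite /= natrD [X in X / _]addrAC subrr add0r ?(ger0_norm d0)//.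
  rewrite (ger0_norm s0) in d1 d2.
  by rewrite ler_norml; apply/andP; split; lra.
have lt : (m - k < m.*2.+1)%N by rewrite ltnS -addnn (leq_trans (leq_subr _ _))// leq_addr.
exists (Ordinal lt); rewrite /= natrB// [X in X / _]addrAC subrr add0r mulNr ?normrN ?(ger0_norm d0)//.
rewrite (ltr0_norm s0) in d1 d2.
by rewrite ler_norml; apply/andP; split; lra.
Qed.

End lattice_sums.

(** * Choice of the phases *)

Section phase_choice.
Context {d : measure_display} {T : measurableType d} {R : realType}.
Variable mu : {finite_measure set T -> \bar R}.
Local Notation C := (CC R).

Definition cmeasurable (f : T -> C) :=
  measurable_fun setT (fun t => Re (f t)) /\ measurable_fun setT (fun t => Im (f t)).

Lemma cmeasurableD f g : cmeasurable f -> cmeasurable g -> cmeasurable (fun t => f t + g t).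
Proof.
move=> [f1 f2] [g1 g2]; split.
  rewrite (_ : (fun t => _) = (fun t => Re (f t)) \+ (fun t => Re (g t))).
    exact: measurable_funD.
  by apply/funext => t; rewrite !CE.
rewrite (_ : (fun t => _) = (fun t => Im (f t)) \+ (fun t => Im (g t))).
  exact: measurable_funD.
by apply/funext => t; rewrite !CE.
Qed.

Lemma cmeasurableZ (c : C) f : cmeasurable f -> cmeasurable (fun t => c * f t).
Proof.
move=> [f1 f2]; split.
  rewrite (_ : (fun t => _) = (fun t => Re c * Re (f t)) \- (fun t => Im c * Im (f t))).
    by apply: measurable_funB; apply: measurable_funM => //; exact: measurable_cst.
  by apply/funext => t; rewrite !CE.
rewrite (_ : (fun t => _) = (fun t => Re c * Im (f t)) \+ (fun t => Im c * Re (f t))).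
  by apply: measurable_funD; apply: measurable_funM => //; exact: measurable_cst.
by apply/funext => t; rewrite !CE.
Qed.

Lemma measurable_defect f : cmeasurable f -> measurable_fun setT (fun t => defect (f t)).
Proof.
move=> [f1 f2].
rewrite (_ : (fun t => _) = (@Num.sqrt R) \o
    (fun t => 1 - (Re (f t) ^+ 2 + Im (f t) ^+ 2))); last first.
  by apply/funext => t; rewrite /= /defect sqr_cabs.
apply: measurableT_comp.
  by apply: continuous_measurable_fun; exact: sqrt_continuous.
apply: measurable_funB; first exact: measurable_cst.
by apply: measurable_funD; apply: measurable_funX.
Qed.

Definition mean_defect (f : T -> C) : \bar R := (\int[mu]_t (defect (f t))%:E)%E.

Lemma phase_mean_le1 (F : C) s : phase_mean F s <= 1.
Proof.
elim: s F => [|g s IH] F /=; first exact: defect_le1.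
rewrite ler_pdivrMr// mul1r; apply: (@le_trans _ _ (\sum_(u <- phases R) 1)).
  exact: ler_sum.
by rewrite /phases !big_cons big_nil; lra.
Qed.

Section family.
Variables (I : Type) (g : I -> T -> C).
Hypothesis mg : forall i, cmeasurable (g i).

Lemma measurable_phase_mean f (s : seq I) : cmeasurable f ->
  measurable_fun setT (fun t => phase_mean (f t) [seq g i t | i <- s]).
Proof.
elim: s f => [|i s IH] f mf /=; first exact: measurable_defect.
apply: measurable_funM; last exact: measurable_cst.
apply: measurable_sum => u; apply: (IH (fun t => f t + u * g i t)).
by apply: cmeasurableD => //; exact: cmeasurableZ.
Qed.

(** The same phases have to serve all [t], so integrals are compared. The phases are fixed one after
    the other: of the four integrals for the next phase, at least one does not exceed their mean. *)
Lemma phase_choice f (s : seq I) : cmeasurable f ->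
  exists us : seq C, [/\ size us = size s, {subset us <= phases R} &
    (mean_defect (fun t => f t + \sum_(p <- zip us s) p.1 * g p.2 t)%R <=
     \int[mu]_t (phase_mean (f t) [seq g i t | i <- s])%:E)%E].
Proof.
have E (x1 x2 x3 x4 : R) : x1 / 4 + (x2 / 4 + (x3 / 4 + (x4 / 4 + 0))) < x4 ->
    x1 / 4 + (x2 / 4 + (x3 / 4 + (x4 / 4 + 0))) < x3 ->
    x1 / 4 + (x2 / 4 + (x3 / 4 + (x4 / 4 + 0))) < x2 ->
    x1 / 4 + (x2 / 4 + (x3 / 4 + (x4 / 4 + 0))) < x1 -> False by move=> *; lra.
elim: s f => [|i s IH] f mf.
  exists [::]; split => //; rewrite /mean_defect /=.
  by under eq_integral do rewrite big_nil addr0.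
pose F u t := phase_mean (f t + u * g i t) [seq g i t | i <- s].
have mfu u : cmeasurable (fun t => f t + u * g i t).
  by apply: cmeasurableD => //; exact: cmeasurableZ.
have mF u : measurable_fun setT (fun t => (F u t)%:E).
  exact: (measurable_EFinP _ _).2 (measurable_phase_mean s (mfu u)).
have F0 u t : setT t -> (0 <= (F u t)%:E)%E by rewrite lee_fin phase_mean_ge0.
pose a u := (\int[mu]_t (F u t)%:E)%E.
have aE u : a u = (fine (a u))%:E.
  have a0 : (0 <= a u)%E by apply: integral_ge0; exact: F0.
  rewrite fineK// ge0_fin_numE//.
  apply: (@le_lt_trans _ _ (\int[mu]_t (cst 1%:E t))%E).
    apply: (ge0_le_integral mu measurableT (F0 u) (mF u) (measurable_cst _)).
    by move=> t _; rewrite lee_fin phase_mean_le1.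
  by rewrite (integral_cst mu measurableT 1%:E) mul1e ltey_eq fin_num_measure.
have tot : (\int[mu]_t (phase_mean (f t) [seq g i t | i <- i :: s])%:E =
    (\sum_(u <- phases R) fine (a u) / 4)%:E)%E.
  have -> : (\int[mu]_t (phase_mean (f t) [seq g i t | i <- i :: s])%:E =
      \int[mu]_t ((\sum_(u <- phases R) (F u t)%:E) * (4^-1)%:E))%E.
    by apply: eq_integral => t _; rewrite /= EFinM sumEFin.
  rewrite (ge0_integralZr mu measurableT); first last.
  - by rewrite lee_fin.
  - by move=> t tT; apply: sume_ge0 => u _; exact: F0.
  - by apply: emeasurable_sum => u _; exact: mF.
  rewrite (ge0_integral_sum mu measurableT mF F0).
  by rewrite -mulr_suml EFinM -sumEFin; congr (_ * _)%E; apply: eq_bigr => u _; rewrite -aE.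
have [u up au] : exists2 u, u \in phases R & fine (a u) <= \sum_(u <- phases R) fine (a u) / 4.
  apply: contrapT => H.
  have {}H u : u \in phases R -> \sum_(u <- phases R) fine (a u) / 4 < fine (a u).
    by move=> up; rewrite ltNge; apply/negP => h; apply: H; exists u.
  have := H 1 _; have := H (mkC 0 1) _; have := H (-1) _; have := H (mkC 0 (-1)) _.
  rewrite !inE !eqxx !orbT /= => /(_ isT) + /(_ isT) + /(_ isT) + /(_ isT).
  rewrite /phases !big_cons big_nil.
  exact: E.
have [us [sus usp H]] := IH (fun t => f t + u * g i t) (mfu u).
exists (u :: us); split => //=; first by rewrite sus.
  by move=> v; rewrite inE => /orP[/eqP ->//|/usp].
rewrite tot; apply: le_trans (_ : (_ <= a u)%E) _; last by rewrite aE lee_fin.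
rewrite (_ : (fun t => _) = (fun t => f t + u * g i t + \sum_(p <- zip us s) p.1 * g p.2 t)%R)//.
by apply/funext => t; rewrite big_cons addrA.
Qed.

End family.
End phase_choice.

(** * Functions holomorphic beyond the closed ball, and peak functions *)

Section regular_functions.
Variables (R : realType) (n : nat).
Local Notation C := (CC R).
Local Notation V := ('rV[C]_n).
Local Notation T := (Rspace R (n + n)).
Implicit Types (f g : V -> C) (y z : V).

Definition regular (rho : R) f :=
  (forall z, vnorm z < rho -> differentiable f z) /\
  exists M : R, forall z, vnorm z < rho -> cabs (f z) <= M.

Lemma regularD rho f g : regular rho f -> regular rho g -> regular rho (fun z => f z + g z).
Proof.
move=> [df [M fM]] [dg [K gK]]; split.
  by move=> z zr; exact: differentiableD (df z zr) (dg z zr).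
exists (M + K) => z zr; apply: le_trans (cabsD _ _) _; exact: lerD (fM z zr) (gK z zr).
Qed.

Lemma regularZ rho (c : C) f : regular rho f -> regular rho (fun z => c * f z).
Proof.
move=> [df [M fM]]; split.
  by move=> z zr; exact: (differentiable_comp (df z zr) (differentiable_cmul c (f z))).
exists (cabs c * M) => z zr; rewrite cabsM ler_wpM2l ?cabs_ge0//; exact: fM.
Qed.

Lemma regular0 rho : regular rho (fun=> 0 : C).
Proof.
split; first by move=> z _; exact: differentiable_cst.
by exists 0 => z _; rewrite cabs0.
Qed.

Lemma regular_sum (I : Type) (s : seq I) rho (f : I -> V -> C) :
  (forall i, regular rho (f i)) -> regular rho (fun z => \sum_(i <- s) f i z).
Proof.
move=> rf; elim: s => [|i s IH].
  rewrite (_ : (fun z => _) = fun=> 0); first exact: regular0.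
  by apply/funext => z; rewrite big_nil.
rewrite (_ : (fun z => _) = (fun z => f i z + \sum_(i <- s) f i z)).
  exact: regularD.
by apply/funext => z; rewrite big_cons.
Qed.

(** The local estimate reaches points at distance at most (rho - 1) / 2; beyond that the distance is
    bounded below, and boundedness of [f] suffices. *)
Lemma regular_lipschitz rho f : 1 < rho -> regular rho f ->
  exists2 L : R, 0 < L & forall z y, vnorm z <= 1 -> vnorm y <= 1 ->
    cabs (f y - f z) <= L * vnorm (y - z).
Proof.
move=> rho1 [df [M fM]]; pose r := rho - 1; have r0 : 0 < r by rewrite subr_gt0.
have M0 : 0 <= M.
  by apply: le_trans (cabs_ge0 _) (fM 0 _); rewrite vnorm0; lra.
have L0 : 0 <= 8 * M / r by rewrite !mulr_ge0// invr_ge0 ltW.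
exists (8 * M / r + 1) => [|z y z1 y1]; first by rewrite ltr_wpDl.
have zr : vnorm z + r <= rho by rewrite /r; lra.
have [h|h] := leP (vnorm (y - z)) (r / 2).
  have dz w : vnorm w < vnorm z + r -> differentiable f w.
    by move=> wr; apply: df; exact: lt_le_trans zr.
  have dM w : vnorm w < vnorm z + r -> cabs (f w) <= M.
    by move=> wr; apply: fM; exact: lt_le_trans zr.
  have := holomorphic_lipschitz r0 dz dM h; rewrite (addrC z) subrK => /le_trans; apply.
  by rewrite ler_wpM2r ?vnorm_ge0// lerDl.
have b1 : cabs (f y) <= M by apply: fM; exact: le_lt_trans rho1.
have b2 : cabs (f z) <= M by apply: fM; exact: le_lt_trans rho1.
apply: le_trans (cabsB _ _) _; apply: (@le_trans _ _ (8 * M / r * (r / 2))).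
  have -> : 8 * M / r * (r / 2) = 4 * M by field; rewrite gt_eqF.
  lra.
apply: (@le_trans _ _ (8 * M / r * vnorm (y - z))); first by rewrite ler_wpM2l// ltW.
by rewrite ler_wpM2r ?vnorm_ge0// lerDl.
Qed.

Lemma regular_continuous rho f z (e : R) : regular rho f -> vnorm z < rho -> 0 < e ->
  exists2 d : R, 0 < d & forall h, vnorm h < d -> cabs (f (z + h) - f z) < e.
Proof.
by move=> [df [M fM]]; exact: bounded_holomorphic_continuous df fM.
Qed.

Lemma regular_cmeasurable rho f : 1 < rho -> regular rho f ->
  cmeasurable (fun t : T => f (cx (direction t))).
Proof.
move=> rho1 rf.
have P (g : C -> R) : (forall a b : C, `|g a - g b| <= cabs (a - b)) ->
    measurable_fun setT (fun t : T => g (f (cx (direction t)))).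
  move=> gl; have [|mD mf] := @cx_continuous_measurable R n rho (fun z => g (f z)).
    move=> z zr e e0; have [d d0 H] := regular_continuous rf zr e0.
    by exists d => // h hd; apply: le_lt_trans (gl _ _) _; exact: H.
  apply: (measurable_comp mD _ mf); last exact: measurable_direction.
  by move=> _ [t _ <-] /=; apply: le_lt_trans rho1; exact: vnorm_cx_direction_le1.
by split; apply: P => a b; [rewrite -ReB; exact: Re_le_cabs|rewrite -ImB; exact: Im_le_cabs].
Qed.

(* On the unit sphere, [cabs (peak N y z)] is the Gaussian [expR (- N/2 |z - y|^2)],
   while [peak N y] is small inside the ball when [N] is large. *)
Definition peak (N : R) y z : C :=
  cexp (\sum_k (toC N * conjC (y 0 k)) * z 0 k + toC (- (N * (1 + vnorm y ^+ 2) / 2))).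

Lemma cabs_peak N y z :
  cabs (peak N y z) = expR (- (N / 2 * (vnorm (z - y) ^+ 2 + (1 - vnorm z ^+ 2)))).
Proof.
rewrite /peak cabs_cexp ReD (big_morph (@Re R) (@ReD R) (Re0 R)) Re_toC; congr expR.
have E : vnorm (z - y) ^+ 2 = vnorm z ^+ 2 + vnorm y ^+ 2 -
    \sum_k 2 * Re (conjC (y 0 k) * z 0 k).
  rewrite !sqr_vnorm -big_split -sumrB; apply: eq_bigr => k _ /=.
  by rewrite !mxE !sqr_cabs !CE; ring.
rewrite E -mulr_sumr [X in X + _](_ : _ = N * \sum_k Re (conjC (y 0 k) * z 0 k)).
  by move: (\sum_k _) (vnorm y ^+ 2) (vnorm z ^+ 2) => *; field.
by rewrite mulr_sumr; apply: eq_bigr => k _; rewrite !CE; ring.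
Qed.

Lemma differentiable_peak N y z : differentiable (peak N y) z.
Proof.
have D (s : seq 'I_n) : differentiable
    (fun z : V => \sum_(k <- s) (toC N * conjC (y 0 k)) * z 0 k) z.
  elim: s => [|k s IH].
    rewrite (_ : (fun z => _) = cst 0); first exact: differentiable_cst.
    by apply/funext => w; rewrite big_nil.
  rewrite (_ : (fun z => _) = (fun z : V => (toC N * conjC (y 0 k)) * z 0 k +
      \sum_(k <- s) (toC N * conjC (y 0 k)) * z 0 k)); last first.
    by apply/funext => w; rewrite big_cons.
  apply: differentiableD IH.
  exact: (differentiable_comp (differentiable_coord z 0 k) (differentiable_cmul _ _)).
have D1 := differentiableD (D (index_enum _)) (differentiable_cst (toC (- (N * (1 + vnorm y ^+ 2) / 2))) z).
exact: (differentiable_comp D1 (differentiable_cexp _)).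
Qed.

Lemma regular_peak rho N y : 0 <= N -> regular rho (peak N y).
Proof.
move=> N0; split; first by move=> z _; exact: differentiable_peak.
exists (expR (N / 2 * rho ^+ 2)) => z zr; rewrite cabs_peak ler_expR -mulrN ler_wpM2l ?divr_ge0//.
have := sqr_ge0 (vnorm (z - y)); have : vnorm z ^+ 2 <= rho ^+ 2.
  by have := vnorm_ge0 z => z0; rewrite lerXn2r ?nnegrE ?(ltW zr)//; lra.
by lra.
Qed.

End regular_functions.

Section grid.
Variables (R : realType) (n m : nat).
Hypothesis m_gt0 : (0 < m)%N.
Local Notation C := (CC R).
Local Notation V := ('rV[C]_n).
Local Notation P := ('I_(m.*2.+1)).

(* The nodes are the points of the lattice (1/m) Z^(2n) in the cube [-1, 1]^(2n). *)
Definition coord (a : P) : R := (a%:R - m%:R) / m%:R.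

Definition node (g : {ffun 'I_n -> P * P}) : V := \row_k mkC (coord (g k).1) (coord (g k).2).

(** The Gaussian factors over the 2n real coordinates, so the sum over the nodes is a product of 2n
    one-dimensional sums, each at most 8. *)
Lemma node_gauss_sum (z : V) :
  \sum_g expR (- (m%:R ^+ 2 * vnorm (z - node g) ^+ 2)) <= 64 ^+ n.
Proof.
have M0 : (m%:R : R) != 0 by rewrite pnatr_eq0 -lt0n.
pose E (k : 'I_n) (j : P * P) : R :=
  expR (- (m%:R * Re (z 0 k) + m%:R - j.1%:R) ^+ 2) *
  expR (- (m%:R * Im (z 0 k) + m%:R - j.2%:R) ^+ 2).
have -> : \sum_g expR (- (m%:R ^+ 2 * vnorm (z - node g) ^+ 2)) = \prod_k \sum_j E k j.
  rewrite bigA_distr_bigA; apply: eq_bigr => g _.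
  rewrite sqr_vnorm mulr_sumr -sumrN expR_sum; apply: eq_bigr => k _.
  rewrite /E -expRD; congr expR; rewrite !mxE sqr_cabs !CE /coord.
  by field.
have -> : (64 ^+ n : R) = \prod_(k < n) 64 by rewrite prodr_const card_ord.
apply: ler_prod => k _; apply/andP; split.
  by apply: sumr_ge0 => j _; rewrite mulr_ge0 ?expR_ge0.
rewrite /E -(pair_bigA _ (fun a b : P =>
  expR (- (m%:R * Re (z 0 k) + m%:R - a%:R) ^+ 2) *
  expR (- (m%:R * Im (z 0 k) + m%:R - b%:R) ^+ 2))) /= -big_distrlr /=.
have -> : (64 : R) = 8 * 8 by ring.
by apply: ler_pM; rewrite ?gauss_lattice_sum//; apply: sumr_ge0 => *; exact: expR_ge0.
Qed.

(** Rounding moves each of the 2n real coordinates toward 0 by at most 1/m. *)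
Lemma node_near (z : V) : vnorm z <= 1 -> exists g, vnorm (node g) <= vnorm z /\
  m%:R ^+ 2 * vnorm (z - node g) ^+ 2 <= (n + n)%:R.
Proof.
move=> z1; have M0 : 0 < m%:R :> R by rewrite ltr0n.
have ex k : exists ab : P * P, (`|coord ab.1| <= `|Re (z 0 k)| /\ `|Re (z 0 k) - coord ab.1| <= m%:R^-1) /\
    (`|coord ab.2| <= `|Im (z 0 k)| /\ `|Im (z 0 k) - coord ab.2| <= m%:R^-1).
  have k1 := le_trans (cabs_le_vnorm z k) z1.
  have [a a1 a2] := round_toward_zero m_gt0 (le_trans (Re_le_cabs _) k1).
  have [b b1 b2] := round_toward_zero m_gt0 (le_trans (Im_le_cabs _) k1).
  by exists (a, b).
have [h Hh] := choice ex; exists (finfun h).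
have sq (x y : R) : `|x| <= y -> x ^+ 2 <= y ^+ 2.
  by move=> xy; rewrite -real_normK ?num_real// lerXn2r ?nnegrE//; apply: le_trans xy.
split.
  rewrite -(@ler_pXn2r _ 2) ?nnegrE ?vnorm_ge0// !sqr_vnorm; apply: ler_sum => k _.
  have [[h1 _] [h2 _]] := Hh k; rewrite !mxE ffunE !sqr_cabs !CE.
  by rewrite -(real_normK (num_real (Re _))) -(real_normK (num_real (Im _))) lerD ?sq.
rewrite sqr_vnorm mulr_sumr; apply: (@le_trans _ _ (\sum_(k < n) (2 : R))); last first.
  by rewrite sumr_const card_ord -[2 *+ n]mulr_natr -natrM mul2n addnn.
apply: ler_sum => k _; have [[_ h1] [_ h2]] := Hh k.
rewrite !mxE ffunE sqr_cabs !CE mulrDr.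
have mm (x : R) : `|x| <= m%:R^-1 -> m%:R ^+ 2 * x ^+ 2 <= 1.
  move=> /sq h3; rewrite -ler_pdivlMl ?exprn_gt0// mulr1 -exprVn//.
by have := mm _ h1; have := mm _ h2; lra.
Qed.

End grid.

(** * One step of the iteration *)

Section block.
Variables (R : realType) (n : nat).
Local Notation C := (CC R).
Local Notation V := ('rV[C]_n).
Local Notation T := (Rspace R (n + n)).
Implicit Types (f : V -> C) (z y : V).
Local Notation sigma := (@sphere_measure R n).

(** The class preserved by the iteration: holomorphy beyond the closed ball gives a Lipschitz
    constant on it, and [eta] bounds the gap from below. *)
Definition admissible f := (exists2 rho : R, 1 < rho & regular rho f) /\
  exists2 eta : R, 0 < eta & forall z, vnorm z <= 1 -> cabs (f z) <= 1 - eta.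

Definition sphere_defect f : \bar R :=
  mean_defect sigma (fun t => f (cx (direction t))).

Definition gap f z : R := 1 - cabs (f z) ^+ 2.

(** Put x = L |z - y| / eta. As eta <= gap f z, the Lipschitz bound gives gap f y <= (1 + 2 x) gap f
    z, and 1 + 2 x <= 2 (1 + x^2) <= 2 exp(x^2). *)
Lemma gap_compare f : admissible f -> exists2 K : R, 0 <= K &
  forall z y, vnorm z <= 1 -> vnorm y <= 1 ->
    gap f y <= 2 * gap f z * expR (K * vnorm (z - y) ^+ 2).
Proof.
move=> [[rho rho1 rf] [eta eta0 feta]].
have [L L0 HL] := regular_lipschitz rho1 rf.
have gap_ge z : vnorm z <= 1 -> eta <= gap f z.
  by move=> z1; have := feta z z1; have := cabs_ge0 (f z); rewrite /gap; nra.
have le1 z : vnorm z <= 1 -> cabs (f z) <= 1 by move=> z1; have := feta z z1; lra.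
exists ((L / eta) ^+ 2); first exact: sqr_ge0.
move=> z y z1 y1; set d := vnorm (z - y); have d0 : 0 <= d := vnorm_ge0 _.
have g1 := gap_ge z z1.
have h1 : gap f y <= gap f z + 2 * L * d.
  have := HL _ _ y1 z1; rewrite -/d => h.
  have := le_trans (cabsB_dist (f z) (f y)) h; rewrite ler_norml => /andP[_ h2].
  have := le1 z z1; have := le1 y y1; have := cabs_ge0 (f z); have := cabs_ge0 (f y).
  have q0 : 0 <= L * d by rewrite mulr_ge0// ltW.
  rewrite /gap -(mulrA 2); move: h2 q0; move: (L * d) (cabs (f z)) (cabs (f y)) => q a b h2 q0 b0 a0 b1 a1.
  have : 0 <= (q - (a - b)) * (a + b) by apply: mulr_ge0; lra.
  have : 0 <= q * (2 - (a + b)) by rewrite mulr_ge0//; lra.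
  lra.
apply: le_trans h1 _; pose x := L / eta * d.
have x0 : 0 <= x by rewrite mulr_ge0// divr_ge0// ltW.
have Ld : 2 * L * d <= 2 * x * gap f z.
  have -> : 2 * L * d = 2 * x * eta by rewrite /x; field; rewrite gt_eqF.
  by rewrite ler_wpM2l// mulr_ge0.
have -> : (L / eta) ^+ 2 * d ^+ 2 = x ^+ 2 by rewrite /x [RHS]exprMn.
have := expR_ge1Dx (x ^+ 2); have : 0 < gap f z by lra.
move: (gap f z) (expR _) (2 * L * d) Ld => G E D Ld G0 E1.
have : G * (1 + x ^+ 2) <= G * E by rewrite ler_pM2l.
have : 0 <= G * (x - 1) ^+ 2 by rewrite mulr_ge0 ?sqr_ge0// ltW.
have : 0 <= G * x ^+ 2 by rewrite mulr_ge0 ?sqr_ge0// ltW.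
by move=> *; nra.
Qed.

Lemma zip_phase_bound (I : Type) (us : seq C) (s : seq I) (g : I -> C) :
  size us = size s -> {subset us <= phases R} ->
  cabs (\sum_(p <- zip us s) p.1 * g p.2) <= \sum_(i <- s) cabs (g i).
Proof.
elim: s us => [|i s IH] [|u us] //=.
  by rewrite !big_nil cabs0.
move=> [sz] sub; rewrite !big_cons; apply: le_trans (cabsD _ _) _; apply: lerD.
  by rewrite /= cabsM (cabs_phases (sub u (mem_head _ _))) mul1r.
by apply: IH => // v vu; apply: sub; rewrite inE vu orbT.
Qed.

(** This is delta exp(- 6n) / 4 for the coefficient [delta] below. At the node close to a point of
    the sphere the Gaussian is at least exp(- 4n); comparing the gaps at the two points costs a
    further 2 exp(2n), and the last 2 comes from measuring the peak against twice the gap. *)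
Definition block_gain : R := (64 ^+ n)^-1 * expR (- (6 * n%:R)) / 128 / 4.

Lemma block_gain_itv : 0 < block_gain <= 1.
Proof.
have S0 : 1 <= (64 : R) ^+ n by apply: exprn_ege1; lra.
have S1 := lt_le_trans ltr01 S0; have : 0 < (64 ^+ n : R)^-1 <= 1 by rewrite invr_gt0 S1 (invf_le1 S1) S0.
have x1' : expR (- (6 * n%:R) : R) <= 1 by rewrite -[leRHS]expR0 ler_expR oppr_le0 mulr_ge0.
move: x1' (expR_gt0 (- (6 * n%:R) : R)).
rewrite /block_gain; move: (expR _) (_^-1) => x y x1 x0 /andP[y0 y1].
have : 0 < y * x by rewrite mulr_gt0.
have : y * x <= 1 by rewrite mulr_ile1// ltW.
by move: (y * x) => w w1 w0; apply/andP; split; lra.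
Qed.

Definition block_factor : R := 1 - block_gain ^+ 2 / 32.

Lemma block_factor_itv : 0 < block_factor < 1.
Proof.
by have /andP[a b] := block_gain_itv; rewrite /block_factor; apply/andP; split; nra.
Qed.

Section one_block.
Variables (f : V -> C) (m : nat) (K : R).
Hypothesis m_gt0 : (0 < m)%N.
Hypothesis fadm : admissible f.
Hypothesis Km : K <= m%:R ^+ 2.
Hypothesis HK : forall z y, vnorm z <= 1 -> vnorm y <= 1 ->
    gap f y <= 2 * gap f z * expR (K * vnorm (z - y) ^+ 2).
Local Notation G := {ffun 'I_n -> 'I_(m.*2.+1) * 'I_(m.*2.+1)}.

Let delta : R := (64 ^+ n)^-1 / 128.

Let delta_gt0 : 0 < delta.
Proof.
have : 0 < (64 ^+ n : R)^-1 by rewrite invr_gt0 exprn_gt0.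
by rewrite /delta; move: (_^-1) => *; lra.
Qed.

Lemma gap_gt0 z : vnorm z <= 1 -> 0 < gap f z.
Proof.
have [_ [eta eta0 h]] := fadm => /h; have := cabs_ge0 (f z); rewrite /gap; nra.
Qed.

(** Nodes of the cube outside the closed ball, where nothing bounds [f], are discarded. *)
Definition bump_coef (g : G) : R :=
  if vnorm (node R g) <= 1 then delta * gap f (node R g) else 0.

Definition bump (g : G) z : C :=
  toC (bump_coef g) * peak (4 * m%:R ^+ 2) (node R g) z.

Lemma regular_bump rho g : regular rho (bump g).
Proof. by apply: regularZ; apply: regular_peak; rewrite mulr_ge0// sqr_ge0. Qed.

Lemma bump_coef_ge0 g : 0 <= bump_coef g.
Proof.
rewrite /bump_coef; case: ifP => // h; rewrite mulr_ge0 ?(ltW delta_gt0)//.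
exact: ltW (gap_gt0 h).
Qed.

Lemma cabs_bump g z : cabs (bump g z) = bump_coef g *
  (expR (- (2 * m%:R ^+ 2 * vnorm (z - node R g) ^+ 2)) *
   expR (- (2 * m%:R ^+ 2 * (1 - vnorm z ^+ 2)))).
Proof.
rewrite /bump cabsM cabs_toC ger0_norm ?bump_coef_ge0// cabs_peak -expRD.
by congr (_ * expR _); field.
Qed.

(** The bump at y has exponent - 2 m^2 |z - y|^2: one half absorbs the growth allowed by [HK], the
    other is summed by [node_gauss_sum]. The choice of [delta] makes 2 delta 64^n equal to 1/64. *)
Lemma sum_bump z : vnorm z <= 1 ->
  \sum_g cabs (bump g z) <= gap f z / 64 * expR (- (2 * m%:R ^+ 2 * (1 - vnorm z ^+ 2))).
Proof.
move=> z1; set e := expR _; have e0 : 0 < e by exact: expR_gt0.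
have g0 := gap_gt0 z1.
apply: (@le_trans _ _ (\sum_g 2 * delta * gap f z *
    expR (- (m%:R ^+ 2 * vnorm (z - node R g) ^+ 2)) * e)).
  apply: ler_sum => g _; rewrite cabs_bump -/e mulrA ler_pM2r//.
  set d := vnorm _ ^+ 2; have d0 : 0 <= d by exact: sqr_ge0.
  rewrite /bump_coef; case: ifP => h; last first.
    by rewrite mul0r !mulr_ge0 ?expR_ge0 ?ltW.
  apply: (@le_trans _ _ (delta * (2 * gap f z * expR (m%:R ^+ 2 * d)) * expR (- (2 * m%:R ^+ 2 * d)))).
    rewrite ler_wpM2r ?expR_ge0// ler_pM2l//; apply: le_trans (HK z1 h) _.
    by rewrite ler_pM2l ?mulr_gt0// ler_expR ler_wpM2r.
  rewrite le_eqVlt; apply/predU1P; left.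
  have -> : - (2 * m%:R ^+ 2 * d) = - (m%:R ^+ 2 * d) + - (m%:R ^+ 2 * d) by ring.
  rewrite expRD [expR (m%:R ^+ 2 * d)](_ : _ = (expR (- (m%:R ^+ 2 * d)))^-1); last first.
    by rewrite expRN invrK.
  by field; rewrite gt_eqF// expR_gt0.
rewrite -mulr_suml ler_pM2r// -mulr_sumr.
apply: (@le_trans _ _ (2 * delta * gap f z * 64 ^+ n)).
  by rewrite ler_pM2l ?mulr_gt0// node_gauss_sum.
by rewrite /delta le_eqVlt; apply/predU1P; left; field; rewrite expf_neq0.
Qed.

Lemma bump_large z : vnorm z = 1 -> exists g, block_gain * (2 * gap f z) <= cabs (bump g z).
Proof.
move=> z1; have z1' : vnorm z <= 1 by rewrite z1.
have [g [g1 g2]] := node_near m_gt0 z1'; exists g.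
rewrite z1 in g1; rewrite cabs_bump z1 expr1n subrr mulr0 oppr0 expR0 mulr1 /bump_coef g1.
have := HK g1 z1'; rewrite vnormB.
set d := vnorm _ ^+ 2 in g2 *; have d0 : 0 <= d by exact: sqr_ge0.
have gz := gap_gt0 z1'; have gg := gap_gt0 g1 => h.
have {}h : gap f z <= 2 * gap f (node R g) * expR (n + n)%:R.
  apply: le_trans h _; rewrite ler_pM2l ?mulr_gt0// ler_expR; apply: le_trans g2.
  by rewrite ler_wpM2r.
have h2 : expR (- (4 * n%:R)) <= expR (- (2 * m%:R ^+ 2 * d)).
  by rewrite ler_expR lerN2; move: g2; rewrite natrD; lra.
apply: (@le_trans _ _ (delta * gap f (node R g) * expR (- (4 * n%:R)))); last first.
  by rewrite ler_wpM2l// mulr_ge0 ?ltW.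
have -> : block_gain * (2 * gap f z) = delta / 2 * expR (- (6 * n%:R)) * gap f z.
  by rewrite /block_gain /delta; field; rewrite expf_neq0.
apply: (@le_trans _ _ (delta / 2 * expR (- (6 * n%:R)) * (2 * gap f (node R g) * expR (n + n)%:R))).
  by rewrite ler_wpM2l// !mulr_ge0 ?expR_ge0 ?invr_ge0 ?ltW.
have -> : expR (- (4 * n%:R)) = expR (- (6 * n%:R)) * expR (n + n)%:R :> R.
  by rewrite -expRD natrD; congr expR; ring.
by rewrite le_eqVlt; apply/predU1P; left; field.
Qed.

End one_block.

End block.

Section block_step.
Variables (R : realType) (n : nat).
Local Notation C := (CC R).
Local Notation V := ('rV[C]_n).
Local Notation T := (Rspace R (n + n)).
Local Notation sigma := (@sphere_measure R n).
Implicit Types (f : V -> C) (z y : V).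

Lemma bump_phase_mean f m K z : (0 < m)%N -> admissible f -> K <= m%:R ^+ 2 ->
  (forall z y, vnorm z <= 1 -> vnorm y <= 1 ->
    gap f y <= 2 * gap f z * expR (K * vnorm (z - y) ^+ 2)) ->
  vnorm z = 1 ->
  phase_mean (f z) [seq bump f (m := m) g z | g <- index_enum _] <=
    block_factor R n * defect (f z).
Proof.
move=> m0 fadm Km HK z1; have z1' : vnorm z <= 1 by rewrite z1.
have G0 := gap_gt0 fadm z1'.
have [g Hg] := bump_large m0 fadm Km HK z1.
have S := sum_bump m0 fadm Km HK z1'; rewrite z1 expr1n subrr mulr0 oppr0 expR0 mulr1 in S.
have SE : \sum_(w <- [seq bump f (m := m) g z | g <- index_enum _]) cabs w =
    \sum_g cabs (bump f (m := m) g z) by rewrite big_map.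
have /andP[c0 c1] := block_gain_itv R n.
have a0 := cabs_ge0 (f z).
have GE : gap f z = 1 - cabs (f z) ^+ 2 by [].
have a1 : cabs (f z) < 1 by nra.
(* Both inequalities on sums follow from gap / 2 <= 1 - |f z| <= gap, the total perturbation being
   at most gap / 64. *)
apply: (@phase_mean_gain R (f z) _ (bump f g z) (gap f z / 64) (2 * gap f z)) => //.
- by rewrite divr_gt0.
- exact: ltW.
- move=> w /mapP[k _ ->]; apply: le_trans S.
  by rewrite (bigD1 k)//= lerDl sumr_ge0// => *; exact: cabs_ge0.
- by rewrite SE; nra.
- by rewrite SE; nra.
- by apply/mapP; exists g => //; rewrite mem_index_enum.
Qed.

Lemma block_step f (r e : R) : admissible f -> 0 <= r -> r < 1 -> 0 < e ->
  exists f', [/\ admissible f',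
    forall z, vnorm z <= r -> cabs (f' z - f z) <= e,
    forall z, vnorm z <= 1 -> cabs (f' z - f z) <= gap f z / 64 &
    (sphere_defect f' <= (block_factor R n)%:E * sphere_defect f)%E].
Proof.
move=> fadm r0 r1 e0; have [K K0 HK] := gap_compare fadm.
have r2 : 0 < 1 - r ^+ 2 by nra.
(* An m >= x has m^2 >= K, for the comparison of gaps, and m^2 (1 - r^2) >= 1 / e, which makes the
   bumps small on the ball of radius [r]. *)
pose x := K + (e * (1 - r ^+ 2))^-1.
have x0 : 0 <= x by rewrite addr_ge0// invr_ge0 ltW// mulr_gt0.
pose m := (Num.truncn x).+1; have m0 : (0 < m)%N by [].
have xm : x < m%:R by exact: truncnS_gt.
have m1 : 1 <= m%:R :> R by rewrite ler1n.
have mm : m%:R <= m%:R ^+ 2 :> R by rewrite expr2 ler_peMl// ltW// (lt_le_trans ltr01).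
have Km : K <= m%:R ^+ 2.
  apply: le_trans mm; apply: le_trans (ltW xm).
  by rewrite lerDl invr_ge0 ltW// mulr_gt0.
have em : expR (- (2 * m%:R ^+ 2 * (1 - r ^+ 2))) <= e.
  apply: le_trans (expR_le_inv _) _; first by rewrite !mulr_ge0 ?sqr_ge0// ltW.
  rewrite -[e]invrK lef_pV2 ?posrE ?invr_gt0//; last first.
    by rewrite ltr_pwDl// !mulr_ge0 ?sqr_ge0// ltW.
  have : (e * (1 - r ^+ 2))^-1 <= m%:R ^+ 2.
    by apply: le_trans mm; apply: le_trans (ltW xm); rewrite lerDr.
  rewrite invfM ler_pdivrMr// => h; have : 0 <= m%:R ^+ 2 * (1 - r ^+ 2).
    by rewrite mulr_ge0 ?sqr_ge0// ltW.
  by rewrite -mulrA; move: (e^-1) (_ * _) h => *; lra.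
have [[rho rho1 rf] [eta eta0 feta]] := fadm.
have mf := regular_cmeasurable rho1 rf.
have mb g := regular_cmeasurable rho1 (regular_bump f (m := m) rho g).
have [us [sus usp H]] := phase_choice sigma mb (index_enum _) mf.
pose f' z := f z + \sum_(p <- zip us (index_enum _)) p.1 * bump f (m := m) p.2 z.
have df z : vnorm z <= 1 -> cabs (f' z - f z) <=
    gap f z / 64 * expR (- (2 * m%:R ^+ 2 * (1 - vnorm z ^+ 2))).
  move=> z1; apply: le_trans (sum_bump m0 fadm Km HK z1); rewrite /f' addrC addKr.
  exact: (zip_phase_bound (fun g => bump f g z) sus usp).
have df1 z : vnorm z <= 1 -> cabs (f' z - f z) <= gap f z / 64.
  move=> z1; apply: le_trans (df z z1) _; rewrite ler_piMr//.
    by rewrite divr_ge0// ltW// gap_gt0.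
  rewrite -[leRHS]expR0 ler_expR oppr_le0 !mulr_ge0 ?sqr_ge0// subr_ge0.
  by rewrite expr_le1// vnorm_ge0.
exists f'; split => //.
- split.
    exists rho; first exact: rho1.
    apply: (regularD rf).
    by apply: (regular_sum _ (f := fun p z => p.1 * bump f p.2 z)) => p; apply: regularZ; exact: regular_bump.
  exists (eta / 2) => [|z z1]; first by rewrite divr_gt0.
  have := df1 z z1; have := feta z z1; have a0 := cabs_ge0 (f z).
  have := cabsD (f' z - f z) (f z); rewrite subrK /gap; nra.
- move=> z zr; have z1 : vnorm z <= 1 by lra.
  apply: le_trans (df z z1) _; rewrite -[leRHS]mul1r; apply: ler_pM; rewrite ?expR_ge0//.
  + by rewrite divr_ge0// ltW// gap_gt0.
  + have := sqr_ge0 (cabs (f z)); rewrite /gap; lra.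
  apply: le_trans em; rewrite ler_expR lerN2 ler_wpM2l ?mulr_ge0 ?sqr_ge0//.
  by rewrite lerD2l lerN2 lerXn2r ?nnegrE ?vnorm_ge0.
- apply: le_trans H _.
  have /andP[q0 q1] := block_factor_itv R n.
  have md := (measurable_EFinP _ _).2 (measurable_defect mf).
  have d0 t : setT t -> (0 <= (defect (f (cx (@direction R (n + n) t))))%:E)%E.
    by rewrite lee_fin defect_ge0.
  have q0' : (0 <= (block_factor R n)%:E)%E by rewrite lee_fin ltW.
  rewrite /sphere_defect /mean_defect -(ge0_integralZl sigma measurableT md d0 q0').
  apply: ae_ge0_le_integral => //.
  + by move=> t _; rewrite lee_fin phase_mean_ge0.
  + exact: (measurable_EFinP _ _).2 (measurable_phase_mean mb _ mf).
  + by move=> t tT; rewrite mule_ge0// d0.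
  + exact: emeasurable_funM (measurable_cst _) md.
  have sph : {ae sigma, forall t : T, enorm t = 1} := surface_measure_sphere R (n + n).
  apply: filterS sph => t t1 _; rewrite -EFinM lee_fin.
  apply: (bump_phase_mean m0 fadm Km HK).
  by rewrite vnorm_cx_direction// t1 oner_neq0.
Qed.

End block_step.

(** * Construction of inner functions *)

Section summation.
Variable R : realType.

Lemma halfpow_gt0 k : 0 < (2^-1 : R) ^+ k.
Proof. by rewrite exprn_gt0// invr_gt0. Qed.

Lemma halfpow_small (e : R) : 0 < e -> exists N, forall k, (N <= k)%N -> (2^-1) ^+ k < e.
Proof.
move=> e0; have [N _ H] := near_infty_natSinv_expn_lt (PosNum e0); exists N => k Nk.
by have := H k Nk; rewrite /= div1r exprVn.
Qed.

Lemma bounded_tails (h : nat -> R) (B e : R) : (forall k, 0 <= h k) ->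
  (forall K, \sum_(0 <= k < K) h k <= B) -> 0 < e ->
  exists K, forall k i, (K <= k)%N -> (k <= i)%N -> \sum_(k <= j < i) h j <= e.
Proof.
move=> h0 hB e0; pose E := [set \sum_(0 <= k < K) h k | K in [set: nat]].
have ubE : has_ubound E by exists B => _ [K _ <-].
have supE : has_sup E by split => //; exists (\sum_(0 <= k < 0) h k), 0%N.
have [_ [K _ <-] HK] := sup_adherent e0 supE.
exists K => k i Kk ki.
have : \sum_(0 <= k < i) h k <= sup E by apply: ub_le_sup => //; exists i.
rewrite (big_cat_nat (leq0n k) ki) (big_cat_nat (leq0n K) Kk) /=.
have : 0 <= \sum_(K <= j < k) h j by apply: sumr_ge0.
by move: HK; move: (sup E) (\sum_(0 <= j < K) h j) (\sum_(K <= j < k) h j) (\sum_(k <= j < i) h j)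
  => s x y z; lra.
Qed.

(** The sum of the series has integral at most c / (1 - q), so it is finite almost everywhere. *)
Lemma finite_sum_ae d (T : measurableType d) (mu : {measure set T -> \bar R})
    (v : nat -> T -> R) (q c : R) : 0 <= q -> q < 1 -> 0 <= c ->
  (forall k, measurable_fun setT (v k)) -> (forall k t, 0 <= v k t) ->
  (forall k, (\int[mu]_t (v k t)%:E <= (q ^+ k * c)%:E)%E) ->
  {ae mu, forall t, exists B : R, forall K, \sum_(0 <= k < K) v k t <= B}.
Proof.
move=> q0 q1 c0 mv v0 vq.
pose S t := (\sum_(0 <= k <oo) (v k t)%:E)%E.
have mvE k : measurable_fun setT (fun t => (v k t)%:E) by exact: (measurable_EFinP _ _).2.
have v0E k t : setT t -> (0 <= (v k t)%:E)%E by rewrite lee_fin.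
have geo K : \sum_(0 <= k < K) q ^+ k * c <= c / (1 - q).
  rewrite ler_pdivlMr ?subr_gt0// -mulr_suml.
  rewrite mulrAC; have -> : (\sum_(0 <= k < K) q ^+ k) * (1 - q) = 1 - q ^+ K.
    elim: K => [|K IH]; first by rewrite big_nil mul0r expr0 subrr.
    by rewrite big_nat_recr//= mulrDl IH exprS; ring.
  by rewrite ler_piMl// lerBlDr lerDl exprn_ge0.
have Sfin : (\int[mu]_t S t <= (c / (1 - q))%:E)%E.
  rewrite (integral_nneseries mu measurableT mvE v0E); apply: lime_le.
    by apply: is_cvg_nneseries => k _ _; apply: integral_ge0 => t _; rewrite lee_fin.
  apply: nearW => K; apply: (@le_trans _ _ (\sum_(0 <= k < K) (q ^+ k * c)%:E)%E).
    by apply: lee_sum => k _; exact: vq.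
  by rewrite sumEFin lee_fin geo.
have S0 t : (0 <= S t)%E by apply: nneseries_ge0 => k _ _; rewrite lee_fin.
have intS : mu.-integrable setT S.
  apply/integrableP; split.
    apply: (ge0_emeasurable_sum (P := xpredT)) => [k t _ _|k _]; [by rewrite lee_fin|exact: mvE].
  under eq_integral do rewrite gee0_abs//.
  exact: le_lt_trans Sfin (ltry _).
apply: filterS (integrable_ae measurableT intS) => t /(_ I) fS.
exists (fine (S t)) => K; rewrite -lee_fin fineK// -sumEFin.
by apply: nneseries_lim_ge => k _ _; rewrite lee_fin.
Qed.

End summation.

(** * The limit of the iteration and its radial limits *)

Section inner_approximation.
Variables (R : realType) (n : nat).
Local Notation C := (CC R).
Local Notation V := ('rV[C]_n).
Local Notation T := (Rspace R (n + n)).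
Local Notation sigma := (@sphere_measure R n).
Local Notation half k := ((2^-1 : R) ^+ k).
Implicit Types (f : V -> C) (z : V).

(** The radius [r] separates two regimes: from [r] outwards f is radially almost constant, while
    inside [r] the change from f to f' is negligible. The bound by 1 - 2^-k makes the radii tend to
    1, and [rstar] is the radius of the ball on which the initial function is approximated. *)
Record next_block (rstar e : R) (k : nat) f (r : R) f' : Prop := NextBlock {
  next_rstar : rstar <= r;
  next_half : 1 - half k <= r;
  next_lt1 : r < 1;
  next_near : forall s z, r <= s -> s <= 1 -> vnorm z <= 1 ->
    cabs (f (toC s *: z) - f z) <= half k;
  next_adm : admissible f';
  next_small : forall z, vnorm z <= r -> cabs (f' z - f z) <= e / 2 * half k;
  next_gap : forall z, vnorm z <= 1 -> cabs (f' z - f z) <= gap f z / 64;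
  next_defect : (sphere_defect f' <= (block_factor R n)%:E * sphere_defect f)%E }.

Lemma next_block_ex (rstar e : R) k f : 0 <= rstar -> rstar < 1 -> 0 < e ->
  admissible f -> exists r f', next_block rstar e k f r f'.
Proof.
move=> s0 s1 e0 fadm; have [[rho rho1 rf] _] := fadm.
have [L L0 HL] := regular_lipschitz rho1 rf.
have hk := halfpow_gt0 R k.
(* The last term makes the Lipschitz bound L (1 - s) at most 2^-k. *)
pose r := Num.max rstar (Num.max (1 - half k) (1 - half k / L)).
have r1 : r < 1.
  rewrite !gt_max s1 /=; apply/andP; split; first by rewrite ltrBlDr ltrDl.
  by rewrite ltrBlDr ltrDl divr_gt0.
have r0 : 0 <= r by rewrite le_max s0.
have ek : 0 < e / 2 * half k by rewrite mulr_gt0// divr_gt0.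
have [f' [adm' sm gp df]] := block_step fadm r0 r1 ek.
exists r, f'; split => //.
- by rewrite le_max lexx.
- by rewrite !le_max lexx orbT.
move=> s z rs sle1 z1; have s0' : 0 <= s by apply: le_trans rs.
have sz : vnorm (toC s *: z) <= 1.
  by rewrite vnormZ cabs_toC ger0_norm// mulr_ile1 ?vnorm_ge0.
apply: le_trans (HL _ _ z1 sz) _.
have -> : toC s *: z - z = toC (s - 1) *: z by rewrite toCD toCN scalerDl scaleNr scale1r.
rewrite vnormZ cabs_toC ler0_norm ?subr_le0// opprB.
apply: (@le_trans _ _ (L * (1 - s))).
  by rewrite ler_pM2l// ler_piMr// subr_ge0.
rewrite mulrC -ler_pdivlMr//; have : 1 - half k / L <= r by rewrite !le_max lexx !orbT.
by move: (half k / L) => x; lra.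
Qed.

Section iteration.
Variables (rstar e : R) (f : nat -> V -> C) (r : nat -> R).
Hypotheses (rstar_ge0 : 0 <= rstar) (e_gt0 : 0 < e).
Hypothesis f0_adm : admissible (f 0%N).
Hypothesis blocks : forall k, next_block rstar e k (f k) (r k) (f k.+1).

Lemma iter_adm k : admissible (f k).
Proof. by case: k => // k; exact: next_adm (blocks k). Qed.

Lemma iter_le1 k z : vnorm z <= 1 -> cabs (f k z) <= 1.
Proof. by have [_ [eta eta0 H]] := iter_adm k => /H; lra. Qed.

Lemma iter_gap_ge0 k z : vnorm z <= 1 -> 0 <= gap (f k) z.
Proof. by move=> z1; exact: ltW (gap_gt0 (iter_adm k) z1). Qed.

Lemma iter_differentiable k z : vnorm z < 1 -> differentiable (f k) z.
Proof.
by have [[rho rho1 [df _]] _] := iter_adm k => z1; apply: df; exact: lt_trans rho1.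
Qed.

Lemma iter_small k i z : (k <= i)%N -> (forall j, (k <= j)%N -> vnorm z <= r j) ->
  cabs (f i z - f k z) <= e * (half k - half i).
Proof.
move=> ki zr; rewrite -(subnK ki) addnC; elim: (i - k)%N => [|j IH].
  by rewrite addn0 !subrr cabs0 mulr0.
rewrite -(subrK (f (k + j)%N z) (f (k + j.+1)%N z)) -addrA.
apply: le_trans (cabsD _ _) _; rewrite addnS.
have := next_small (blocks (k + j)) (zr _ (leq_addr j k)).
by rewrite [half (k + j).+1]exprS; move: IH; rewrite !mulrBr; lra.
Qed.

Lemma iter_gap k i z : (k <= i)%N -> vnorm z <= 1 ->
  cabs (f i z - f k z) <= \sum_(k <= j < i) gap (f j) z.
Proof.
move=> ki z1; rewrite -(subnK ki) addnC; elim: (i - k)%N => [|j IH].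
  by rewrite addn0 subrr cabs0 big_geq.
rewrite addnS big_nat_recr ?leq_addr//=.
rewrite -(subrK (f (k + j)%N z) (f (k + j).+1 z)) -addrA.
apply: le_trans (cabsD _ _) _; rewrite [leRHS]addrC; apply: lerD IH.
apply: le_trans (next_gap (blocks (k + j)) z1) _.
have := iter_gap_ge0 (k + j) z1; lra.
Qed.

Section limit.
Variables (U : set_system nat) (F : V -> C).
Hypothesis UU : UltraFilter U.
Hypothesis Uoo : \oo `<=` U.
Hypothesis fF : forall z, vnorm z <= 1 -> clim U (fun k => f k z) (F z).

Lemma limit_tail k z B : vnorm z <= 1 ->
  (forall i, (k <= i)%N -> cabs (f i z - f k z) <= B) -> cabs (F z - f k z) <= B.
Proof.
move=> z1 H; apply: (@clim_le _ U _ (fun i => f i z - f k z)).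
  move=> e' e'0; apply: filterS (fF z1 e'0) => i /=.
  by rewrite opprB addrA subrK.
by apply: Uoo; exists k => // i ki /=; exact: H.
Qed.

Lemma limit_small k z : vnorm z <= 1 -> (forall j, (k <= j)%N -> vnorm z <= r j) ->
  cabs (F z - f k z) <= e * half k.
Proof.
move=> z1 zr; apply: limit_tail => // i ki; apply: le_trans (iter_small ki zr) _.
by rewrite ler_pM2l// lerBlDr lerDl ltW// halfpow_gt0.
Qed.

Lemma limit_boundary zeta (B : R) : vnorm zeta <= 1 ->
  (forall K, \sum_(0 <= k < K) defect (f k zeta) <= B) ->
  has_boundary_value F zeta (F zeta) /\ cabs (F zeta) = 1.
Proof.
move=> z1 HB; pose h k := gap (f k) zeta.
have h0 k : 0 <= h k by exact: iter_gap_ge0.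
(* The gap is the square of the defect, which is at most 1; so the gaps, which bound the increments,
   are summable too. *)
have hd k : h k <= defect (f k zeta).
  have -> : h k = defect (f k zeta) ^+ 2 by rewrite /defect sqr_sqrtr//; exact: h0.
  by rewrite expr2 ler_piMr ?defect_ge0// defect_le1.
have hB K : \sum_(0 <= k < K) h k <= B by apply: le_trans (HB K); exact: ler_sum.
have tail e' : 0 < e' -> exists K, forall k, (K <= k)%N ->
    cabs (F zeta - f k zeta) <= e' /\ h k <= e'.
  move=> e'0; have [K HK] := bounded_tails h0 hB e'0; exists K => k Kk; split.
    by apply: limit_tail => // i ki; apply: le_trans (iter_gap ki z1) _; exact: HK.
  by have := HK k k.+1 Kk (leqnSn k); rewrite big_nat1.
split; last first.
  apply/eqP; rewrite eq_le; apply/andP; split.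
    apply: (clim_le (fF z1)); apply: filterS filterT => k _; exact: iter_le1.
  apply/ler_addgt0Pl => e' e'0; have e2 : 0 < e' / 2 by rewrite divr_gt0.
  have [K HK] := tail _ e2; have [h1 h2] := HK K (leqnn K).
  have := cabsD (f K zeta - F zeta) (F zeta); rewrite subrK cabsC.
  have := cabs_ge0 (f K zeta); have := iter_le1 K z1.
  by move: h1 h2; rewrite /h /gap; move: (cabs (f K zeta)) => a *; nra.
(* The four terms of the decomposition [tri] will be at most e e', 3 e' / 64, e' and e'. *)
apply/has_boundary_valueP => eps eps0; pose e' := eps / (e + 4).
have e40 : 0 < e + 4 by rewrite addr_gt0.
have e'0 : 0 < e' by rewrite divr_gt0.
have [K1 HK1] := tail _ e'0; have [K2 HK2] := halfpow_small e'0.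
pose K := maxn K1 K2; exists (1 - r K); first by rewrite subr_gt0; exact: next_lt1 (blocks K).
move=> s; rewrite opprB addrC subrK => rs s1.
have s10 : 0 < 1 - s by rewrite subr_gt0.
(* [r] need not be monotone: let [k] be the largest index with [r k <= s] *)
have [N HN] := halfpow_small s10.
have r_ge j : rstar <= r j by exact: next_rstar (blocks j).
have exP : exists j, r j <= s by exists K; exact: ltW.
have ubP j : r j <= s -> (j <= N)%N.
  move=> rj; rewrite leqNgt; apply/negP => /ltnW /HN.
  by have := next_half (blocks j); lra.
have [k ks kmax] := ex_maxnP exP ubP.
have Kk : (K <= k)%N by apply: kmax; exact: ltW.
have [t1 t2] := HK1 k (leq_trans (leq_maxl _ _) Kk).
have t3 := HK2 k (leq_trans (leq_maxr _ _) Kk).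
have s0 : 0 <= s by apply: le_trans rstar_ge0 (le_trans (r_ge k) ks).
have sz : vnorm (toC s *: zeta) <= s.
  by rewrite vnormZ cabs_toC ger0_norm// ler_piMr.
have sz1 : vnorm (toC s *: zeta) <= 1 by apply: le_trans sz _; exact: ltW.
have near := next_near (blocks k) ks (ltW s1) z1.
(* By maximality of [k], s < r j for every j > k, so all later perturbations are small at s zeta. *)
have far : cabs (F (toC s *: zeta) - f k.+1 (toC s *: zeta)) <= e * half k.+1.
  apply: limit_small => // j kj; apply: le_trans sz _; rewrite leNgt; apply/negP => rj.
  by have := kmax j (ltW rj); rewrite leqNgt kj.
have mid := next_gap (blocks k) sz1.
have gp : gap (f k) (toC s *: zeta) <= 3 * e'.
  have := le_trans (cabsB_dist _ _) near; rewrite ler_norml => /andP[n1 n2].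
  have := iter_le1 k z1; have := iter_le1 k sz1; have := cabs_ge0 (f k zeta).
  have := cabs_ge0 (f k (toC s *: zeta)); move: t2 n1 n2; rewrite /h /gap.
  by move: (cabs (f k zeta)) (cabs (f k (toC s *: zeta))) => a b; nra.
have tri : F (toC s *: zeta) - F zeta =
   (F (toC s *: zeta) - f k.+1 (toC s *: zeta)) +
   ((f k.+1 (toC s *: zeta) - f k (toC s *: zeta)) +
   ((f k (toC s *: zeta) - f k zeta) + (f k zeta - F zeta))) by ring.
rewrite tri; apply: le_lt_trans (cabsD _ _) _.
apply: (@lt_le_trans _ _ ((e + 4) * e')); last first.
  by rewrite /e' mulrC divfK ?gt_eqF.
have hk1 : e * half k.+1 <= e * e'.
  rewrite ler_pM2l//; apply: le_trans (ltW t3); rewrite exprS ler_piMl ?(ltW (halfpow_gt0 _ _))//.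
  by rewrite invf_le1// ler1n.
have b1 := cabsD (f k.+1 (toC s *: zeta) - f k (toC s *: zeta))
  ((f k (toC s *: zeta) - f k zeta) + (f k zeta - F zeta)).
have b2 := cabsD (f k (toC s *: zeta) - f k zeta) (f k zeta - F zeta).
rewrite cabsC in t1.
by rewrite mulrDl; move: (e * e') hk1 => ee hk1; lra.
Qed.

End limit.
End iteration.

Lemma block_sequence (rstar e : R) f0 : 0 <= rstar -> rstar < 1 -> 0 < e ->
  admissible f0 -> exists (f : nat -> V -> C) (r : nat -> R), f 0%N = f0 /\
    forall k, next_block rstar e k (f k) (r k) (f k.+1).
Proof.
move=> rs0 rs1 e0 f0adm.
have ex (x : nat * (V -> C)) : exists y : R * (V -> C),
    admissible x.2 -> next_block rstar e x.1 x.2 y.1 y.2.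
  have [adm|nadm] := pselect (admissible x.2); last by exists (0, x.2).
  by have [r [f' H]] := next_block_ex x.1 rs0 rs1 e0 adm; exists (r, f').
have [h hP] := choice ex.
pose fs := fix fs k := if k is j.+1 then (h (j, fs j)).2 else f0.
have adm k : admissible (fs k).
  by elim: k => // k IH; exact: next_adm (hP (k, fs k) IH).
by exists fs, (fun k => (h (k, fs k)).1); split => // k; exact: hP (k, fs k) (adm k).
Qed.

Lemma inner_near (rstar e : R) f0 : 0 <= rstar -> rstar < 1 -> 0 < e ->
  admissible f0 -> exists F : V -> C, inner_function F /\
    forall z, vnorm z <= rstar -> cabs (F z - f0 z) <= e.
Proof.
move=> rs0 rs1 e0 adm0.
have [f [r [f00 blocks]]] := block_sequence rs0 rs1 e0 adm0.
have adm0' : admissible (f 0%N) by rewrite f00.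
have le1 := iter_le1 adm0' blocks.
have [U [UU Uoo]] := ultraFilterLemma (F := \oo) _.
(* The limit is taken on the closed ball: on the sphere, [F] is the candidate for the radial
   limit. *)
have ex z : exists l, vnorm z <= 1 -> clim U (fun k => f k z) l.
  have [z1|] := boolP (vnorm z <= 1); last by exists 0.
  by have [l Hl] := clim_ultra UU (fun k => le1 k z z1); exists l.
have [F HF] := choice ex.
have FH : Hinfty F.
  apply/HinftyP; split.
    move=> z z1; apply: (clim_differentiable UU (M := 1) _ _ _ z1).
    - exact: (iter_differentiable adm0' blocks).
    - by move=> k w w1; apply: le1; exact: ltW.
    - by move=> w w1; apply: HF; exact: ltW.
  exists 1 => z z1; apply: (clim_le (HF z (ltW z1))); apply: filterS filterT => k _.
  by apply: le1; exact: ltW.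
exists F; split; last first.
  move=> z zr; have z1 : vnorm z <= 1 by apply: le_trans zr (ltW rs1).
  have zrj j : (0 <= j)%N -> vnorm z <= r j.
    by move=> _; exact: le_trans zr (next_rstar (blocks j)).
  by have := limit_small e0 blocks UU Uoo HF z1 zrj; rewrite expr0 mulr1 f00.
apply/inner_functionP; split => //.
pose v k (t : T) := defect (f k (cx (direction t))).
pose c := fine (sphere_defect (f 0%N)).
have /andP[q0 q1] := block_factor_itv R n.
have mv k : measurable_fun setT (v k).
  have [[rho rho1 rf] _] := iter_adm adm0' blocks k.
  exact: measurable_defect (regular_cmeasurable rho1 rf).
have sd0 k : (0 <= sphere_defect (f k))%E.
  by apply: integral_ge0 => t _; rewrite lee_fin defect_ge0.
have cE : sphere_defect (f 0%N) = c%:E.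
  rewrite fineK// ge0_fin_numE//.
  apply: (@le_lt_trans _ _ (\int[sigma]_t (cst 1%:E t))%E).
    apply: (ge0_le_integral sigma measurableT _ _ (measurable_cst _)).
    - by move=> t _; rewrite lee_fin defect_ge0.
    - exact: (measurable_EFinP _ _).2 (mv 0%N).
    - by move=> t _; rewrite lee_fin defect_le1.
  by rewrite (integral_cst sigma measurableT 1%:E) mul1e ltey_eq fin_num_measure.
have c0 : 0 <= c by rewrite -lee_fin -cE.
have vq k : (\int[sigma]_t (v k t)%:E <= (block_factor R n ^+ k * c)%:E)%E.
  elim: k => [|k IH]; first by rewrite expr0 mul1r -cE.
  apply: le_trans (next_defect (blocks k)) _; rewrite exprS -mulrA EFinM.
  by rewrite lee_pmul2l// lte_fin.
have sph : {ae sigma, forall t : T, enorm t = 1} := surface_measure_sphere R (n + n).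
have := finite_sum_ae (ltW q0) q1 c0 mv (fun k t => defect_ge0 _) vq.
apply: filterS2 sph => t t1 [B HB].
have z1 := vnorm_cx_direction_le1 t.
have [bv F1] := limit_boundary rs0 e0 adm0' blocks UU Uoo HF z1 HB.
by rewrite direction_id// in bv F1; exists (F (cx t)).
Qed.

End inner_approximation.

(** * Approximation of Schur functions *)

Section approximation.
Variables (R : realType) (n : nat).
Local Notation C := (CC R).
Local Notation V := ('rV[C]_n).

(** Dilating the argument gives holomorphy on the ball of radius 1 / rho; the factor in front keeps
    the modulus at most rho. *)
Lemma dilation_admissible (phi : V -> C) (rho : R) : 0 < rho -> rho < 1 ->
  (forall z, vnorm z < 1 -> differentiable phi z) ->
  (forall z, vnorm z < 1 -> cabs (phi z) <= 1) ->
  admissible (fun z => toC rho * phi (toC rho *: z)).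
Proof.
move=> r0 r1 dphi phi1; have inb (z : V) : vnorm z < rho^-1 -> vnorm (toC rho *: z) < 1.
  by rewrite vnormZ cabs_toC gtr0_norm// => zr; rewrite mulrC -ltr_pdivlMr// mul1r.
have ir : 1 < rho^-1 by rewrite invf_gt1.
split.
  exists rho^-1; first exact: ir.
  apply: regularZ; split; last by exists 1 => z zr; exact: phi1 (inb z zr).
  move=> z zr.
  have ds : differentiable (toC rho *: (id : V -> V)) z by exact: differentiableZ.
  exact: (differentiable_comp ds (dphi _ (inb z zr))).
exists (1 - rho) => [|z z1]; first by rewrite subr_gt0.
rewrite opprB addrC subrK cabsM cabs_toC gtr0_norm// ler_piMr// ?(ltW r0)//.
by apply: phi1; apply: inb; exact: le_lt_trans ir.
Qed.

Lemma schur_class_inner_approximation (phi : V -> C) (I : finType) (z : I -> V) :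
  schur_class phi -> (forall j, vnorm (z j) < 1) ->
  exists phi_ : nat -> V -> C, (forall k, inner_function (phi_ k)) /\
    forall j, phi_ k (z j) @[k --> \oo] --> phi (z j).
Proof.
move=> /schur_classP[dphi phi1] z1.
pose rs := \big[Num.max/0]_j vnorm (z j).
have rs0 : 0 <= rs by exact: bigmax_ge_id.
have rs1 : rs < 1 by apply: bigmax_lt => // j _; exact: z1.
have zrs j : vnorm (z j) <= rs by exact: le_bigmax.
(* [e k] is both the accuracy and the distance of the dilation factor to 1; starting at 1/2 keeps
   that factor positive. *)
pose e k : R := (k.+2%:R)^-1.
have e0 k : 0 < e k by rewrite invr_gt0.
have e1 k : e k < 1 by rewrite invf_lt1// ltr1n.
have ex k : exists F : V -> C, inner_function F /\ forall w, vnorm w <= rs ->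
    cabs (F w - toC (1 - e k) * phi (toC (1 - e k) *: w)) <= e k.
  apply: inner_near => //; apply: dilation_admissible => //; first by rewrite subr_gt0.
  by rewrite ltrBlDr ltrDl.
have [F HF] := choice ex; exists F; split; first by move=> k; exact: (HF k).1.
move=> j; apply/cabs_cvgP => eps eps0.
have eps3 : 0 < eps / 3 by rewrite divr_gt0.
have [d d0 Hd] := bounded_holomorphic_continuous dphi phi1 (z1 j) eps3.
have m0 : 0 < Num.min d (eps / 3) by rewrite lt_min d0.
apply: filterS (near_infty_natSinv_lt (PosNum m0)) => k /= Hk.
have {Hk} : e k < Num.min d (eps / 3).
  by apply: le_lt_trans Hk; rewrite lef_pV2 ?posrE ?ltr0n// ler_nat.
rewrite lt_min => /andP[ed eeps].
have F1 := (HF k).2 _ (zrs j).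
set w := toC (1 - e k) *: z j in F1.
have we : w = z j + toC (- e k) *: z j by rewrite /w toCD toC1 scalerDl scale1r.
have w1 : cabs (phi w - phi (z j)) < eps / 3.
  rewrite we; apply: Hd; rewrite vnormZ cabs_toC normrN (gtr0_norm (e0 k)).
  by apply: le_lt_trans ed; rewrite ler_piMr ?(ltW (e0 k))// ltW.
have wb : vnorm w < 1.
  rewrite vnormZ cabs_toC ger0_norm; last by rewrite subr_ge0 ltW.
  by apply: le_lt_trans (z1 j); rewrite ler_piMl ?vnorm_ge0// lerBlDr lerDl ltW.
have -> : F k (z j) - phi (z j) = (F k (z j) - toC (1 - e k) * phi w) +
    ((toC (- e k) * phi w) + (phi w - phi (z j))) by rewrite toCD toC1; ring.
have b1 := cabsD (F k (z j) - toC (1 - e k) * phi w) ((toC (- e k) * phi w) + (phi w - phi (z j))).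
have b2 := cabsD (toC (- e k) * phi w) (phi w - phi (z j)).
have b3 : cabs (toC (- e k) * phi w) <= e k.
  by rewrite cabsM cabs_toC normrN (gtr0_norm (e0 k)) ler_piMr ?(ltW (e0 k))// phi1.
by move: (e k) F1 eeps b3 b1 b2 => *; lra.
Qed.

End approximation.

Unset Implicit Arguments.
Set Strict Implicit.
Set Printing Implicit Defensive.

Theorem theorem3 (R : realType) (n m : nat) (n_ge1 : (1 <= n)%N)
    (z : 'I_m -> 'rV[R[i]]_n) (w : 'I_m -> R[i])
    (z_inj : injective z)
    (z_ball : forall j, unit_ball (z j))
    (w_disc : forall j, `|w j| < 1) :
  (exists phi : 'rV[R[i]]_n -> R[i],
      schur_class phi /\ forall j, phi (z j) = w j) <->
  (exists phi_ : nat -> 'rV[R[i]]_n -> R[i],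
      (forall k, inner_function (phi_ k)) /\
      forall j, phi_ k (z j) @[k --> \oo] --> w j).
Proof.
have z1 j : vnorm (z j : 'rV[CC R]_n) < 1 by apply/unit_ballP; exact: z_ball.
split.
  move=> [phi [phiS phiw]].
  have [F [inF cF]] := schur_class_inner_approximation phiS z1.
  exists F; split; first exact: inF.
  move=> j; have := cF j; rewrite phiw; exact: id.
move=> [F [inF cF]].
have dF k : forall x : 'rV[CC R]_n, vnorm x < 1 -> differentiable (F k : 'rV[CC R]_n -> CC R) x.
  by have /inner_functionP[/HinftyP[]] := inF k.
have [phi [phiS H]] := schur_class_limit dF (fun k => inner_function_le1 n_ge1 (inF k)).
exists phi; split; first exact: phiS.
by move=> j; exact: (H _ _ (z1 j) (cF j)).
Qed.
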